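(* Let $R_S$ denote the homogeneous coordinate ring of the spinor variety $S^{10}\subset\mathbb{P}^{15}$ and let $A=\mathbb{C}[x_0,\dots,x_4]/I$ be a graded Artinian Gorenstein ring with Hilbert function $(1,5,5,1)$. If $A$ is general, then there exists a regular sequence of linear forms $h_0,\dots,h_{10}\in R_S$ such that $A\cong R_S/(h_0,\dots,h_{10})$.
   Context: The spinor variety $S^{10}\subset\mathbb{P}^{15}$ is one of the two isomorphic 10-dimensional irreducible families of $\mathbb{P}^4$'s contained in a smooth 8-dimensional quadric $Q^8\subset\mathbb{P}^9$, embedded in $\mathbb{P}^{15}$ by the half-spin representation. By Macaulay's correspondence, graded Artinian Gorenstein quotients $A$ of a polynomial ring $T=\mathbb{C}[\partial_0,\dots,\partial_4]$ with socle in degree $3$ correspond bijectively to cubic forms $f\in\mathbb{C}[x_0,\dots,x_4]$ up to nonzero scalar, via $A=T/f^{\perp}$, $f^\perp=\{D\in T\mid D(f)=0\}$, where $T$ acts by differentiation; $f$ is the dual polynomial of $A$. ''$A$ is general'' means that the dual cubic polynomial of $A$ is general, i.e. lies in a suitable nonempty Zariski open subset of the space of cubic forms in 5 variables. *)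

(* Defs.v *)
From HB Require Import structures.
From mathcomp Require Import all_boot all_order all_algebra.
From mathcomp Require Import mpoly.
From mathcomp Require Import complex.
From mathcomp Require Import boolp reals.
From mathcomp Require Import ring.

Set Implicit Arguments.
Unset Strict Implicit.
Unset Printing Implicit Defensive.

Import GRing.Theory.

Local Open Scope ring_scope.
Local Open Scope quotient_scope.

(* Unlike [idealr] of ring_quotient, an [ideal] is a Prop-valued predicate (no
   decidability) and may be the whole ring, so that R/I is always defined. *)
Record ideal (R : comPzRingType) := Ideal {
  ideal_mem :> R -> Prop;
  ideal_mem0 : ideal_mem 0;
  ideal_memD : forall x y, ideal_mem x -> ideal_mem y -> ideal_mem (x + y);
  ideal_memM : forall a x, ideal_mem x -> ideal_mem (a * x) }.

Section IdealQuotient.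

Variables (R : comPzRingType) (I : ideal R).

Lemma ideal_memN x : I x -> I (- x).
Proof. by move=> Ix; rewrite -mulN1r; apply: ideal_memM. Qed.

Definition ideal_pred : {pred R} := [pred x | `[< I x >]].

Lemma ideal_predP x : reflect (I x) (x \in ideal_pred).
Proof. exact: asboolP. Qed.

Lemma ideal_pred_zmod_closed : zmod_closed ideal_pred.
Proof.
split=> [|x y /ideal_predP Ix /ideal_predP Iy]; apply/ideal_predP.
  exact: ideal_mem0.
by apply: ideal_memD => //; apply: ideal_memN.
Qed.

HB.instance Definition _ :=
  GRing.isZmodClosed.Build R ideal_pred ideal_pred_zmod_closed.

Definition quot : Type := Quotient.quot (ideal_pred : zmodClosed R).

HB.instance Definition _ := ZmodQuotient.on quot.

Definition quot_pi (x : R) : quot := \pi_quot x.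

Lemma quot_piP x y : quot_pi x = quot_pi y <-> I (x - y).
Proof.
split=> [/eqP | Ixy].
  by rewrite -Quotient.idealrBE => /ideal_predP.
by apply/eqP; rewrite -Quotient.idealrBE; apply/ideal_predP.
Qed.

Lemma quot_pi_surj y : exists x, y = quot_pi x.
Proof. by exists (repr y); rewrite /quot_pi reprK. Qed.

Lemma quot_piB : {morph quot_pi : x y / x - y}.
Proof. by move=> x y; rewrite /quot_pi raddfB. Qed.

Lemma quot_piD : {morph quot_pi : x y / x + y}.
Proof. by move=> x y; rewrite /quot_pi raddfD. Qed.

Definition quot_one : quot := quot_pi 1.
Definition quot_mul (x y : quot) : quot := quot_pi (repr x * repr y).

Lemma quot_piM : {morph quot_pi : x y / x * y >-> quot_mul x y}.
Proof.
move=> x y; apply/quot_piP.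
have Ix : I (x - repr (quot_pi x)) by apply/quot_piP; rewrite /quot_pi reprK.
have Iy : I (y - repr (quot_pi y)) by apply/quot_piP; rewrite /quot_pi reprK.
set x' := repr _ in Ix *; set y' := repr _ in Iy *.
have -> : x * y - x' * y' = x * (y - y') + y' * (x - x').
  by rewrite !mulrBr [y' * x]mulrC [y' * x']mulrC addrA subrK.
by apply: ideal_memD; apply: ideal_memM.
Qed.

Lemma quot_mulA : associative quot_mul.
Proof.
move=> x y z; have [a ->] := quot_pi_surj x; have [b ->] := quot_pi_surj y.
by have [c ->] := quot_pi_surj z; rewrite -!quot_piM mulrA.
Qed.

Lemma quot_mulC : commutative quot_mul.
Proof.
move=> x y; have [a ->] := quot_pi_surj x; have [b ->] := quot_pi_surj y.
by rewrite -!quot_piM mulrC.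
Qed.

Lemma quot_mul1 : left_id quot_one quot_mul.
Proof.
by move=> x; have [a ->] := quot_pi_surj x; rewrite -!quot_piM mul1r.
Qed.

Lemma quot_mulDl : left_distributive quot_mul +%R.
Proof.
move=> x y z; have [a ->] := quot_pi_surj x; have [b ->] := quot_pi_surj y.
by have [c ->] := quot_pi_surj z; rewrite -quot_piD -!quot_piM -quot_piD mulrDl.
Qed.

HB.instance Definition _ := GRing.Zmodule_isComPzRing.Build quot
  quot_mulA quot_mulC quot_mul1 quot_mulDl.

HB.instance Definition _ := GRing.isZmodMorphism.Build R quot quot_pi quot_piB.
HB.instance Definition _ := GRing.isMonoidMorphism.Build R quot quot_pi
  (erefl, quot_piM).

End IdealQuotient.

(* A ring with the image of the scalars and its elements of degree d. No axiom is
   imposed: the data is a graded K-algebra for [gr_mpoly], and for [gr_quot A I]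
   when A is one and the ideal I is homogeneous. *)
Record gralg (K : fieldType) := GrAlg {
  gr_ring :> comPzRingType;
  gr_scal : {rmorphism K -> gr_ring};
  gr_part : nat -> gr_ring -> Prop }.

Section GradedAlgebras.

Variable K : fieldType.

Definition gr_mpoly (n : nat) : gralg K :=
  @GrAlg K {mpoly K[n]} (@mpolyC n K) (fun d p => p \is d.-homog).

Definition gr_quot (A : gralg K) (I : ideal A) : gralg K :=
  @GrAlg K (quot I) (quot_pi I \o gr_scal A)
    (fun d y => exists2 x, gr_part d x & y = quot_pi I x).

Definition gr_isomorphic (A B : gralg K) : Prop :=
  exists phi : {rmorphism A -> B},
    [/\ bijective phi,
        forall c, phi (gr_scal A c) = gr_scal B c &
        forall d x, gr_part d x <-> gr_part d (phi x)].

(* P is a linear subspace of A in all uses. *)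
Definition has_dim (A : gralg K) (P : A -> Prop) (r : nat) : Prop :=
  exists2 e : 'I_r -> A, forall i, P (e i) &
    forall x, P x ->
      exists! c : {ffun 'I_r -> K}, x = \sum_i gr_scal A (c i) * e i.

(* H lists the nonzero values of the Hilbert function. *)
Definition has_hilbert_function (A : gralg K) (H : seq nat) : Prop :=
  forall d, has_dim (@gr_part K A d) (nth 0%N H d).

Definition artinian (R : comPzRingType) : Prop :=
  forall J : nat -> ideal R, (forall k x, J k.+1 x -> J k x) ->
    exists N, forall k x, (N <= k)%N -> J N x -> J k x.

Definition socle (A : gralg K) (a : A) : Prop :=
  forall d x, gr_part d.+1 x -> x * a = 0 :> A.

(* For A graded with A_0 = K, the maximal ideal is A_+ and the residue field is
   K, so the Gorenstein condition is that the socle has dimension 1. *)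
Definition artinian_gorenstein (A : gralg K) : Prop :=
  artinian A /\ has_dim (@socle A) 1.

Definition homogeneous_ideal (n : nat) (I : ideal {mpoly K[n]}) : Prop :=
  forall p d, I p -> I (pihomog mdeg d p).

End GradedAlgebras.

Section RegularSequences.

Variables (R : comPzRingType) (k : nat) (h : 'I_k -> R).

Definition prefix_span (m : nat) (x : R) : Prop :=
  exists c : 'I_k -> R, x = \sum_(j < k | (j < m)%N) c j * h j.

Lemma prefix_span0 m : prefix_span m 0.
Proof.
by exists (fun=> 0); rewrite big1 // => j _; rewrite mul0r.
Qed.

Lemma prefix_spanD m x y :
  prefix_span m x -> prefix_span m y -> prefix_span m (x + y).
Proof.
move=> [c ->] [d ->]; exists (fun j => c j + d j).
by rewrite -big_split; apply: eq_bigr => j _; rewrite mulrDl.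
Qed.

Lemma prefix_spanM m a x : prefix_span m x -> prefix_span m (a * x).
Proof.
move=> [c ->]; exists (fun j => a * c j).
by rewrite mulr_sumr; apply: eq_bigr => j _; rewrite mulrA.
Qed.

(* The ideal (h_0, ..., h_(m-1)). *)
Definition prefix_ideal (m : nat) : ideal R :=
  Ideal (@prefix_span0 m) (@prefix_spanD m) (@prefix_spanM m).

Definition seq_ideal : ideal R := prefix_ideal k.

Definition regular_sequence : Prop :=
  (forall (i : 'I_k) (y : quot (prefix_ideal i)),
      quot_pi (prefix_ideal i) (h i) * y = 0 -> y = 0) /\
  1 <> 0 :> quot seq_ideal.

End RegularSequences.

Section Apolarity.

Variables (K : fieldType) (n : nat).

Definition diff_action (D f : {mpoly K[n]}) : {mpoly K[n]} :=
  \sum_(m <- msupp D) D@_m *: f^`M[m].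

Definition is_apolar_ideal (I : ideal {mpoly K[n]}) (f : {mpoly K[n]}) : Prop :=
  forall D, I D <-> diff_action D f = 0.

End Apolarity.

Definition zariski_open (K : fieldType) (V : vectType K) (U : V -> Prop) : Prop :=
  exists G : {mpoly K[\dim {:V}]} -> Prop, forall v,
    U v <-> exists2 g, G g & g.@[fun i => coord (vbasis {:V}) i v] != 0.

Section SpinorVariety.

Variable K : fieldType.

(* K^10 = W + W^* with W = K^5, and the quadric Q^8 = {quadric = 0}. *)
Definition hyperbolic : vectType K := ('rV[K]_5 * 'rV[K]_5)%type.

Definition quadric (v : hyperbolic) : K := \sum_i v.1 0 i * v.2 0 i.

(* An element s of the spin module \Lambda W, in the basis
   e_B = e_(b_1) /\ ... /\ e_(b_r), where B = {b_1 < ... < b_r}. *)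
Definition spinor := {ffun {set 'I_5} -> K}.

Definition flip (i : 'I_5) (B : {set 'I_5}) : {set 'I_5} :=
  if i \in B then B :\ i else i |: B.

Definition koszul (i : 'I_5) (B : {set 'I_5}) : K :=
  (-1) ^+ #|[set j in B | (j < i)%N]|.

(* (w, a) acts by s |-> w /\ s + (contraction of s by a): e_B receives
   e_i /\ e_(B - i) when i is in B, and the contraction of e_(B + i) by e_i^*
   otherwise, both with the sign [koszul i B]. *)
Definition clifford (v : hyperbolic) (s : spinor) : spinor :=
  [ffun B : {set 'I_5} => \sum_(i < 5) (if i \in B then v.1 0 i else v.2 0 i)
                    * koszul i B * s (flip i B)].

Lemma in_flip i j B : (j \in flip i B) = (i == j) (+) (j \in B).
Proof.
rewrite /flip; case: (boolP (i \in B)) => iB; rewrite !inE [j == i]eq_sym;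
by case: eqP => [<-|]; rewrite ?iB ?(negbTE iB).
Qed.

Lemma flipK i : involutive (flip i).
Proof. by move=> B; apply/setP=> k; rewrite !in_flip addbA addbb. Qed.

Lemma flipC i j B : flip i (flip j B) = flip j (flip i B).
Proof. by apply/setP=> k; rewrite !in_flip addbCA. Qed.

Lemma koszul_flip i j B :
  koszul j (flip i B) = (-1) ^+ (i < j)%N * koszul j B.
Proof.
rewrite /koszul; have [ij | ij] := boolP (i < j)%N; last first.
  rewrite expr0 mul1r; congr (_ ^+ #|pred_of_set _|).
  by apply/setP=> k; rewrite !inE in_flip; case: eqP => [<-|//]; rewrite (negbTE ij) !andbF.
have [iB | iB] := boolP (i \in B).
  rewrite [in RHS](cardsD1 i) inE iB ij /= exprD mulrA -expr2 sqrrN expr1n mul1r.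
  congr (_ ^+ #|pred_of_set _|); apply/setP=> k; rewrite !inE in_flip [k == i]eq_sym.
  by case: eqP => [<-|//]; rewrite iB.
rewrite [in LHS](cardsD1 i) inE in_flip eqxx (negbTE iB) ij /= exprD.
congr (_ * _ ^+ #|pred_of_set _|); apply/setP=> k.
rewrite !inE in_flip [k == i]eq_sym.
by case: eqP => [<-|//]; rewrite (negbTE iB).
Qed.

Lemma clifford_sqr v s B :
  clifford v (clifford v s) B = quadric v * s B.
Proof.
pose a i (B : {set 'I_5}) := if i \in B then v.1 0 i else v.2 0 i.
pose F i j := a i B * a j B * koszul i B * koszul j B * s (flip i (flip j B)).
have FC i j : F i j = F j i.
  by rewrite /F flipC [a i B * _]mulrC [_ * koszul i B * _]mulrAC.
have step i j : a i B * koszul i B * (a j (flip i B) * koszul j (flip i B)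
    * s (flip j (flip i B))) =
    if i == j then v.1 0 i * v.2 0 i * s B else (-1) ^+ (i < j)%N * F i j.
  rewrite koszul_flip; have [<- | ij] := eqVneq i j.
    rewrite ltnn expr0 mul1r flipK.
    have -> : a i (flip i B) = if i \in B then v.2 0 i else v.1 0 i.
      by rewrite /a in_flip eqxx /=; case: (i \in B).
    have sq : koszul i B * koszul i B = 1 by rewrite -expr2 /koszul sqrr_sign.
    rewrite -[RHS]mul1r -sq /a; case: (i \in B); ring.
  have -> : a j (flip i B) = a j B by rewrite /a in_flip (negbTE ij).
  by rewrite flipC /F; ring.
have -> : clifford v (clifford v s) B =
    \sum_i \sum_j if i == j then v.1 0 i * v.2 0 i * s B
                   else (-1) ^+ (i < j)%N * F i j.
  rewrite ffunE; apply: eq_bigr => i _; rewrite ffunE mulr_sumr.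
  by apply: eq_bigr => j _; rewrite -step.
rewrite /quadric mulr_suml.
have split3 (i : 'I_5) : \sum_j (if i == j then v.1 0 i * v.2 0 i * s B
      else (-1) ^+ (i < j)%N * F i j) = v.1 0 i * v.2 0 i * s B
    + (\sum_(j : 'I_5 | (j < i)%N) F i j - \sum_(j : 'I_5 | (i < j)%N) F i j).
  rewrite (bigD1 i) //= eqxx; congr (_ + _).
  rewrite (bigID (fun j : 'I_5 => (j < i)%N)) /= -sumrN; congr (_ + _).
    apply: eq_big => j; first by rewrite -val_eqE /=; case: ltngtP.
    case/andP=> ji ltji; rewrite eq_sym (negbTE ji) ltnNge ltnW //.
    by rewrite expr0 mul1r.
  apply: eq_big => j.
    by rewrite -val_eqE /=; case: ltngtP.
  rewrite eq_sym -val_eqE /=; case: ltngtP => // ij _.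
  by rewrite expr1 mulN1r.
rewrite (eq_bigr _ (fun i _ => split3 i)) big_split /= sumrB.
rewrite [X in _ + (X - _)](exchange_big_dep predT) //= -sumrB.
rewrite [X in _ + X]big1 ?addr0 // => i _; rewrite -sumrB big1 // => j _.
by rewrite FC subrr.
Qed.

Definition even_sets : {set {set 'I_5}} := [set B : {set 'I_5} | ~~ odd #|B|].

Lemma card_even_sets : #|even_sets| = 16.
Proof.
pose D k := [set B : {set 'I_5} | #|B| == k].
have -> : even_sets = D 0%N :|: D 2 :|: D 4.
  apply/setP=> B; rewrite !inE; have : (#|B| <= 5)%N.
    by rewrite -[X in (_ <= X)%N](card_ord 5) max_card.
  by move: #|B|; do 6!case=> //.
have dis i j : i != j -> D i :&: D j = set0.
  move=> ij; apply/setP=> B; rewrite !inE; apply: contraNF ij.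
  by case/andP=> /eqP <-.
rewrite !cardsU setIUl !dis // setU0 !cards0 !subn0.
by rewrite !card_draws !card_ord.
Qed.

(* A nonzero even spinor s represents a point of S^10 when it is killed by a
   P^4 contained in Q^8, i.e. by a 5-dimensional isotropic subspace L. The
   P^4's obtained in this way form one of the two families; those of the other
   family kill lines of odd spinors. *)
Definition pure_even_spinor (s : spinor) : Prop :=
  [/\ s <> 0,
      forall B : {set 'I_5}, odd #|B| -> s B = 0 &
      exists L : {vspace hyperbolic},
        [/\ \dim L = 5,
            forall v, v \in L -> quadric v = 0 &
            forall v, v \in L -> clifford v s = 0]].

(* The homogeneous coordinates of P^15, the projectivized half-spin module. *)
Definition spinor_coord (s : spinor) (k : 'I_16) : K :=
  s (enum_val (cast_ord (esym card_even_sets) k)).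

Definition vanishes_on_spinors (p : {mpoly K[16]}) : Prop :=
  forall s, pure_even_spinor s -> p.@[spinor_coord s] = 0.

Lemma vanishes_on_spinors0 : vanishes_on_spinors 0.
Proof. by move=> s _; rewrite meval0. Qed.

Lemma vanishes_on_spinorsD p q :
  vanishes_on_spinors p -> vanishes_on_spinors q -> vanishes_on_spinors (p + q).
Proof. by move=> Ip Iq s hs; rewrite mevalD Ip // Iq // addr0. Qed.

Lemma vanishes_on_spinorsM a p :
  vanishes_on_spinors p -> vanishes_on_spinors (a * p).
Proof. by move=> Ip s hs; rewrite mevalM Ip // mulr0. Qed.

Definition spinor_ideal : ideal (gr_mpoly K 16) :=
  Ideal vanishes_on_spinors0 vanishes_on_spinorsD vanishes_on_spinorsM.

Definition spinor_ring : gralg K := gr_quot spinor_ideal.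

End SpinorVariety.

(* Main.v *)
(* Write an even spinor as [(e, w_ij, v_i)]. The ideal of the spinor variety contains the ten
   quadrics [pf_i(w) - e v_i] and [sum_j w_ij v_j]. A tensor [z] defines a linear subspace P^4,
   with coordinates [x_0, ..., x_4], by [e = 0], [v_i = x_i], [w_ij = sum_k (z_ijk - z_jik) x_k].
   If the ten quadrics restricted to the section leave a quotient of [T] spanned by 1, 5, 5, 1
   elements in degrees 0, 1, 2, 3, then these lift to 12 elements generating [R_S] over the
   polynomial ring in the 11 linear forms that vanish on the section. Standard monomials of a
   degeneration of the variety to the cone over a shellable complex with h-vector (1, 5, 5, 1)
   bound the Hilbert function of [R_S] from below and make this module free. So the forms are a
   regular sequence and the section has the coordinate ring [T/J], [J] the ideal of restricted
   quadrics.

   It remains to see that for general [f] some [z] has [J = f^perp]. For fixed [z] the cubics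
   killed by [J] solve a linear system [M(z) f = 0], with a nonzero solution by the lower bound
   and generically only one up to scalars, given by Cramer's rule as [F(z)]. At a base point
   whose solution is the Klein cubic [f_0], a covector [u] normal to the cone over the image of
   [F] is [u = y M(z_0)], and differentiating [M F = 0] gives [y dM f_0 = 0]; this forces [u =
   0], so [F] is dominant. Quantifier elimination turns density into a nonempty open set. *)
Require Import Defs.
From HB Require Import structures.
From mathcomp Require Import all_boot all_order all_algebra.
From mathcomp Require Import closed_field.
From mathcomp Require Import mpoly.
From mathcomp Require ssrcomplements.
From mathcomp Require Import complex.
From mathcomp Require Import boolp reals.
From mathcomp Require Import ring zify.

Set Implicit Arguments.
Unset Strict Implicit.
Unset Printing Implicit Defensive.

Import GRing.Theory Num.Theory.

Local Open Scope ring_scope.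

(** * Polynomial maps and generic projections *)

(** The comparison of counts also proves that the ten quadrics generate the ideal of the variety, so
    neither this fact nor Cohen-Macaulayness is an input. Over a section the 12 generators are
    always 1, the [x_i], the [x_i^2] and [x_0^2 x_1]. That they suffice up to degree 3 is an open
    condition on [z]. Invertibility of the matrix of the third derivatives of [f] in directions
    [(i, j, j)] is an open condition on [f]; it makes the [x_j^2] dual to the [x_i], and this
    duality settles the quartics and the inclusion of [f^perp] in [J]. The base point is invariant
    under the cyclic shift of the indices: its quadrics are [x_(i+1) x_(i+3)] and
    [x_i x_(i+1) - x_(i+4)^2], so each rank or tangency statement there becomes a few relations with
    a free index modulo 5. The final vanishing is a telescoping sum over this cycle. Degrees are
    tracked through upper bounds on [msize], where [msize p <= d] means degree below [d]; the
    truncated differences [d - k] then also cover the small degrees. *)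

Section Derivations.

Variables (n : nat) (R : comNzRingType) (S : comNzRingType).
Variables (f : {rmorphism R -> S}) (h : 'I_n -> S) (D : {additive S -> S}).
Hypothesis DM : forall x y, D (x * y) = D x * y + x * D y.
Hypothesis Df : forall c, D (f c) = 0.

(** The chain rule, for an arbitrary derivation [D] killing the scalars: it serves both for the
    derivative along a line and for the partial derivatives of a composite of polynomial maps. *)
Lemma derivation_mmap (p : {mpoly R[n]}) :
  D (mmap f h p) = \sum_i mmap f h p^`M(i) * D (h i).
Proof.
pose P (p : {mpoly R[n]}) := D (mmap f h p) = \sum_i mmap f h p^`M(i) * D (h i).
have PD p1 p2 : P p1 -> P p2 -> P (p1 + p2).
  rewrite /P => e1 e2; rewrite !raddfD /= e1 e2 -big_split; apply: eq_bigr => i _.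
  by rewrite mderivD raddfD /= mulrDl.
have PM p1 p2 : P p1 -> P p2 -> P (p1 * p2).
  rewrite /P => e1 e2; rewrite rmorphM DM e1 e2 mulr_suml mulr_sumr -big_split.
  apply: eq_bigr => i _; rewrite mderivM raddfD /= !rmorphM /=; ring.
have PC c : P c%:MP.
  rewrite /P mmapC Df big1 // => i _.
  by rewrite mderivC raddf0 mul0r.
have PX i : P 'X_i.
  rewrite /P (bigD1 i) //= big1 => [|j ji].
    rewrite mderivX mnm1E eqxx scale1r mmapX mmap1U addr0.
    have -> : (U_(i) - U_(i))%MM = 0%MM :> 'X_{1..n}.
      by apply/mnmP=> k; rewrite !mnmE subnn.
    by rewrite mpolyX0 rmorph1 mul1r.
  by rewrite mderivX mnm1E eq_sym (negbTE ji) scale0r raddf0 mul0r.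
have P0 : P 0 by rewrite -mpolyC0; apply: PC.
have PXm m : P 'X_[m].
  rewrite mpolyXE_id.
  elim/big_ind: _ => //; first by rewrite -mpolyC1; apply: PC.
  move=> i _; elim: (m i) => [|k IHk]; first by rewrite expr0 -mpolyC1; apply: PC.
  by rewrite exprS; apply: PM.
rewrite -/(P p) (mpolyE p); elim/big_ind: _ => // m _.
by rewrite -mul_mpolyC; apply: PM.
Qed.

End Derivations.

Section PolynomialIdentities.

Variables (n : nat) (K : numFieldType).
Implicit Types p q : {mpoly K[n]}.

Lemma mnm_neq0 (m : 'X_{1..n}) : m != 0%MM -> exists i, m i != 0%N.
Proof.
move=> m0; apply/existsP; apply: contraR m0.
rewrite negb_exists => /forallP mi; apply/eqP/mnmP=> i.
by rewrite mnm0E; apply/eqP; rewrite -[_ == _]negbK.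
Qed.

Lemma mderiv_all0 p : (forall i, p^`M(i) = 0) -> p = (p@_0)%:MP.
Proof.
move=> dp; apply/mpolyP=> m; rewrite mcoeffC.
have [->|m0] := eqVneq m 0%MM; first by rewrite mulr1.
have [i mi] := mnm_neq0 m0.
have := mcoeff_mderiv i p (m - U_(i))%MM; rewrite dp mcoeff0 submK; last first.
  by apply/mnm_lepP=> j; rewrite mnm1E; case: eqP => // <-; rewrite lt0n.
move/esym/eqP; rewrite mulrn_eq0 /= => /eqP ->.
by rewrite mulr0.
Qed.

Lemma poly_all0 (q : {poly K}) : (forall x, q.[x] = 0) -> q = 0.
Proof.
move=> q0; apply/eqP; apply: contraT => nzq.
have inj : uniq [seq (i%:R : K) | i <- iota 0 (size q)].
  by rewrite map_inj_uniq ?iota_uniq // => i j /eqP; rewrite eqr_nat => /eqP.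
have := max_poly_roots nzq _ inj.
rewrite size_map size_iota ltnn; apply.
by apply/allP=> x _; rewrite rootE q0.
Qed.

(** Along the line through [v] in direction [i] the polynomial becomes univariate with all values
    zero, hence zero because the field is infinite; its derivative at 0 is the partial derivative at
    [v]. *)
Lemma meval_mderiv_all0 p i :
  (forall v, p.@[v] = 0) -> forall v, p^`M(i).@[v] = 0.
Proof.
move=> p0 v.
pose h j : {poly K} := (v j)%:P + (j == i)%:R *: 'X.
have hE (q : {mpoly K[n]}) x :
    (mmap polyC h q).[x] = q.@[fun j => v j + (j == i)%:R * x].
  rewrite /mmap mevalE horner_sum; apply: eq_bigr => m _.
  rewrite hornerM hornerC /mmap1 horner_prod; congr (_ * _); apply: eq_bigr => j _.
  by rewrite horner_exp hornerD hornerC hornerZ hornerX.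
have q0 : mmap polyC h p = 0 by apply: poly_all0 => x; rewrite hE p0.
have := derivation_mmap (D := @deriv K) (f := @polyC K) h (@derivM K) (@derivC K) p.
rewrite q0 raddf0 (bigD1 i) //= big1 => [|j ji]; last first.
  by rewrite /h derivD derivC derivZ derivX (negbTE ji) scale0r addr0 mulr0.
rewrite /h derivD derivC derivZ derivX eqxx scale1r add0r mulr1 addr0.
move/(congr1 (horner^~ 0)); rewrite horner0 -/h hE => /esym; congr (_ = _).
by apply: meval_eq => j; rewrite mulr0 addr0.
Qed.

Lemma meval_at0 p : p.@[fun=> 0] = p@_0.
Proof.
rewrite mevalE [in RHS](mpolyE p) raddf_sum /=; apply: eq_bigr => m _.
rewrite mcoeffZ mcoeffX; congr (_ * _).
have [->|/mnm_neq0[i mi]] := eqVneq m 0%MM.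
  by rewrite big1 // => i _; rewrite mnm0E expr0.
by rewrite (bigD1 i) //= expr0n (negbTE mi) mul0r.
Qed.

(** Every iterated derivative vanishes at 0, where its value is a coefficient of [p] times a product
    of factorials, nonzero in characteristic 0. *)
Lemma meval_all0 p : (forall v, p.@[v] = 0) -> p = 0.
Proof.
move=> p0; apply/mpolyP=> m; rewrite mcoeff0.
have Z s : forall v, (foldr (@mderiv n K) p s).@[v] = 0.
  by elim: s => //= i s IHs; apply: meval_mderiv_all0.
have : p^`M[m].@[fun=> 0] = 0 by have := Z; rewrite mderivm_foldr; apply.
rewrite meval_at0 mcoeff_mderivm addm0 => /eqP; rewrite mulrn_eq0 => /orP[|/eqP //].
by have /gtn_eqF -> // : (0 < \prod_(i < n) m i ^_ m i)%N;
  rewrite prodn_gt0 // => i; rewrite ffact_gt0.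
Qed.

Lemma meval_neq0 p : p != 0 -> exists v, p.@[v] != 0.
Proof.
move=> p0; apply: contrapT => H; case/eqP: p0; apply: meval_all0 => v.
by apply: contrapT => /eqP pv; apply: H; exists v.
Qed.

(** Lets an identity be checked off a hypersurface only; [v0] witnesses that [p] is not the zero
    polynomial. *)
Lemma mpoly_id p q v0 : p.@[v0] != 0 ->
  (forall v, p.@[v] != 0 -> q.@[v] = 0) -> q = 0.
Proof.
move=> p0 pq; have /eqP : p * q = 0.
  apply: meval_all0 => v; rewrite mevalM.
  by have [->|/pq ->] := eqVneq p.@[v] 0; rewrite ?mul0r ?mulr0.
rewrite mulf_eq0 => /orP[/eqP pz|/eqP //].
by rewrite pz meval0 eqxx in p0.
Qed.

End PolynomialIdentities.

Section GenericProjection.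

Variable K : numClosedFieldType.

Let tm n (p : {mpoly K[n]}) : GRing.term K :=
  \big[GRing.Add/GRing.Const 0]_(m <- msupp p)
    GRing.Mul (GRing.Const p@_m)
      (\big[GRing.Mul/GRing.Const 1]_(i < n) GRing.Exp (GRing.Var K i) (m i)).

Let tmP n (p : {mpoly K[n]}) e : GRing.eval e (tm p) = p.@[fun i => e`_i].
Proof.
rewrite mevalE /tm (big_morph (GRing.eval e) (id1 := 0) (op1 := +%R)) //.
apply: eq_bigr => m _ /=; congr (_ * _).
by rewrite (big_morph (GRing.eval e) (id1 := 1) (op1 := *%R)).
Qed.

Let tm_rterm n (p : {mpoly K[n]}) : GRing.rterm (tm p).
Proof.
rewrite /tm; elim/big_ind: _ => //= [t1 t2 -> -> //|m _].
by elim/big_ind: _ => //= t1 t2 -> ->.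
Qed.

Let exN (n N : nat) (f : GRing.formula K) :=
  foldr GRing.Exists f (iota n N).

Let exN_rformula n N f : GRing.rformula f -> GRing.rformula (exN n N f).
Proof. by move=> rf; rewrite /exN; elim: (iota n N). Qed.

Let exNP n N f e : size e = n ->
  GRing.holds e (exN n N f) <-> exists2 y : seq K, size y = N & GRing.holds (e ++ y) f.
Proof.
rewrite /exN; elim: N n e => [|N IHN] n e se /=.
  split=> [fe|[y /size0nil -> ]]; last by rewrite cats0.
  by exists [::] => //; rewrite cats0.
have sne x : set_nth 0 e n x = rcons e x.
  by rewrite -se; elim: (e) => //= z s ->.
split=> [[x]|[[|x y] //= [sy] fy]].
  rewrite sne => /(IHN n.+1 (rcons e x)); rewrite size_rcons se => /(_ erefl)[y sy].
  by rewrite cat_rcons => fy; exists (x :: y) => //=; rewrite sy.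
exists x; rewrite sne; apply/(IHN n.+1 (rcons e x)); first by rewrite size_rcons se.
by exists y => //; rewrite cat_rcons.
Qed.

Let mpoly_of_term n (t : GRing.term K) : GRing.rterm t ->
  exists p : {mpoly K[n]}, forall v, GRing.eval [seq v i | i <- enum 'I_n] t = p.@[v].
Proof.
elim: t => //=.
- move=> i _; case: (ltnP i n) => [lt_in | le_ni].
    exists 'X_(Ordinal lt_in) => v; rewrite mevalXU.
    by rewrite (nth_map (Ordinal lt_in)) ?size_enum_ord // (nth_ord_enum _ (Ordinal lt_in)).
  (* A variable with index [n] or more lies outside the environment and reads its default value
     0. *)
  by exists 0 => v; rewrite meval0 nth_default // size_map size_enum_ord.
- by move=> c _; exists c%:MP => v; rewrite mevalC.
- by move=> m _; exists m%:R => v; rewrite rmorph_nat.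
- move=> t1 IH1 t2 IH2 /andP[/IH1[p1 e1] /IH2[p2 e2]].
  by exists (p1 + p2) => v; rewrite e1 e2 mevalD.
- by move=> t IH /IH[p ep]; exists (- p) => v; rewrite ep mevalN.
- by move=> t IH m /IH[p ep]; exists (p *+ m) => v; rewrite ep mevalMn.
- move=> t1 IH1 t2 IH2 /andP[/IH1[p1 e1] /IH2[p2 e2]].
  by exists (p1 * p2) => v; rewrite e1 e2 mevalM.
- by move=> t IH m /IH[p ep]; exists (p ^+ m) => v; rewrite ep rmorphXn.
Qed.

(* An atom [t1 == t2] is constant off the zero set of the polynomial [t1 - t2],
   and this property is inherited by Boolean combinations. *)
Let qf_generic n (f : GRing.formula K) : GRing.qf_form f && GRing.rformula f ->
  exists (g : {mpoly K[n]}) (b : bool), g != 0 /\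
    forall v, g.@[v] != 0 -> GRing.qf_eval [seq v i | i <- enum 'I_n] f = b.
Proof.
have two (f1 f2 : GRing.formula K) (op : bool -> bool -> bool) :
    (exists (g : {mpoly K[n]}) (b : bool), g != 0 /\
      forall v, g.@[v] != 0 -> GRing.qf_eval [seq v i | i <- enum 'I_n] f1 = b) ->
    (exists (g : {mpoly K[n]}) (b : bool), g != 0 /\
      forall v, g.@[v] != 0 -> GRing.qf_eval [seq v i | i <- enum 'I_n] f2 = b) ->
    exists (g : {mpoly K[n]}) (b : bool), g != 0 /\ forall v, g.@[v] != 0 ->
      op (GRing.qf_eval [seq v i | i <- enum 'I_n] f1)
         (GRing.qf_eval [seq v i | i <- enum 'I_n] f2) = b.
  move=> [g1 [b1 [g10 e1]]] [g2 [b2 [g20 e2]]]; exists (g1 * g2), (op b1 b2).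
  split=> [|v]; first by rewrite mulf_neq0.
  by rewrite mevalM mulf_eq0 negb_or => /andP[/e1 -> /e2 ->].
elim: f => //=.
- by move=> b _; exists 1, b; rewrite oner_neq0.
- move=> t1 t2 /andP[/(mpoly_of_term n)[p1 e1] /(mpoly_of_term n)[p2 e2]].
  have [e12 | ne12] := eqVneq p1 p2.
    by exists 1, true; rewrite oner_neq0; split=> // v _; rewrite e1 e2 e12 eqxx.
  exists (p1 - p2), false; rewrite subr_eq0; split=> // v.
  by rewrite mevalB subr_eq0 e1 e2 => /negbTE.
- move=> f1 IH1 f2 IH2 /andP[/andP[q1 q2] /andP[r1 r2]].
  by apply: (two f1 f2 andb); [apply: IH1; rewrite q1 r1|apply: IH2; rewrite q2 r2].
- move=> f1 IH1 f2 IH2 /andP[/andP[q1 q2] /andP[r1 r2]].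
  by apply: (two f1 f2 orb); [apply: IH1; rewrite q1 r1|apply: IH2; rewrite q2 r2].
- move=> f1 IH1 f2 IH2 /andP[/andP[q1 q2] /andP[r1 r2]].
  by apply: (two f1 f2 implb); [apply: IH1; rewrite q1 r1|apply: IH2; rewrite q2 r2].
move=> f IH /IH[g [b [g0 e]]]; exists g, (~~ b); split=> // v gv.
by rewrite e.
Qed.

Definition glue (n N : nat) (v : 'I_n -> K) (w : 'I_N -> K) (i : 'I_(n + N)) : K :=
  match split i with inl j => v j | inr j => w j end.

(* Quantifier elimination over [K]: the projection of a constructible set is
   constructible, so it either contains or avoids a dense open set. *)
Lemma generic_projection (n N : nat) (I : finType)
    (P : I -> {mpoly K[n + N]}) (D : {mpoly K[n + N]}) :
  let X v := exists w : 'I_N -> K,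
    (forall i, (P i).@[glue v w] = 0) /\ D.@[glue v w] != 0 in
  exists g : {mpoly K[n]}, g != 0 /\
    ((forall v, g.@[v] != 0 -> X v) \/ (forall v, g.@[v] != 0 -> ~ X v)).
Proof.
move=> X.
pose phi : GRing.formula K :=
  GRing.And (\big[@GRing.And K/GRing.Bool true]_(i : I) GRing.Equal (tm (P i)) (GRing.Const 0))
    (GRing.Not (GRing.Equal (tm D) (GRing.Const 0))).
have rphi : GRing.rformula phi.
  rewrite /= tm_rterm !andbT; elim/big_ind: _ => //= [? ? -> -> //|i _].
  by rewrite tm_rterm.
have phiP e : GRing.holds e phi <->
    (forall i, (P i).@[fun j => e`_j] = 0) /\ D.@[fun j => e`_j] != 0.
  have andP : GRing.holds e (\big[@GRing.And K/GRing.Bool true]_(i : I)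
      GRing.Equal (tm (P i)) (GRing.Const 0)) <-> forall i, (P i).@[fun j => e`_j] = 0.
    suff H (r : seq I) : GRing.holds e (\big[@GRing.And K/GRing.Bool true]_(i <- r)
      GRing.Equal (tm (P i)) (GRing.Const 0)) <->
      forall i, i \in r -> (P i).@[fun j => e`_j] = 0.
      split=> [/H Pi i|Pi]; first by apply: Pi; rewrite mem_index_enum.
      by apply/H => i _.
    elim: r => [|i r IHr]; first by rewrite big_nil.
    rewrite big_cons /= tmP; split=> [[Pi /IHr Pr] j|Pr].
      by rewrite inE => /orP[/eqP ->|/Pr].
    split; first by apply: Pr; rewrite mem_head.
    by apply/IHr => j jr; apply: Pr; rewrite inE jr orbT.
  rewrite /= tmP; split=> [[/andP Pe /eqP De]|[Pe De]] //.
  by split; [apply/andP | apply/eqP].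
pose psi := GRing.quantifier_elim (@ClosedFieldQE.ex_elim K) (exN n N phi).
have rpsi := exN_rformula n N rphi.
have solve : GRing.closed_field_axiom K by exact: solve_monicpoly.
have psiP e := GRing.quantifier_elim_rformP (@ClosedFieldQE.wf_ex_elim K)
  (ClosedFieldQE.holds_ex_elim solve) e rpsi.
have XP v : reflect (X v) (GRing.qf_eval [seq v i | i <- enum 'I_n] psi).
  have sv : size [seq v i | i <- enum 'I_n] = n by rewrite size_map size_enum_ord.
  have nthv (j : 'I_n) : [seq v i | i <- enum 'I_n]`_j = v j.
    by rewrite (nth_map j) ?size_enum_ord // nth_ord_enum.
  apply: (iffP (psiP _)) => [/(exNP _ _ sv)[y sy /phiP[Py Dy]]|[w [Pw Dw]]].
    exists (fun j => y`_j).
    have uE : (fun j : 'I_(n + N) => ([seq v i | i <- enum 'I_n] ++ y)`_j) =1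
        glue v (fun j => y`_j).
      move=> j; rewrite /glue nth_cat sv; case: split_ordP => k -> /=.
        by rewrite nthv.
      by rewrite addKn.
    by split=> [i|]; rewrite -(meval_eq _ uE).
  apply/(exNP _ _ sv); exists [seq w i | i <- enum 'I_N].
    by rewrite size_map size_enum_ord.
  apply/phiP; set e := _ ++ _.
  have uE : (fun j : 'I_(n + N) => e`_j) =1 glue v w.
    move=> j; rewrite /glue /e nth_cat sv; case: split_ordP => k -> /=.
      by rewrite nthv.
    by rewrite addKn (nth_map k) ?size_enum_ord // nth_ord_enum.
  by split=> [i|]; rewrite (meval_eq _ uE).
have [g [b [g0 gb]]] := qf_generic n (GRing.quantifier_elim_wf
   (@ClosedFieldQE.wf_ex_elim K) rpsi).
exists g; split=> //; case: b gb => gb; [left | right] => v gv.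
  by apply/XP; rewrite gb.
by move/XP; rewrite gb.
Qed.

End GenericProjection.

Section Dominance.

Variables (K : numFieldType) (n N : nat) (F : 'I_n -> {mpoly K[N]}).

Lemma msize_mderiv (p : {mpoly K[n]}) i : (msize p^`M(i) <= (msize p).-1)%N.
Proof.
rewrite [X in (X <= _)%N]msizeE; apply/bigmax_leqP_seq => m ms _.
have : (m + U_(i))%MM \in msupp p.
  rewrite mcoeff_msupp; apply: contraTneq ms => pm.
  by rewrite mcoeff_msupp mcoeff_mderiv pm mul0rn eqxx.
move/msize_mdeg_lt; rewrite mdegD mdeg1 addn1.
by case: (msize p).
Qed.

Lemma meval_mmap (g : {mpoly K[n]}) z :
  (mmap (@mpolyC N K) F g).@[z] = g.@[fun i => (F i).@[z]].
Proof.
rewrite /mmap [in RHS]mevalE raddf_sum; apply: eq_bigr => m _ /=.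
rewrite mevalM mevalC /mmap1 rmorph_prod; congr (_ * _).
by apply: eq_bigr => i _; rewrite rmorphXn.
Qed.

(* Jacobian criterion: for a relation [g] of least degree, differentiating
   [g(F) = 0] gives relations of smaller degree. *)
Lemma alg_independent (z0 : 'I_N -> K) (g : {mpoly K[n]}) :
  (forall u : 'rV[K]_n,
    (forall j, \sum_i u 0 i * (F i)^`M(j).@[z0] = 0) -> u = 0) ->
  mmap (@mpolyC N K) F g = 0 -> g = 0.
Proof.
move=> J0; pose A : 'M[{mpoly K[N]}]_(n, N) := \matrix_(i, j) (F i)^`M(j).
pose A0 : 'M[K]_(n, N) := \matrix_(i, j) (F i)^`M(j).@[z0].
have /row_freeP[C AC] : row_free A0.
  rewrite -kermx_eq0; apply/eqP/row_matrixP => k; rewrite row0; apply: J0 => j.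
  have := congr1 (fun M : 'M_(_, _) => M k j) (mulmx_ker A0).
  by rewrite !mxE => E; rewrite -[RHS]E; apply: eq_bigr => i' _; rewrite !mxE.
(* The value of [B] at [z0] is the identity matrix, so [\det B] is a nonzero polynomial that can be
   cancelled from [\det B *: G = 0]. *)
pose B := A *m map_mx (@mpolyC N K) C.
have detB : \det B != 0.
  apply: contraTneq (oner_neq0 K) => dB.
  have := det_map_mx (meval z0) B; rewrite dB rmorph0.
  suff -> : map_mx (meval z0) B = 1%:M by rewrite det1 => ->; rewrite eqxx.
  rewrite -AC; apply/matrixP=> i j; rewrite !mxE raddf_sum; apply: eq_bigr => k _.
  by rewrite !mxE /= mevalM mevalC.
elim: {g}(msize g) {-2}g (leqnn (msize g)) => [|k IHk] g sg Fg.
  by apply/eqP; rewrite -msize_poly_eq0 -leqn0.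
have dg i : g^`M(i) = 0.
  apply: IHk; first by rewrite (leq_trans (msize_mderiv g i)) // -ltnS; case: (msize g) sg.
  pose G : 'rV[{mpoly K[N]}]_n := \row_i mmap (@mpolyC N K) F g^`M(i).
  have GA : G *m A = 0.
    apply/rowP=> j; rewrite !mxE.
    have := derivation_mmap (D := @mderiv N K j) (f := @mpolyC N K) F
      (@mderivM N K j) (@mderivC N K j) g.
    rewrite Fg raddf0 => E; rewrite [RHS]E; apply: eq_bigr => i' _.
    by rewrite !mxE.
  have : \det B *: G = 0.
    rewrite -mul_mx_scalar -mul_mx_adj /B !mulmxA GA.
    by rewrite !mul0mx.
  move/rowP/(_ i)/eqP; rewrite !mxE mulf_eq0 (negbTE detB) /=.
  by move/eqP.
move: Fg; rewrite (mderiv_all0 dg) mmapC => /eqP; rewrite mpolyC_eq0 => /eqP ->.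
by rewrite mpolyC0.
Qed.

Lemma dominant_dense (z0 : 'I_N -> K) (D : {mpoly K[N]}) (g : {mpoly K[n]}) :
  (forall u : 'rV[K]_n,
    (forall j, \sum_i u 0 i * (F i)^`M(j).@[z0] = 0) -> u = 0) ->
  D.@[z0] != 0 -> g != 0 ->
  exists z, D.@[z] != 0 /\ g.@[fun i => (F i).@[z]] != 0.
Proof.
move=> J0 D0 g0; have Fg : mmap (@mpolyC N K) F g != 0.
  by apply: contraNneq g0 => /(alg_independent J0) ->.
have DN0 : D != 0 by apply: contraNneq D0 => ->; rewrite meval0.
have [z] := meval_neq0 (mulf_neq0 DN0 Fg).
by rewrite mevalM mulf_eq0 negb_or meval_mmap => /andP[]; exists z.
Qed.

End Dominance.

(** Among the indices with [c x != 0], one with the largest leading monomial cannot be cancelled: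
    the other terms have coefficient 0 at this monomial. *)
Lemma lead_independent (K : fieldType) (n : nat) (X : finType)
    (p : X -> {mpoly K[n]}) (c : X -> K) :
  (forall x, p x != 0) -> injective (fun x => mlead (p x)) ->
  \sum_x c x *: p x = 0 -> forall x, c x = 0.
Proof.
move=> p0 inj sum0 x0; apply/eqP; apply: contraT => cx0.
case: (@Order.TotalTheory.arg_maxP _ _ X x0 (fun x => c x != 0)
         (fun x => mlead (p x)) cx0) => x cx xmax.
have := congr1 (mcoeff (mlead (p x))) sum0; rewrite raddf_sum mcoeff0 (bigD1 x) //=.
rewrite big1 => [|y yx]; last first.
  rewrite mcoeffZ; have [->|cy] := eqVneq (c y) 0; first by rewrite mul0r.
  rewrite mcoeff_gt_mlead ?mulr0 //.
  rewrite Order.POrderTheory.lt_neqAle; apply/andP; split; last exact: (xmax _ cy).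
  by apply: contraNneq yx => /inj ->.
move/eqP; rewrite addr0 mcoeffZ mulf_eq0 (negbTE cx) /=.
by rewrite mleadc_eq0 (negbTE (p0 x)).
Qed.

(* As many vectors span as are independent, so the spanning ones are independent. *)
Lemma independent_of_span (K : fieldType) (V : lmodType K) (N : V -> Prop)
    (X : finType) (e phi : X -> V) :
  N 0 -> (forall u v, N u -> N v -> N (u + v)) -> (forall a v, N v -> N (a *: v)) ->
  (forall c : X -> K, N (\sum_x c x *: e x) -> forall x, c x = 0) ->
  (forall x, exists c : X -> K, N (e x - \sum_y c y *: phi y)) ->
  forall c : X -> K, N (\sum_x c x *: phi x) -> forall x, c x = 0.
Proof.
move=> N0 ND NZ indep /choice[C eC] c Nc.
have Nsum (r : seq X) (F : X -> V) : (forall x, N (F x)) -> N (\sum_(x <- r) F x).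
  by move=> NF; elim/big_ind: _.
pose M : 'M[K]_#|X| := \matrix_(i, j) C (enum_val i) (enum_val j).
have reidx (a : 'rV[K]_#|X|) (F : X -> V) :
    \sum_x a 0 (enum_rank x) *: F x = \sum_i a 0 i *: F (enum_val i).
  rewrite (reindex _ (onW_bij _ (enum_val_bij X))) /=.
  by apply: eq_bigr => i _; rewrite enum_valK.
have comb (a : 'rV[K]_#|X|) : N (\sum_x a 0 (enum_rank x) *: e x
    - \sum_x (a *m M) 0 (enum_rank x) *: phi x).
  have -> : \sum_x a 0 (enum_rank x) *: e x - \sum_x (a *m M) 0 (enum_rank x) *: phi x
      = \sum_x a 0 (enum_rank x) *: (e x - \sum_y C x y *: phi y).
    rewrite -sumrB /=.
    under [RHS]eq_bigr do rewrite scalerBr scaler_sumr.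
    rewrite !sumrB; congr (_ - _); rewrite [RHS]exchange_big /=.
    apply: eq_bigr => y _; rewrite mxE scaler_suml.
    rewrite [RHS](reindex _ (onW_bij _ (enum_val_bij X))) /=; apply: eq_bigr => i _.
    by rewrite !mxE enum_rankK enum_valK scalerA.
  by apply: Nsum => x; apply: NZ.
(* A relation between the rows of [M] would be a relation between the [e x]. Being square, [M] is
   then invertible, and a relation between the [phi x] pulls back to one between the [e x]. *)
have free : row_free M.
  rewrite -kermx_eq0; apply/eqP/row_matrixP => k; rewrite row0.
  have kM : row k (kermx M) *m M = 0 by rewrite -row_mul mulmx_ker row0.
  apply/rowP=> i; rewrite [RHS]mxE -(enum_valK i).
  apply: (indep (fun x => row k (kermx M) 0 (enum_rank x))).
  have := comb (row k (kermx M)); rewrite kM [X in _ - X]big1 ?subr0 // => x _.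
  by rewrite mxE scale0r.
have [B BM] : exists B, B *m M = 1%:M by exists (invmx M); rewrite mulVmx // -row_free_unit.
pose a := (\row_i c (enum_val i)) *m B.
have aM : a *m M = \row_i c (enum_val i) by rewrite -mulmxA BM mulmx1.
have a0 : a = 0.
  apply/rowP=> i; rewrite [RHS]mxE -(enum_valK i).
  apply: (indep (fun x => a 0 (enum_rank x))).
  have -> : \sum_x a 0 (enum_rank x) *: e x = (\sum_x a 0 (enum_rank x) *: e x
      - \sum_x (a *m M) 0 (enum_rank x) *: phi x) + \sum_x c x *: phi x.
    rewrite aM; rewrite [X in _ = _ - X + _](eq_bigr (fun x => c x *: phi x)) => [|x _]; last by rewrite mxE enum_rankK.
    by rewrite subrK.
  exact: ND.
move=> x; have := congr1 (fun m : 'rV_ _ => m 0 (enum_rank x)) aM.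
by rewrite a0 mul0mx !mxE enum_rankK => <-.
Qed.

Section QuotientLift.

Variables (R S : comPzRingType) (I : ideal R) (f : {rmorphism R -> S}).
Hypothesis fI : forall x, I x -> f x = 0.

Definition quot_lift (y : quot I) : S := f (repr y).

Lemma quot_liftE x : quot_lift (quot_pi I x) = f x.
Proof.
apply/eqP; rewrite -subr_eq0 -rmorphB; apply/eqP/fI/quot_piP.
by rewrite /quot_pi reprK.
Qed.

Lemma quot_lift_zmod_morphism : {morph quot_lift : x y / x - y}.
Proof.
move=> x y; have [a ->] := quot_pi_surj x; have [b ->] := quot_pi_surj y.
by rewrite -raddfB !quot_liftE raddfB.
Qed.

Lemma quot_lift_monoid_morphism : quot_lift 1 = 1 /\ {morph quot_lift : x y / x * y}.
Proof.
split; first by rewrite -(rmorph1 (quot_pi I)) quot_liftE rmorph1.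
move=> x y; have [a ->] := quot_pi_surj x; have [b ->] := quot_pi_surj y.
by rewrite -rmorphM !quot_liftE rmorphM.
Qed.

HB.instance Definition _ := GRing.isZmodMorphism.Build (quot I) S quot_lift
  quot_lift_zmod_morphism.
HB.instance Definition _ := GRing.isMonoidMorphism.Build (quot I) S quot_lift
  quot_lift_monoid_morphism.

Lemma quot_lift_rmorphism :
  exists phi : {rmorphism quot I -> S}, forall x, phi (quot_pi I x) = f x.
Proof. by exists quot_lift; apply: quot_liftE. Qed.

End QuotientLift.

(** * Pure spinors *)

(** Indicator bits turn identities on the 32 basis vectors of the spin module into case analyses on
    five booleans. *)
Definition mkset (b0 b1 b2 b3 b4 : bool) : {set 'I_5} :=
  [set i : 'I_5 | nth false [:: b0; b1; b2; b3; b4] i].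

Lemma mkset_surj (B : {set 'I_5}) :
  exists b0 b1 b2 b3 b4, B = mkset b0 b1 b2 b3 b4.
Proof.
exists (inord 0 \in B), (inord 1 \in B), (inord 2 \in B), (inord 3 \in B), (inord 4 \in B).
apply/setP=> i; rewrite inE -[in LHS](inord_val i).
by case: i; do 5!case=> //.
Qed.

Lemma mkset_even b0 b1 b2 b3 b4 :
  odd #|mkset b0 b1 b2 b3 b4| = b0 (+) b1 (+) b2 (+) b3 (+) b4.
Proof.
rewrite -sum1_card big_mkcond /= !big_ord_recl big_ord0 !inE /= .
by case: b0 b1 b2 b3 b4 => [] [] [] [] [].
Qed.

Notation "''o_' k" := (@Ordinal 5 k isT) (at level 0, k at level 0, format "''o_' k").

Lemma big_ord5 (R : Type) (idx : R) (op : Monoid.law idx) (F : 'I_5 -> R) :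
  \big[op/idx]_(i < 5) F i = op (op (op (op (F 'o_0) (F 'o_1)) (F 'o_2)) (F 'o_3)) (F 'o_4).
Proof.
rewrite !big_ord_recl big_ord0 Monoid.mulm1 !Monoid.mulmA.
by do ![congr (op _ (F _)); last exact: val_inj]; congr (F _); exact: val_inj.
Qed.

Section Clifford.

Variable K : numFieldType.
Implicit Types (s x y : spinor K) (u v : hyperbolic K).

Lemma clifford_mkset v s b0 b1 b2 b3 b4 :
  clifford v s (mkset b0 b1 b2 b3 b4) =
    (if b0 then v.1 0 'o_0 else v.2 0 'o_0) * s (mkset (~~ b0) b1 b2 b3 b4)
  + (if b1 then v.1 0 'o_1 else v.2 0 'o_1) * (-1) ^+ b0
      * s (mkset b0 (~~ b1) b2 b3 b4)
  + (if b2 then v.1 0 'o_2 else v.2 0 'o_2) * (-1) ^+ (b0 + b1)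
      * s (mkset b0 b1 (~~ b2) b3 b4)
  + (if b3 then v.1 0 'o_3 else v.2 0 'o_3) * (-1) ^+ (b0 + b1 + b2)
      * s (mkset b0 b1 b2 (~~ b3) b4)
  + (if b4 then v.1 0 'o_4 else v.2 0 'o_4) * (-1) ^+ (b0 + b1 + b2 + b3)
      * s (mkset b0 b1 b2 b3 (~~ b4)).
Proof.
have kz (k : 'I_5) : koszul K k (mkset b0 b1 b2 b3 b4) =
    (-1) ^+ \sum_(j < 5) (nth false [:: b0; b1; b2; b3; b4] j && (j < k)%N).
  rewrite /koszul -sum1_card big_mkcond; congr (_ ^+ _); apply: eq_bigr => j _.
  by rewrite !inE; case: ifP => // ->.
have fl (k : 'I_5) : flip k (mkset b0 b1 b2 b3 b4) =
   [set i : 'I_5 | (k == i) (+) nth false [:: b0; b1; b2; b3; b4] i].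
  by apply/setP=> i; rewrite in_flip !inE.
rewrite ffunE big_ord5 !kz !fl !big_ord5 !inE /= ?andbF ?andbT ?addn0 ?expr0 ?mulr1.
congr (_ + _ + _ + _ + _); congr (_ * s _); apply/setP=> i; rewrite !inE;
  by case: i; do 5!case=> //.
Qed.

End Clifford.

Section PureSpinors.

Variable K : numFieldType.
Implicit Types (s x y : spinor K) (u v : hyperbolic K).

(* The invariant pairing between the two half-spin modules. *)
Definition spin_pairing x y : K :=
  \sum_(b0 : bool) \sum_(b1 : bool) \sum_(b2 : bool) \sum_(b3 : bool) \sum_(b4 : bool)
    (-1) ^+ (b1 + b3) * x (mkset b0 b1 b2 b3 b4)
      * y (mkset (~~ b0) (~~ b1) (~~ b2) (~~ b3) (~~ b4)).

(** The sign in the pairing is made for this: deleting [i] from [B] changes it by [(-1)^i], which is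
    also the product of the Koszul signs of [i] in [B] and in its complement. *)
Lemma spin_pairing_clifford v x y :
  spin_pairing (clifford v x) y = spin_pairing x (clifford v y).
Proof.
rewrite /spin_pairing !big_bool !clifford_mkset /= ?addn0 ?add0n ?expr0 ?expr1.
rewrite ?[(1 + 1)%N]/2%N ?[(1 + 2)%N]/3%N.
set a0 := v.1 0 'o_0; set a1 := v.1 0 'o_1; set a2 := v.1 0 'o_2.
set a3 := v.1 0 'o_3; set a4 := v.1 0 'o_4.
set c0 := v.2 0 'o_0; set c1 := v.2 0 'o_1; set c2 := v.2 0 'o_2.
set c3 := v.2 0 'o_3; set c4 := v.2 0 'o_4.
ring.
Qed.

Lemma clifford_is_linear s u v a :
  clifford (a *: u + v) s = [ffun B => a * clifford u s B + clifford v s B].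
Proof.
apply/ffunP=> B; rewrite !ffunE mulr_sumr -big_split; apply: eq_bigr => i _ /=.
by case: ifP => _; rewrite !mxE; ring.
Qed.

Definition polar u v : K := \sum_i (u.1 0 i * v.2 0 i + v.1 0 i * u.2 0 i).

Lemma clifford_polar u v s B :
  clifford u (clifford v s) B + clifford v (clifford u s) B = polar u v * s B.
Proof.
have uv : u + v = 1 *: u + v by rewrite scale1r.
have E w x : clifford (u + v) x w = clifford u x w + clifford v x w.
  by rewrite uv clifford_is_linear ffunE mul1r.
have L x y w C : clifford w [ffun D => (x D + y D : K)] C = clifford w x C + clifford w y C.
  rewrite !ffunE -big_split; apply: eq_bigr => i _ /=.
  by rewrite ffunE; ring.
have -> : polar u v = quadric (u + v) - quadric u - quadric v.
  rewrite /quadric -!sumrB; apply: eq_bigr => i _ /=.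
  by rewrite !mxE; ring.
rewrite !mulrBl -!clifford_sqr.
have -> : clifford (u + v) s = [ffun D => clifford u s D + clifford v s D].
  by apply/ffunP=> D; rewrite E !ffunE.
rewrite E !L; ring.
Qed.

(** For [v] in [L] the linear forms [polar v] and [q] are proportional. If [q] were nonzero, each
    [polar v] would be a multiple of [q], and nondegeneracy of [polar] would leave room for a line
    at most, whereas [L] has dimension 5. *)
Lemma pure_spin_pairing s u : pure_even_spinor s -> spin_pairing s (clifford u s) = 0.
Proof.
move=> [_ _ [L [dimL _ Ls]]].
pose q w := spin_pairing s (clifford w s).
(* Both sides are the pairing of [u s] with [v u' s], since [v s = 0]. *)
have qq v w w' : v \in L -> polar v w * q w' = polar v w' * q w.
  move=> /Ls vs.
  have vv x (w1 : hyperbolic K) : clifford v (clifford w1 s) = [ffun B => polar v w1 * s B].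
    apply/ffunP=> B; rewrite [RHS]ffunE -clifford_polar vs.
    rewrite [X in _ = _ + X]ffunE [X in _ = _ + X]big1 ?addr0 // => i _.
    by rewrite ffunE mulr0.
  have scl c x y : spin_pairing [ffun B => c * x B] y = c * spin_pairing x y.
    rewrite /spin_pairing.
    do 5![rewrite mulr_sumr; apply: eq_bigr => ? _].
    by rewrite ffunE; ring.
  have scr c x y : spin_pairing x [ffun B => c * y B] = c * spin_pairing x y.
    rewrite /spin_pairing.
    do 5![rewrite mulr_sumr; apply: eq_bigr => ? _].
    by rewrite ffunE; ring.
  rewrite /q -scl -(vv s) spin_pairing_clifford (vv s) scr.
  by rewrite -spin_pairing_clifford.
apply/eqP; apply: contraT => qu.
have sep v : v \in L -> polar v u = 0 -> v = 0.
  move=> vL vu; have pv w : polar v w = 0.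
    apply/eqP; have := qq v w u vL; rewrite vu mul0r => /eqP.
    by rewrite mulf_eq0 (negbTE qu) orbF.
  have p1 i : v.1 0 i = 0.
    have := pv (0, delta_mx 0 i); rewrite /polar (bigD1 i) //= big1 => [|j ji].
      by rewrite !mxE !eqxx /= mulr1 mul0r !addr0.
    by rewrite !mxE eqxx (negbTE ji) /= mulr0 mul0r addr0.
  have p2 i : v.2 0 i = 0.
    have := pv (delta_mx 0 i, 0); rewrite /polar (bigD1 i) //= big1 => [|j ji].
      by rewrite !mxE !eqxx /= mul1r mulr0 !add0r addr0.
    by rewrite !mxE eqxx (negbTE ji) /= mulr0 mul0r addr0.
  by case: v {vL vu pv} p1 p2 => v1 v2 /= p1 p2; congr (_, _);
    apply/rowP=> i; rewrite mxE.
have polarD (a b : K) v w : polar (a *: v + b *: w) u = a * polar v u + b * polar w u.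
  by rewrite /polar !mulr_sumr -big_split; apply: eq_bigr => i _ /=; rewrite !mxE; ring.
have fr := basis_free (vbasisP L).
have lt0 : (0 < \dim L)%N by rewrite dimL.
have lt1 : (1 < \dim L)%N by rewrite dimL.
set v0 := (vbasis L)`_(Ordinal lt0); set v1 := (vbasis L)`_(Ordinal lt1).
have vL i : (vbasis L)`_(i : 'I_(\dim L)) \in L by rewrite vbasis_mem // mem_nth // size_tuple.
(* This combination of two basis vectors of [L] is orthogonal to [u], hence zero; freeness gives
   [polar v0 u = 0], and [sep] then kills the basis vector [v0]. *)
have comb : polar v1 u *: v0 + - polar v0 u *: v1 = 0.
  apply: sep; last by rewrite polarD; ring.
  by rewrite memvD // memvZ // vL.
have /freeP/(_ (fun i => if val i == 0%N then polar v1 u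
    else if val i == 1%N then - polar v0 u else 0)) := fr.
rewrite (bigD1 (Ordinal lt0)) //= (bigD1 (Ordinal lt1)) //= big1 ?addr0; last first.
  move=> i; rewrite -!val_eqE /= => /andP[/negbTE -> /negbTE ->].
  by rewrite scale0r.
move/(_ comb)/(_ (Ordinal lt1))/eqP; rewrite /= oppr_eq0 => /eqP v0u.
have v00 := sep v0 (vL _) v0u.
move: fr; rewrite free_directv => /andP[/negP[]]; rewrite -v00.
by rewrite mem_nth // size_tuple.
Qed.

End PureSpinors.

(* Coordinates of an even spinor, with indices modulo 5: [e], [w i j] and [v i] are
   its coordinates on the empty set, on {i, j} and, up to the sign (-1)^i, on the
   complement of {i}. *)
Section SpinorCoordinates.

Variable A : comNzRingType.
Implicit Types (e : A) (w : 'I_5 -> 'I_5 -> A) (v : 'I_5 -> A).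

Definition even_spinor e w v (B : {set 'I_5}) : A :=
  match 'o_0 \in B, 'o_1 \in B, 'o_2 \in B, 'o_3 \in B, 'o_4 \in B with
  | false, false, false, false, false => e
  | true, true, false, false, false => w 'o_0 'o_1
  | true, false, true, false, false => w 'o_0 'o_2
  | true, false, false, true, false => w 'o_0 'o_3
  | true, false, false, false, true => w 'o_0 'o_4
  | false, true, true, false, false => w 'o_1 'o_2
  | false, true, false, true, false => w 'o_1 'o_3
  | false, true, false, false, true => w 'o_1 'o_4
  | false, false, true, true, false => w 'o_2 'o_3
  | false, false, true, false, true => w 'o_2 'o_4
  | false, false, false, true, true => w 'o_3 'o_4
  | false, true, true, true, true => v 'o_0
  | true, false, true, true, true => - v 'o_1
  | true, true, false, true, true => v 'o_2
  | true, true, true, false, true => - v 'o_3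
  | true, true, true, true, false => v 'o_4
  | _, _, _, _, _ => 0
  end.

(** The Pfaffian of [w] with row and column [i] deleted. Listing the remaining indices cyclically
    instead of increasingly costs a sign [(-1)^i], which the coordinates [v i] absorb; the formulas
    are thereby invariant under the cyclic shift. *)
Definition pfaffian w (i : 'I_5) : A :=
  w (i + 1) (i + 2) * w (i + 3) (i + 4) - w (i + 1) (i + 3) * w (i + 2) (i + 4)
  + w (i + 1) (i + 4) * w (i + 2) (i + 3).

Definition quad e w v (k : 'I_5 + 'I_5) : A :=
  match k with
  | inl i => pfaffian w i - e * v i
  | inr i => \sum_j w i j * v j
  end.

Variable s : {set 'I_5} -> A.

Definition coord_e : A := s set0.
Definition coord_w (i j : 'I_5) : A :=
  if (i < j)%N then s [set i; j] else if (j < i)%N then - s [set i; j] else 0.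
Definition coord_v (i : 'I_5) : A := (-1) ^+ i * s (~: [set i]).

End SpinorCoordinates.

Lemma pfaffianE (A : comNzRingType) (w : 'I_5 -> 'I_5 -> A) :
  ((pfaffian w 'o_0 = (w 'o_1 'o_2 * w 'o_3 'o_4 - w 'o_1 'o_3 * w 'o_2 'o_4
                      + w 'o_1 'o_4 * w 'o_2 'o_3)%R) *
   (pfaffian w 'o_1 = (w 'o_2 'o_3 * w 'o_4 'o_0 - w 'o_2 'o_4 * w 'o_3 'o_0
                      + w 'o_2 'o_0 * w 'o_3 'o_4)%R) *
   (pfaffian w 'o_2 = (w 'o_3 'o_4 * w 'o_0 'o_1 - w 'o_3 'o_0 * w 'o_4 'o_1
                      + w 'o_3 'o_1 * w 'o_4 'o_0)%R) *
   (pfaffian w 'o_3 = (w 'o_4 'o_0 * w 'o_1 'o_2 - w 'o_4 'o_1 * w 'o_0 'o_2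
                      + w 'o_4 'o_2 * w 'o_0 'o_1)%R) *
   (pfaffian w 'o_4 = (w 'o_0 'o_1 * w 'o_2 'o_3 - w 'o_0 'o_2 * w 'o_1 'o_3
                      + w 'o_0 'o_3 * w 'o_1 'o_2)%R))%type.
Proof.
rewrite /pfaffian; do ?split; congr (_ * _ - _ * _ + _ * _);
  by congr (w _ _); apply: val_inj.
Qed.

Lemma clifford_delta (K : numFieldType) (s : spinor K) (i : 'I_5) b0 b1 b2 b3 b4
    (bs := [:: b0; b1; b2; b3; b4]) :
  let c := koszul K i (mkset b0 b1 b2 b3 b4) * s (flip i (mkset b0 b1 b2 b3 b4)) in
  (clifford (delta_mx 0 i, 0) s (mkset b0 b1 b2 b3 b4) = if nth false bs i then c else 0) *
  (clifford (0, delta_mx 0 i) s (mkset b0 b1 b2 b3 b4) = if nth false bs i then 0 else c).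
Proof.
split; rewrite ffunE (bigD1 i) //= big1 ?addr0 ?inE => [|j ji].
- by rewrite !mxE !eqxx; case: ifP => _; rewrite ?mul1r ?mul0r.
- by rewrite !mxE eqxx (negbTE ji) /=; case: ifP => _; rewrite !mul0r.
- by rewrite !mxE !eqxx; case: ifP => _; rewrite ?mul1r ?mul0r.
by rewrite !mxE eqxx (negbTE ji) /=; case: ifP => _; rewrite !mul0r.
Qed.

(** Up to sign, twice each quadric is the pairing of [s] with [clifford u s] for a basis vector [u]:
    vectors of W give the Pfaffian equations, those of the dual of W the equations linear in [w] and
    [v]. *)
Lemma pure_quad (K : numFieldType) (s : spinor K) k : pure_even_spinor s ->
  quad (coord_e s) (coord_w s) (coord_v s) k = 0.
Proof.
move=> pure_s; have [_ s_odd _] := pure_s.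
have odd0 b0 b1 b2 b3 b4 : b0 (+) b1 (+) b2 (+) b3 (+) b4 ->
    s (mkset b0 b1 b2 b3 b4) = 0.
  by move=> odd_b; apply: s_odd; rewrite mkset_even.
have sE (B : {set 'I_5}) :
    s B = s (mkset ('o_0 \in B) ('o_1 \in B) ('o_2 \in B) ('o_3 \in B) ('o_4 \in B)).
  by congr (s _); apply/setP=> -[[|[|[|[|[|?]]]]] ?]; rewrite inE //=;
    apply: (congr1 (fun i => i \in B)); apply: val_inj.
have e_s : coord_e s = s (mkset false false false false false).
  by rewrite /coord_e sE !inE.
have flipE (i : 'I_5) b0 b1 b2 b3 b4 : flip i (mkset b0 b1 b2 b3 b4) =
    mkset (('o_0 == i) (+) b0) (('o_1 == i) (+) b1) (('o_2 == i) (+) b2)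
          (('o_3 == i) (+) b3) (('o_4 == i) (+) b4).
  by apply/setP=> -[[|[|[|[|[|?]]]]] ?]; rewrite in_flip !inE //= eq_sym.
have kE (i : 'I_5) b0 b1 b2 b3 b4 : koszul K i (mkset b0 b1 b2 b3 b4) =
    (-1) ^+ ((b0 && (0 < i)) + (b1 && (1 < i)) + (b2 && (2 < i)) + (b3 && (3 < i)))%N.
  rewrite /koszul -sum1_card big_mkcond big_ord5 !inE /=; congr (_ ^+ _).
  have -> : (4 < i)%N = false by rewrite ltnNge -ltnS ltn_ord.
  by rewrite andbF addn0; case: (b0 && _); case: (b1 && _); case: (b2 && _); case: (b3 && _).
pose sg (i : 'I_5) (b0 b1 b2 b3 : bool) : K :=
  (-1) ^+ ((b0 && (0 < i)) + (b1 && (1 < i)) + (b2 && (2 < i)) + (b3 && (3 < i)))%N.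
pose S (i : 'I_5) (c : bool) := \sum_(b0 : bool) \sum_(b1 : bool) \sum_(b2 : bool)
  \sum_(b3 : bool) \sum_(b4 : bool) (-1) ^+ (b1 + b3) * s (mkset b0 b1 b2 b3 b4) *
    (if nth false [:: b0; b1; b2; b3; b4] i == c then
       sg i (~~ b0) (~~ b1) (~~ b2) (~~ b3) *
         s (mkset (('o_0 == i) (+) ~~ b0) (('o_1 == i) (+) ~~ b1) (('o_2 == i) (+) ~~ b2)
                  (('o_3 == i) (+) ~~ b3) (('o_4 == i) (+) ~~ b4)) else 0).
have nthN (i : 'I_5) b0 b1 b2 b3 b4 : nth false [:: ~~ b0; ~~ b1; ~~ b2; ~~ b3; ~~ b4] i =
    ~~ nth false [:: b0; b1; b2; b3; b4] i.
  by case: i => -[|[|[|[|[|]]]]].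
have S0 i : S i false = 0.
  rewrite -[RHS](pure_spin_pairing (delta_mx 0 i, 0) pure_s); do 5!apply: eq_bigr => ? _.
  by rewrite clifford_delta flipE kE nthN eqbF_neg.
have S1 i : S i true = 0.
  rewrite -[RHS](pure_spin_pairing (0, delta_mx 0 i) pure_s); do 5!apply: eq_bigr => ? _.
  by rewrite clifford_delta flipE kE nthN; case: (nth _ _ _).
have half (x : K) : x + x = 0 -> x = 0.
  by move/eqP; rewrite -mulr2n mulrn_eq0 => /eqP.
pose odd_s := (odd0 false false false false true isT,
  odd0 false false false true false isT,
  odd0 false false true false false isT,
  odd0 false false true true true isT,
  odd0 false true false false false isT,
  odd0 false true false true true isT,
  odd0 false true true false true isT,
  odd0 false true true true false isT,
  odd0 true false false false false isT,
  odd0 true false false true true isT,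
  odd0 true false true false true isT,
  odd0 true false true true false isT,
  odd0 true true false false true isT,
  odd0 true true false true false isT,
  odd0 true true true false false isT,
  odd0 true true true true true isT).
have oE := bool_irrelevance.
case: k => -[[|[|[|[|[|//]]]]] lt_i]; rewrite (oE _ lt_i isT) {lt_i oE}; apply: half.
- have := S0 'o_0; rewrite /S /sg !big_bool /= ?(mulr0, addr0, add0r) !odd_s.
  rewrite ?(mulr0, mul0r, addr0, add0r) /quad pfaffianE /coord_w /coord_v ?e_s /=.
  rewrite ![s [set _; _]]sE ![s (~: _)]sE !inE /= => H.
  by first [apply: etrans H; ring | apply: oppr_inj; rewrite oppr0; apply: etrans H; ring].
- have := S0 'o_1; rewrite /S /sg !big_bool /= ?(mulr0, addr0, add0r) !odd_s.
  rewrite ?(mulr0, mul0r, addr0, add0r) /quad pfaffianE /coord_w /coord_v ?e_s /=.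
  rewrite ![s [set _; _]]sE ![s (~: _)]sE !inE /= => H.
  by first [apply: etrans H; ring | apply: oppr_inj; rewrite oppr0; apply: etrans H; ring].
- have := S0 'o_2; rewrite /S /sg !big_bool /= ?(mulr0, addr0, add0r) !odd_s.
  rewrite ?(mulr0, mul0r, addr0, add0r) /quad pfaffianE /coord_w /coord_v ?e_s /=.
  rewrite ![s [set _; _]]sE ![s (~: _)]sE !inE /= => H.
  by first [apply: etrans H; ring | apply: oppr_inj; rewrite oppr0; apply: etrans H; ring].
- have := S0 'o_3; rewrite /S /sg !big_bool /= ?(mulr0, addr0, add0r) !odd_s.
  rewrite ?(mulr0, mul0r, addr0, add0r) /quad pfaffianE /coord_w /coord_v ?e_s /=.
  rewrite ![s [set _; _]]sE ![s (~: _)]sE !inE /= => H.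
  by first [apply: etrans H; ring | apply: oppr_inj; rewrite oppr0; apply: etrans H; ring].
- have := S0 'o_4; rewrite /S /sg !big_bool /= ?(mulr0, addr0, add0r) !odd_s.
  rewrite ?(mulr0, mul0r, addr0, add0r) /quad pfaffianE /coord_w /coord_v ?e_s /=.
  rewrite ![s [set _; _]]sE ![s (~: _)]sE !inE /= => H.
  by first [apply: etrans H; ring | apply: oppr_inj; rewrite oppr0; apply: etrans H; ring].
- have := S1 'o_0; rewrite /S /sg !big_bool /= ?(mulr0, addr0, add0r) !odd_s.
  rewrite ?(mulr0, mul0r, addr0, add0r) /quad big_ord5 /coord_w /coord_v ?e_s /=.
  rewrite ![s [set _; _]]sE ![s (~: _)]sE !inE /= => H.
  by first [apply: etrans H; ring | apply: oppr_inj; rewrite oppr0; apply: etrans H; ring].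
- have := S1 'o_1; rewrite /S /sg !big_bool /= ?(mulr0, addr0, add0r) !odd_s.
  rewrite ?(mulr0, mul0r, addr0, add0r) /quad big_ord5 /coord_w /coord_v ?e_s /=.
  rewrite ![s [set _; _]]sE ![s (~: _)]sE !inE /= => H.
  by first [apply: etrans H; ring | apply: oppr_inj; rewrite oppr0; apply: etrans H; ring].
- have := S1 'o_2; rewrite /S /sg !big_bool /= ?(mulr0, addr0, add0r) !odd_s.
  rewrite ?(mulr0, mul0r, addr0, add0r) /quad big_ord5 /coord_w /coord_v ?e_s /=.
  rewrite ![s [set _; _]]sE ![s (~: _)]sE !inE /= => H.
  by first [apply: etrans H; ring | apply: oppr_inj; rewrite oppr0; apply: etrans H; ring].
- have := S1 'o_3; rewrite /S /sg !big_bool /= ?(mulr0, addr0, add0r) !odd_s.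
  rewrite ?(mulr0, mul0r, addr0, add0r) /quad big_ord5 /coord_w /coord_v ?e_s /=.
  rewrite ![s [set _; _]]sE ![s (~: _)]sE !inE /= => H.
  by first [apply: etrans H; ring | apply: oppr_inj; rewrite oppr0; apply: etrans H; ring].
- have := S1 'o_4; rewrite /S /sg !big_bool /= ?(mulr0, addr0, add0r) !odd_s.
  rewrite ?(mulr0, mul0r, addr0, add0r) /quad big_ord5 /coord_w /coord_v ?e_s /=.
  rewrite ![s [set _; _]]sE ![s (~: _)]sE !inE /= => H.
  by first [apply: etrans H; ring | apply: oppr_inj; rewrite oppr0; apply: etrans H; ring].
Qed.

(** This spinor is [e] times the exponential of the bivector [w / e]. It is annihilated by the graph
    of the skew matrix [M], which is isotropic because [M] is skew. *)
Lemma pure_even_spinor_of_skew (K : numFieldType) (e : K) (w : 'I_5 -> 'I_5 -> K)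
    (v : 'I_5 -> K) :
  e != 0 -> (forall i j, w i j = - w j i) -> (forall i, e * v i = pfaffian w i) ->
  pure_even_spinor [ffun B => even_spinor e w v B].
Proof.
move=> e0 wC ev; pose M : 'M[K]_5 := \matrix_(j, i) (w i j / e).
have w0 i : w i i = 0.
  by apply/eqP; have /eqP := wC i i; rewrite -addr_eq0 -mulr2n mulrn_eq0.
have evenP b0 b1 b2 b3 b4 : b0 (+) b1 (+) b2 (+) b3 (+) b4 ->
    even_spinor e w v (mkset b0 b1 b2 b3 b4) = 0.
  by rewrite /even_spinor !inE /=; case: b0 b1 b2 b3 b4 => [] [] [] [] [].
split.
- move/ffunP/(_ set0)/eqP; rewrite !ffunE /even_spinor !inE /=.
  by rewrite (negbTE e0).
- move=> B; have [b0 [b1 [b2 [b3 [b4 ->]]]]] := mkset_surj B.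
  by rewrite mkset_even ffunE; apply: evenP.
pose X := [tuple ((row i M, delta_mx 0 i) : hyperbolic K) | i < 5].
have Xi (i : 'I_5) : X`_i = (row i M, delta_mx 0 i) by rewrite -tnth_nth tnth_mktuple.
have comb (c : 'I_5 -> K) : \sum_i c i *: X`_i = ((\row_i c i) *m M, \row_i c i).
  have -> : \sum_i c i *: X`_i = (\sum_i c i *: row i M, \sum_i c i *: delta_mx 0 i) :> hyperbolic K.
    elim/big_rec3: _ => //= i y1 y2 y3 _ ->; rewrite Xi.
    by [].
  congr (_, _); last by rewrite [RHS]row_sum_delta; apply: eq_bigr => i _; rewrite mxE.
  by rewrite mulmx_sum_row; apply: eq_bigr => i _; rewrite mxE.
have freeX : free X.
  apply/freeP => c; rewrite comb => -[_ /rowP c0] i.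
  by have := c0 i; rewrite !mxE.
exists <<X>>%VS; have LE u : u \in <<X>>%VS -> u.1 = u.2 *m M.
  by move/coord_span => ->; rewrite comb.
split=> [|u /LE|u /LE].
- by move: freeX; rewrite /free size_tuple => /eqP.
- case: u => x a /= ->; rewrite /quadric /=.
  rewrite !big_ord5 !mxE !big_ord5 !mxE !w0.
  rewrite (wC 'o_1 'o_0) (wC 'o_2 'o_0) (wC 'o_3 'o_0) (wC 'o_4 'o_0) (wC 'o_2 'o_1).
  rewrite (wC 'o_3 'o_1) (wC 'o_4 'o_1) (wC 'o_3 'o_2) (wC 'o_4 'o_2) (wC 'o_4 'o_3).
  by rewrite /=; field.
case: u => x a /= ->; apply/ffunP => B; rewrite [RHS]ffunE.
have [b0 [b1 [b2 [b3 [b4 ->]]]]] := mkset_surj B; rewrite clifford_mkset !ffunE.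
have [odd_b | even_b] := boolP (b0 (+) b1 (+) b2 (+) b3 (+) b4); last first.
  rewrite !evenP ?mulr0 ?addr0 //;
    by move: even_b; case: b0 b1 b2 b3 b4 => [] [] [] [] [].
have vE i : v i = pfaffian w i / e by rewrite -ev mulrAC divff ?mul1r.
rewrite !mxE !big_ord5 !mxE /even_spinor !inE /= !vE !pfaffianE !w0.
rewrite (wC 'o_1 'o_0) (wC 'o_2 'o_0) (wC 'o_3 'o_0) (wC 'o_4 'o_0) (wC 'o_2 'o_1).
rewrite (wC 'o_3 'o_1) (wC 'o_4 'o_1) (wC 'o_3 'o_2) (wC 'o_4 'o_2) (wC 'o_4 'o_3).
by case: b0 b1 b2 b3 b4 odd_b => [] [] [] [] [] //= _; field.
Qed.

(** * Standard monomials *)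

Section SpinorPolynomials.

Variable K : numFieldType.

Definition even_set (k : 'I_16) : {set 'I_5} := enum_val (cast_ord (esym card_even_sets) k).

Lemma even_setP k : ~~ odd #|even_set k|.
Proof. by have := enum_valP (cast_ord (esym card_even_sets) k); rewrite inE. Qed.

Lemma even_set_inj : injective even_set.
Proof. by move=> k l /enum_val_inj/cast_ord_inj. Qed.

Fact set0_even : set0 \in even_sets. Proof. by rewrite inE cards0. Qed.

Definition even_rank (B : {set 'I_5}) : 'I_16 :=
  cast_ord card_even_sets (enum_rank_in set0_even B).

Lemma even_rankK (B : {set 'I_5}) : ~~ odd #|B| -> even_set (even_rank B) = B.
Proof. by move=> Be; rewrite /even_set /even_rank cast_ordK enum_rankK_in // inE. Qed.

Definition spinor_var (B : {set 'I_5}) : {mpoly K[16]} :=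
  if odd #|B| then 0 else 'X_(even_rank B).

Lemma spinor_var_even_set k : spinor_var (even_set k) = 'X_k.
Proof.
rewrite /spinor_var (negbTE (even_setP k)); congr 'X_ _.
by apply: even_set_inj; rewrite even_rankK // even_setP.
Qed.

Definition spinor_subst (A : comNzRingType) (f : K -> A) (x : {set 'I_5} -> A)
    : {mpoly K[16]} -> A := mmap f (fun k => x (even_set k)).

Lemma spinor_subst_var (A : comNzRingType) (f : {rmorphism K -> A}) x (B : {set 'I_5}) :
  ~~ odd #|B| -> spinor_subst f x (spinor_var B) = x B.
Proof.
move=> Be; rewrite /spinor_subst /spinor_var (negbTE Be) mmapX mmap1U.
by rewrite even_rankK.
Qed.

(* The affine chart of the cone over the spinor variety: [a] is variable 10, and
   variables 0 to 9 are the entries of a skew matrix, ordered so that the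
   leading term of w_ij w_kl - w_ik w_jl + w_il w_jk is w_il w_jk. *)
Let chart_index : seq (seq nat) :=
  [:: [:: 0; 3; 4; 1; 0];
      [:: 3; 0; 5; 6; 2];
      [:: 4; 5; 0; 7; 8];
      [:: 1; 6; 7; 0; 9];
      [:: 0; 2; 8; 9; 0]]%N.

Definition chart_w (i j : 'I_5) : {mpoly K[11]} :=
  let x := 'X_(inord (nth 0%N (nth [::] chart_index i) j)) in
  if (i < j)%N then x else if (j < i)%N then - x else 0.

Let a : {mpoly K[11]} := 'X_(inord 10).

Definition chart : {set 'I_5} -> {mpoly K[11]} :=
  even_spinor a (fun i j => a * chart_w i j) (fun i => a * pfaffian chart_w i).

Lemma chart_w_skew i j : chart_w i j = - chart_w j i.
Proof.
rewrite /chart_w; case: ltngtP => ij; rewrite ?opprK ?oppr0 //.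
  congr ('X_(inord _)).
  by case: i ij => -[|[|[|[|[|//]]]]] ?; case: j => -[|[|[|[|[|//]]]]].
congr (- 'X_(inord _)).
by case: i ij => -[|[|[|[|[|//]]]]] ?; case: j => -[|[|[|[|[|//]]]]].
Qed.

(** The chart takes values in pure spinors wherever [a] is nonzero, and this is enough for a
    polynomial identity. Independence modulo the ideal can therefore be tested on leading monomials
    in 11 variables. *)
Lemma spinor_ideal_chart p : spinor_ideal K p -> spinor_subst (@mpolyC 11 K) chart p = 0.
Proof.
move=> Ip; apply: (@mpoly_id _ _ a _ (fun=> 1)) => [|v av].
  by rewrite mevalXU oner_neq0.
pose w i j := (a * chart_w i j).@[v]; pose u i := (a * pfaffian chart_w i).@[v].
have pure : pure_even_spinor [ffun B => even_spinor a.@[v] w u B].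
  apply: pure_even_spinor_of_skew => // [i j|i].
    by rewrite /w chart_w_skew mulrN mevalN.
  by rewrite /w /u /pfaffian !(mevalM, mevalB, mevalD); ring.
rewrite -[RHS](Ip _ pure) /spinor_subst meval_mmap; apply: meval_eq => k.
rewrite /spinor_coord ffunE /chart /even_spinor.
by do 5!case: (_ \in _) => //; rewrite ?meval0 ?mevalN.
Qed.

End SpinorPolynomials.

(* Standard monomials: a shelling of a triangulation of the toric degeneration of the
   spinor variety has 12 facets of 11 coordinates each, and a standard monomial is the
   product of the restriction face of a facet with any monomial in its coordinates. *)
Definition coord_bits : seq (seq bool) :=
  [seq [seq i \in s | i <- iota 0 5] | s <-
    [:: [::]; [:: 0; 1]; [:: 0; 2]; [:: 0; 3]; [:: 0; 4]; [:: 1; 2]; [:: 1; 3]; [:: 1; 4];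
        [:: 2; 3]; [:: 2; 4]; [:: 3; 4]; [:: 1; 2; 3; 4]; [:: 0; 2; 3; 4];
        [:: 0; 1; 3; 4]; [:: 0; 1; 2; 4]; [:: 0; 1; 2; 3]]]%N.

(* The leading monomials of these coordinates in the affine chart, without [a]. *)
Definition coord_lead : seq (seq nat) :=
  [:: [::]; [:: 3]; [:: 4]; [:: 1]; [:: 0]; [:: 5]; [:: 6]; [:: 2]; [:: 7]; [:: 8]; [:: 9];
      [:: 2; 7]; [:: 0; 7]; [:: 0; 6]; [:: 0; 5]; [:: 1; 5]]%N.

(** The first eight coordinates are cone points, common to all facets. The listed triples are the
    triangles, in shelling order, of a triangulated 2-sphere on the other eight coordinates. *)
Definition facet (k : nat) : seq nat :=
  ([:: 1; 2; 9; 10; 11; 13; 15; 0] ++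
  nth [::] [:: [:: 5; 8; 12]; [:: 3; 8; 12]; [:: 5; 12; 14]; [:: 4; 12; 14]; [:: 5; 6; 8];
     [:: 5; 6; 7]; [:: 3; 4; 12]; [:: 3; 6; 8]; [:: 3; 6; 7]; [:: 5; 7; 14]; [:: 4; 7; 14];
     [:: 3; 4; 7]] k)%N.

(** The least face of facet [k] contained in no earlier facet; sizes 0, 1, 2, 3 occur 1, 5, 5, 1
    times. *)
Definition restriction (k : nat) : seq nat :=
  nth [::] [:: [::]; [:: 3]; [:: 14]; [:: 4]; [:: 6]; [:: 7]; [:: 3; 4]; [:: 3; 6];
     [:: 3; 7]; [:: 7; 14]; [:: 4; 7]; [:: 3; 4; 7]]%N k.

Definition lead_exponent (k : nat) (f : nat -> nat) (i : nat) : nat :=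
  let d c := count_mem i (10%N :: nth [::] coord_lead c) in
  (sumn [seq d r | r <- restriction k]
   + sumn [seq f j * d (nth 0%N (facet k) j) | j <- iota 0 11])%N.

Definition multiplicity (k : nat) (f : nat -> nat) (c : nat) : nat :=
  (count_mem c (restriction k) + sumn [seq f j * (nth 0 (facet k) j == c) | j <- iota 0 11])%N.

Lemma size_facet k : (k < 12)%N -> size (facet k) = 11.
Proof.
move=> lt_k; have sz : all (fun k => size (facet k) == 11) (iota 0 12) by [].
by apply/eqP; have /allP := sz; apply; rewrite mem_iota.
Qed.

Lemma multiplicity_notin k f c : (k < 12)%N -> c \notin facet k -> multiplicity k f c = 0%N.
Proof.
move=> lt_k cF; have sub : all (fun k => all (mem (facet k)) (restriction k)) (iota 0 12) by [].
have k_in : k \in iota 0 12 by rewrite mem_iota.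
have /allP sub_k := allP sub k k_in; rewrite /multiplicity (count_memPn _); last first.
  by apply: contra cF => cR; apply: sub_k.
rewrite add0n; have : {subset iota 0 11 <= [pred j | j < size (facet k)]%N}.
  by move=> j; rewrite mem_iota inE size_facet.
elim: (iota 0 11) => //= j r IHr sr; rewrite IHr => [|i ir]; last first.
  by apply: sr; rewrite inE ir orbT.
case: eqP => [jc|_]; last by rewrite muln0.
by case/negP: cF; rewrite -jc mem_nth //; apply: sr; rewrite mem_head.
Qed.

Lemma multiplicity_restriction k f c : c \in restriction k -> (0 < multiplicity k f c)%N.
Proof. by move=> cR; rewrite addn_gt0 -has_count has_pred1 cR. Qed.

Lemma lead_exponent_linear k f : (k < 12)%N ->
  let x := lead_exponent k f in let N := multiplicity k f in
  (x 0 = N 4 + N 12 + N 13 + N 14 /\ x 1 = N 3 + N 15 /\ x 2 = N 7 + N 11 /\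
   x 3 = N 1 /\ x 4 = N 2 /\ x 5 = N 5 + N 14 + N 15 /\ x 6 = N 6 + N 13 /\
   x 7 = N 8 + N 11 + N 12 /\ x 8 = N 9 /\ x 9 = N 10 /\
   x 10 = sumn [seq N c | c <- iota 0 16])%N.
Proof.
do 12?[case: k => [|k] //]; move=> _; cbv zeta; rewrite /lead_exponent /multiplicity /=;
  by rewrite ?(muln0, muln1, addn0, add0n); do ?split; lia.
Qed.

(** The pairs of vertices of the sphere that are not joined by an edge. *)
Definition nonfaces : seq (nat * nat) :=
  [:: (7, 8); (7, 12); (3, 5); (3, 14); (6, 4); (6, 12); (6, 14); (8, 4); (8, 14); (4, 5)]%N.

Lemma multiplicity_nonface k f p : (k < 12)%N -> p \in nonfaces ->
  multiplicity k f p.1 = 0%N \/ multiplicity k f p.2 = 0%N.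
Proof.
move=> lt_k pn.
have sub : all (fun k => all (fun p => (p.1 \notin facet k) || (p.2 \notin facet k)) nonfaces)
  (iota 0 12) by [].
have k_in : k \in iota 0 12 by rewrite mem_iota.
have /allP/(_ p pn)/orP[] := allP sub k k_in; [left | right]; exact: multiplicity_notin.
Qed.

(* The exponents of variables 0 to 9 are vertex weights on a tree whose edges are the
   leading monomials of the last five coordinates, and the nonfaces force each edge to be
   used as often as possible. *)
Lemma lead_exponent_inj k k' f f' : (k < 12)%N -> (k' < 12)%N ->
  (forall i, (i < 11)%N -> lead_exponent k f i = lead_exponent k' f' i) ->
  k = k' /\ forall j, (j < 11)%N -> f j = f' j.
Proof.
move=> lt_k lt_k' H.
have : forall c, (c < 16)%N -> multiplicity k f c = multiplicity k' f' c.
  have := (H 0 isT, H 1 isT, H 2 isT, H 3 isT, H 4 isT, H 5 isT, H 6 isT, H 7 isT,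
    H 8 isT, H 9 isT, H 10 isT)%N.
  move: (lead_exponent_linear f lt_k) (lead_exponent_linear f' lt_k').
  cbv zeta; move: (lead_exponent k f) (lead_exponent k' f') => x x'.
  move: (fun p => @multiplicity_nonface k f p lt_k) (fun p => @multiplicity_nonface k' f' p lt_k').
  move: (multiplicity k f) (multiplicity k' f') => N N' nf nf'.
  move=> [e0 [e1 [e2 [e3 [e4 [e5 [e6 [e7 [e8 [e9 e10]]]]]]]]]].
  move=> [g0 [g1 [g2 [g3 [g4 [g5 [g6 [g7 [g8 [g9 g10]]]]]]]]]].
  move=> [[[[[[[[[[h0 h1] h2] h3] h4] h5] h6] h7] h8] h9] h10].
  (* The edges at the leaves 2, 1 and 6 of the tree are settled first; the two remaining edges, 12
     and 14, meet at vertex 0 and use them. *)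
  have d11 : N 11%N = N' 11%N.
    move: (nf (7, 8)%N isT) (nf (7, 12)%N isT) (nf' (7, 8)%N isT) (nf' (7, 12)%N isT) => /=.
    by clear -e2 e7 g2 g7 h2 h7; lia.
  have d15 : N 15%N = N' 15%N.
    move: (nf (3, 5)%N isT) (nf (3, 14)%N isT) (nf' (3, 5)%N isT) (nf' (3, 14)%N isT) => /=.
    by clear -e1 e5 g1 g5 h1 h5; lia.
  have d13 : N 13%N = N' 13%N.
    move: (nf (6, 4)%N isT) (nf (6, 12)%N isT) (nf (6, 14)%N isT).
    move: (nf' (6, 4)%N isT) (nf' (6, 12)%N isT) (nf' (6, 14)%N isT) => /=.
    by clear -e0 e6 g0 g6 h0 h6; lia.
  have d12 : N 12%N = N' 12%N.
    move: (nf (8, 4)%N isT) (nf (8, 14)%N isT) (nf' (8, 4)%N isT) (nf' (8, 14)%N isT) => /=.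
    by clear -e0 e7 g0 g7 h0 h7 d11 d13; lia.
  have d14 : N 14%N = N' 14%N.
    move: (nf (4, 5)%N isT) (nf' (4, 5)%N isT) => /=.
    by clear -e0 e5 g0 g5 h0 h5 d12 d13 d15; lia.
  move: e10 g10; rewrite /= => e10 g10.
  have d0 : N 0%N = N' 0%N.
    by clear nf nf'; lia.
  by do 16?[case=> [|]; first by move=> _; clear nf nf'; lia] => //.
move=> NN'.
(* By the shelling, the restriction face of the later of two facets is not contained in the earlier
   one, so the supports of the multiplicities distinguish the facets. *)
have sep : all (fun k => all (fun k' => (k == k') || has (fun c => c \notin facet k') (restriction k)
    || has (fun c => c \notin facet k) (restriction k')) (iota 0 12)) (iota 0 12) by [].
have mem12 i : (i < 12)%N -> i \in iota 0 12 by rewrite mem_iota.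
have lt16 : all (fun k => all (fun c => c < 16) (facet k ++ restriction k))%N (iota 0 12) by [].
have kk' : k = k'.
  have /allP/(_ _ (mem12 _ lt_k'))/orP[/orP[/eqP //|]|] := allP sep _ (mem12 _ lt_k).
    move=> /hasP[c cR cF]; have := multiplicity_restriction f cR.
    rewrite NN' ?multiplicity_notin //; have /allP := allP lt16 _ (mem12 _ lt_k); apply.
    by rewrite mem_cat cR orbT.
  move=> /hasP[c cR cF]; have := multiplicity_restriction f' cR.
  rewrite -NN' ?multiplicity_notin //; have /allP := allP lt16 _ (mem12 _ lt_k'); apply.
  by rewrite mem_cat cR orbT.
split=> // j lt_j; rewrite -kk' in NN' {lt_k'}.
have sz := size_facet lt_k.
have un : all (fun k => uniq (facet k)) (iota 0 12) by [].
have Nj g : multiplicity k g (nth 0%N (facet k) j)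
    = (count_mem (nth 0%N (facet k) j) (restriction k) + g j)%N.
  congr (_ + _)%N; have ju : j \in iota 0 11 by rewrite mem_iota.
  rewrite sumnE big_map (bigD1_seq j) ?iota_uniq // eqxx muln1 big_seq_cond big1 => [|i].
    exact: addn0.
  rewrite mem_iota add0n => /andP[/= lt_i ij].
  rewrite nth_uniq ?sz ?(allP un _ (mem12 _ lt_k)) // (negbTE ij).
  by rewrite muln0.
have := NN' (nth 0%N (facet k) j); rewrite !Nj => /(_ _)/addnI; apply.
have /allP := allP lt16 _ (mem12 _ lt_k); apply.
by rewrite mem_cat mem_nth ?sz.
Qed.

Section StandardMonomials.

Variable K : numFieldType.

Definition coord_set (c : nat) : {set 'I_5} :=
  [set i : 'I_5 | nth false (nth [::] coord_bits c) i].

Lemma coord_set_even c : (c < 16)%N -> ~~ odd #|coord_set c|.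
Proof.
set l := nth [::] coord_bits c.
have -> : coord_set c = mkset (nth false l 0) (nth false l 1) (nth false l 2)
    (nth false l 3) (nth false l 4).
  by apply/setP=> -[[|[|[|[|[|?]]]]] ?]; rewrite !inE.
rewrite mkset_even {}/l; by do 16?[case: c => [|c] //].
Qed.

Let u (x : nat) : 'X_{1..11} := U_(inord x)%MM.
Let u3 x y : 'X_{1..11} := (u 10 + u x + u y)%MM.

Let uE x (i : 'I_11) : (x < 11)%N -> u x i = (x == i) :> nat.
Proof. by move=> lt_x; rewrite mnm1E -val_eqE /= inordK. Qed.

Let u3_lt x y x' y' : (x < 10)%N -> (x < x' < 11)%N -> (x < y' < 11)%N -> (y < 11)%N ->
  (x <= y)%N -> (u3 x' y' < u3 x y)%O.
Proof.
move=> lt_x /andP[lx' lt_x'] /andP[ly' lt_y'] lt_y le_xy.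
have lt_x11 : (x < 11)%N by rewrite (ltn_trans lt_x).
apply/ltmcP; first by rewrite /u3 !mdegD !mdeg1.
exists (inord x) => [j|]; last first.
  rewrite !mnmDE !uE // inordK // (gtn_eqF lt_x) (gtn_eqF lx') (gtn_eqF ly') eqxx; lia.
rewrite inordK // => lt_j; rewrite !mnmDE !uE //.
have ne z : (x <= z)%N -> (z == j) = false by move=> /(leq_trans lt_j)/gtn_eqF.
by rewrite !ne // ltnW.
Qed.

Let lead_trinomial (m1 m2 m3 : 'X_{1..11}) (b1 b2 b3 : bool) (p : {mpoly K[11]}) :
  (m2 < m1)%O -> (m3 < m1)%O ->
  p = (-1) ^+ b1 *: 'X_[m1] + (-1) ^+ b2 *: 'X_[m2] + (-1) ^+ b3 *: 'X_[m3] ->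
  p != 0 /\ mlead p = m1.
Proof.
move=> lt21 lt31 ->; have s0 (b : bool) : (-1 : K) ^+ b != 0 by rewrite signr_eq0.
have l2 : mlead ((-1) ^+ b1 *: 'X_[K, m1] + (-1) ^+ b2 *: 'X_[m2]) = m1.
  by rewrite mleadDl !mleadZ ?mleadXm // !s0.
have l3 : mlead ((-1) ^+ b1 *: 'X_[K, m1] + (-1) ^+ b2 *: 'X_[m2] + (-1) ^+ b3 *: 'X_[m3]) = m1.
  by rewrite mleadDl l2 // mleadZ ?mleadXm // s0.
split=> //; rewrite -mleadc_eq0 l3 !mcoeffD !mcoeffZ !mcoeffX eqxx.
have [lt2 lt3] := (Order.POrderTheory.lt_eqF lt21, Order.POrderTheory.lt_eqF lt31).
by rewrite lt2 lt3 !mulr0 !addr0 mulr1 s0.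
Qed.

Lemma chart_lead c : (c < 16)%N -> chart K (coord_set c) != 0 /\
  forall i, mlead (chart K (coord_set c)) i =
    count_mem (val i) (10%N :: nth [::] coord_lead c).
Proof.
have X0 x : ('X_(inord x) : {mpoly K[11]}) != 0.
  by rewrite -msize_poly_eq0 msizeX.
have a1 : ('X_(inord 10) : {mpoly K[11]}) != 0 /\
    forall i, mlead ('X_(inord 10) : {mpoly K[11]}) i = count_mem (val i) [:: 10%N].
  by split=> // i; rewrite mleadXm uE //= addn0.
have aw x : (x < 11)%N -> ('X_(inord 10) * 'X_(inord x) : {mpoly K[11]}) != 0 /\
    forall i, mlead ('X_(inord 10) * 'X_(inord x) : {mpoly K[11]}) i =
      count_mem (val i) [:: 10%N; x].
  move=> lt_x; split=> [|i]; first by rewrite mulf_neq0.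
  by rewrite -mpolyXD mleadXm mnmDE !uE //= addn0.
have pf (p : {mpoly K[11]}) x y : p != 0 /\ mlead p = u3 x y -> (x < 11)%N -> (y < 11)%N ->
    p != 0 /\ forall i, mlead p i = count_mem (val i) [:: 10%N; x; y].
  move=> [p0 lp] lt_x lt_y; split=> // i; rewrite lp !mnmDE !uE //=.
  by rewrite addn0 addnA.
have signE := (expr0, expr1, scale1r, scaleN1r).
do 11?[case: c => [_|c]; first by rewrite /chart /even_spinor !inE /= /chart_w /=;
   (apply: a1 || apply: aw)].
rewrite /chart.
case: c => [_|c].
  rewrite /even_spinor !inE /=; apply: pf => //.
  apply: (@lead_trinomial _ (u3 6 8) (u3 5 9) false true false); rewrite ?u3_lt //.
  by rewrite !signE /u3 !mpolyXD pfaffianE /chart_w /=; ring.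
case: c => [_|c].
  rewrite /even_spinor !inE /=; apply: pf => //.
  apply: (@lead_trinomial _ (u3 1 8) (u3 4 9) false true false); rewrite ?u3_lt //.
  by rewrite !signE /u3 !mpolyXD pfaffianE /chart_w /=; ring.
case: c => [_|c].
  rewrite /even_spinor !inE /=; apply: pf => //.
  apply: (@lead_trinomial _ (u3 1 2) (u3 3 9) false true false); rewrite ?u3_lt //.
  by rewrite !signE /u3 !mpolyXD pfaffianE /chart_w /=; ring.
case: c => [_|c].
  rewrite /even_spinor !inE /=; apply: pf => //.
  apply: (@lead_trinomial _ (u3 2 4) (u3 3 8) false true false); rewrite ?u3_lt //.
  by rewrite !signE /u3 !mpolyXD pfaffianE /chart_w /=; ring.
case: c => [_|c].
  rewrite /even_spinor !inE /=; apply: pf => //.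
  apply: (@lead_trinomial _ (u3 4 6) (u3 3 7) false true false); rewrite ?u3_lt //.
  by rewrite !signE /u3 !mpolyXD pfaffianE /chart_w /=; ring.
by [].
Qed.

Definition standard_monomial (k : nat) (m : 'X_{1..11}) : {mpoly K[16]} :=
  \prod_(r <- restriction k) spinor_var K (coord_set r) *
  \prod_(j < 11) spinor_var K (coord_set (nth 0%N (facet k) j)) ^+ m j.

Lemma facet_lt16 k c : (k < 12)%N -> c \in facet k ++ restriction k -> (c < 16)%N.
Proof.
move=> lt_k; have lt16 : all (fun k => all (fun c => c < 16) (facet k ++ restriction k))%N
  (iota 0 12) by [].
have k_in : k \in iota 0 12 by rewrite mem_iota.
by have /allP := allP lt16 k k_in; apply.
Qed.

Lemma msize_standard_monomial k m : (k < 12)%N ->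
  (msize (standard_monomial k m) <= (size (restriction k) + mdeg m).+1)%N.
Proof.
move=> lt_k; have mM (p q : {mpoly K[16]}) (d e : nat) :
    (msize p <= d.+1 -> msize q <= e.+1 -> msize (p * q) <= (d + e).+1)%N.
  move=> sp sq; have [->|p0] := eqVneq p 0; first by rewrite mul0r msize0.
  have [->|q0] := eqVneq q 0; first by rewrite mulr0 msize0.
  by rewrite msizeM //; move: (msize p) (msize q) sp sq => a b; lia.
have mv c : (msize (spinor_var K (coord_set c)) <= 2)%N.
  by rewrite /spinor_var; case: ifP; rewrite ?msize0 // msizeX mdeg1.
apply: (mM).
  elim: (restriction k) => [|r s IHs]; first by rewrite big_nil msize1.
  by rewrite big_cons /=; apply: (mM _ _ 1%N).
rewrite mdegE; elim/big_rec2: _ => [|j y p _ IH]; first by rewrite msize1.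
apply: (mM) => //; elim: (m j) => [|e IHe]; first by rewrite expr0 msize1.
by rewrite exprS; apply: (mM _ _ 1%N).
Qed.

Lemma standard_monomial_lead k m (F := spinor_subst (@mpolyC 11 K) (chart K)) :
  (k < 12)%N -> F (standard_monomial k m) != 0 /\
  forall i, mlead (F (standard_monomial k m)) i = lead_exponent k (fun j => m (inord j)) i.
Proof.
move=> lt_k; have lt16 := @facet_lt16 k _ lt_k.
have Fv c : c \in facet k ++ restriction k ->
    F (spinor_var K (coord_set c)) = chart K (coord_set c).
  by move=> /lt16 lt_c; apply: spinor_subst_var; rewrite coord_set_even.
have facet_in (j : 'I_11) : nth 0%N (facet k) j \in facet k ++ restriction k.
  by rewrite mem_cat mem_nth // size_facet.
have res_in r : r \in restriction k -> r \in facet k ++ restriction k.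
  by rewrite mem_cat orbC => ->.
have FE : F (standard_monomial k m) = \prod_(r <- restriction k) chart K (coord_set r) *
  \prod_(j < 11) chart K (coord_set (nth 0%N (facet k) j)) ^+ m j.
  rewrite /F /spinor_subst rmorphM !rmorph_prod /=; congr (_ * _).
    by apply: eq_big_seq => r /res_in /Fv.
  by apply: eq_bigr => j _; rewrite rmorphXn; congr (_ ^+ _); exact: Fv.
have r0 : \prod_(r <- restriction k) chart K (coord_set r) != 0.
  by rewrite prodf_seq_neq0; apply/allP => r /res_in /lt16 /chart_lead[].
have f0 (j : 'I_11) : chart K (coord_set (nth 0%N (facet k) j)) != 0.
  by case: (chart_lead (lt16 _ (facet_in j))).
have p0 : \prod_(j < 11) chart K (coord_set (nth 0%N (facet k) j)) ^+ m j != 0.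
  by rewrite prodf_seq_neq0; apply/allP => j _; rewrite expf_neq0.
rewrite FE; split=> [|i]; first by rewrite mulf_neq0.
rewrite mleadM // mnmDE mlead_prod => [|r /res_in /lt16 /chart_lead[] //].
rewrite mlead_prod => [|j _ _]; last by rewrite expf_neq0.
rewrite !mnm_sumE /lead_exponent !sumnE !big_map; congr (_ + _)%N.
  by apply: eq_big_seq => r /res_in /lt16 /chart_lead[_].
rewrite -[X in iota X]subn0 -/(index_iota 0 11) big_mkord; apply: eq_bigr => j _.
rewrite mleadX // mulmnE inord_val mulnC; congr (_ * _)%N.
by case: (chart_lead (lt16 _ (facet_in j))).
Qed.

(** The images in the chart have pairwise distinct leading monomials. This is the lower bound on the
    Hilbert function. *)
Lemma standard_monomial_independent (X : finType) (k : X -> 'I_12) (m : X -> 'X_{1..11})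
    (c : X -> K) :
  injective (fun x => (k x, m x)) ->
  spinor_ideal K (\sum_x c x *: standard_monomial (k x) (m x)) -> forall x, c x = 0.
Proof.
move=> inj /spinor_ideal_chart; rewrite /spinor_subst raddf_sum => sum0.
pose F := spinor_subst (@mpolyC 11 K) (chart K).
apply: (@lead_independent K 11 X (fun x => F (standard_monomial (k x) (m x)))).
- by move=> x; case: (standard_monomial_lead (m x) (ltn_ord (k x))).
- move=> x y /= e; apply: inj.
  have H i : (i < 11)%N -> lead_exponent (k x) (fun j => m x (inord j)) i =
      lead_exponent (k y) (fun j => m y (inord j)) i.
    move=> lt_i; have [_ lx] := standard_monomial_lead (m x) (ltn_ord (k x)).
    have [_ ly] := standard_monomial_lead (m y) (ltn_ord (k y)).
    by rewrite -(lx (Ordinal lt_i)) -(ly (Ordinal lt_i)); rewrite -/F e.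
  have [kk mm] := lead_exponent_inj (ltn_ord (k x)) (ltn_ord (k y)) H.
  congr (_, _); first exact: val_inj.
  by apply/mnmP=> j; have := mm j (ltn_ord j); rewrite inord_val.
by rewrite -[RHS]sum0; apply: eq_bigr => x _; rewrite [RHS]/= mmapZ mul_mpolyC.
Qed.

End StandardMonomials.

(** * Linear sections *)

Section CoordinateLemmas.

Lemma coord_even_spinor (A : comNzRingType) (e : A) w v :
  (forall i j, w i j = - w j i) -> (forall i, w i i = 0) ->
  [/\ coord_e (even_spinor e w v) = e,
      forall i j, coord_w (even_spinor e w v) i j = w i j &
      forall i, coord_v (even_spinor e w v) i = v i].
Proof.
move=> wC w0; split=> [|i j|i].
- by rewrite /coord_e /even_spinor !inE.
- rewrite /coord_w; case: ltngtP => [ij|ij|/val_inj -> //]; rewrite ?(wC i j).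
    rewrite -wC /even_spinor !inE.
    by case: i ij => -[|[|[|[|[|//]]]]] pi; case: j => -[|[|[|[|[|//]]]]] pj //= _;
      congr (w _ _); apply: val_inj.
  congr (- _); rewrite /even_spinor !inE.
  by case: i ij => -[|[|[|[|[|//]]]]] pi; case: j => -[|[|[|[|[|//]]]]] pj //= _;
    congr (w _ _); apply: val_inj.
rewrite /coord_v /even_spinor !inE.
case: i => -[|[|[|[|[|//]]]]] pi; rewrite -signr_odd /= ?expr0 ?expr1 ?mul1r ?mulN1r ?opprK;
  by congr (v _); apply: val_inj.
Qed.

Lemma quad_morph (A B : comNzRingType) (f : {rmorphism A -> B}) e w v k :
  f (quad e w v k) = quad (f e) (fun i j => f (w i j)) (f \o v) k.
Proof.
case: k => i /=; last by rewrite rmorph_sum; apply: eq_bigr => j _; rewrite rmorphM.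
by rewrite /pfaffian !(rmorphB, rmorphD, rmorphM).
Qed.

Lemma eq_quad (A : comNzRingType) (e e' : A) w w' v v' k :
  e = e' -> (forall i j, w i j = w' i j) -> v =1 v' ->
  quad e w v k = quad e' w' v' k.
Proof.
move=> -> ww vv; case: k => i /=; first by rewrite /pfaffian !ww vv.
by apply: eq_bigr => j _; rewrite ww vv.
Qed.

Lemma coord_morph (A B : comNzRingType) (f : {rmorphism A -> B}) (s : {set 'I_5} -> A)
    (s' : {set 'I_5} -> B) : (forall B : {set 'I_5}, ~~ odd #|B| -> f (s B) = s' B) ->
  [/\ f (coord_e s) = coord_e s',
      forall i j, f (coord_w s i j) = coord_w s' i j &
      forall i, f (coord_v s i) = coord_v s' i].
Proof.
move=> fs; have e2 (i j : 'I_5) : i != j -> ~~ odd #|[set i; j]|.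
  by move=> ij; rewrite cards2 ij.
split=> [|i j|i]; first by rewrite /coord_e fs ?cards0.
  rewrite /coord_w; case: ltngtP => ij; rewrite ?rmorph0 // ?rmorphN fs ?e2 //.
    by rewrite -val_eqE ltn_eqF.
  by rewrite -val_eqE gtn_eqF.
by rewrite /coord_v rmorphM rmorph_sign fs // cardsC1 card_ord.
Qed.

End CoordinateLemmas.

Section SpinorQuadrics.

Variable K : numFieldType.

Definition spinor_quad (k : 'I_5 + 'I_5) : {mpoly K[16]} :=
  quad (coord_e (spinor_var K)) (coord_w (spinor_var K)) (coord_v (spinor_var K)) k.

Lemma spinor_quad_subst (A : comNzRingType) (f : {rmorphism K -> A}) x k :
  spinor_subst f x (spinor_quad k) = quad (coord_e x) (coord_w x) (coord_v x) k.
Proof.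
rewrite /spinor_subst quad_morph.
have [e w v] := @coord_morph _ _ (mmap f (fun k => x (even_set k))) (spinor_var K) x
  (@spinor_subst_var K A f x).
by apply: eq_quad.
Qed.

Lemma spinor_ideal_quad k : spinor_ideal K (spinor_quad k).
Proof.
move=> s pure_s; rewrite -(pure_quad k pure_s).
exact: (@spinor_quad_subst K idfun s k).
Qed.

Lemma coord_setP (B : {set 'I_5}) : ~~ odd #|B| -> exists2 c, (c < 16)%N & B = coord_set c.
Proof.
have [b0 [b1 [b2 [b3 [b4 ->]]]]] := mkset_surj B; rewrite mkset_even => even_b.
have b_in : [:: b0; b1; b2; b3; b4] \in coord_bits.
  by move: even_b; case: b0 b1 b2 b3 b4 => [] [] [] [] [].
exists (index [:: b0; b1; b2; b3; b4] coord_bits); first by rewrite -[16%N]/(size coord_bits) index_mem.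
by apply/setP=> i; rewrite !inE nth_index.
Qed.

End SpinorQuadrics.

Section DegreeBounds.

Lemma msizeM_bound n (R : idomainType) (p q : {mpoly R[n]}) d e :
  (msize p <= d)%N -> (msize q <= e.+1)%N -> (msize (p * q) <= d + e)%N.
Proof.
move=> sp sq; have [->|p0] := eqVneq p 0; first by rewrite mul0r msize0.
have [->|q0] := eqVneq q 0; first by rewrite mulr0 msize0.
by rewrite msizeM //; lia.
Qed.

Lemma msizeD_bound n (R : idomainType) (p q : {mpoly R[n]}) d :
  (msize p <= d)%N -> (msize q <= d)%N -> (msize (p + q) <= d)%N.
Proof. by move=> sp sq; rewrite (leq_trans (msizeD_le _ _)) // geq_max sp. Qed.

Lemma msize_sum_bound n (R : idomainType) I (r : seq I) (P : pred I)
    (F : I -> {mpoly R[n]}) d :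
  (forall i, P i -> msize (F i) <= d)%N -> (msize (\sum_(i <- r | P i) F i) <= d)%N.
Proof.
move=> sF; elim/big_ind: _ => // [|p q]; first by rewrite msize0.
exact: msizeD_bound.
Qed.

Lemma msizeZ_bound n (R : idomainType) (p : {mpoly R[n]}) c d :
  (msize p <= d)%N -> (msize (c *: p) <= d)%N.
Proof. exact/leq_trans/msizeZ_le. Qed.

Lemma msize_mmap n k (R : idomainType) (x : 'I_n -> {mpoly R[k]}) (p : {mpoly R[n]}) :
  (forall i, msize (x i) <= 2)%N -> (msize (mmap (@mpolyC k R) x p) <= msize p)%N.
Proof.
move=> sx; rewrite /mmap big_seq; apply: msize_sum_bound => m mp.
rewrite mul_mpolyC; apply: msizeZ_bound; apply: leq_trans (msize_mdeg_lt mp).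
rewrite /mmap1 mdegE; elim/big_rec2: _ => [|j y q _ IH]; first by rewrite msize1.
rewrite addnC -addSn mulrC; apply: msizeM_bound => //.
elim: (m j) => [|e IHe]; first by rewrite expr0 msize1.
by rewrite exprS mulrC -addn1; apply: (@msizeM_bound _ _ _ _ e.+1 1).
Qed.

End DegreeBounds.

Section LinearSection.

Variables (K : numFieldType) (z : 'I_5 -> 'I_5 -> 'I_5 -> K).

Local Notation T := {mpoly K[5]}.
Local Notation P := {mpoly K[16]}.

Definition section_w (i j : 'I_5) : T := \sum_k (z i j k - z j i k) *: 'X_k.

Lemma section_w_skew i j : section_w i j = - section_w j i.
Proof. by rewrite /section_w -sumrN; apply: eq_bigr => k _; rewrite -scaleNr opprB. Qed.

Lemma section_w_diag i : section_w i i = 0.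
Proof. by rewrite /section_w big1 // => k _; rewrite subrr scale0r. Qed.

Definition section_point : {set 'I_5} -> T :=
  even_spinor 0 section_w (fun j => 'X_j).

Definition restrict : P -> T := spinor_subst (@mpolyC 5 K) section_point.

Definition extend : T -> P := mmap (@mpolyC 16 K) (coord_v (spinor_var K)).

HB.instance Definition _ := GRing.RMorphism.on restrict.
HB.instance Definition _ := GRing.RMorphism.on extend.

Definition section_quad (k : 'I_5 + 'I_5) : T := quad 0 section_w (fun j => 'X_j) k.

Lemma restrict_var (B : {set 'I_5}) : ~~ odd #|B| ->
  restrict (spinor_var K B) = section_point B.
Proof. exact: spinor_subst_var. Qed.

Lemma restrictZ c p : restrict (c *: p) = c *: restrict p.
Proof. by rewrite /restrict /spinor_subst mmapZ mul_mpolyC. Qed.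

Lemma extendZ c p : extend (c *: p) = c *: extend p.
Proof. by rewrite /extend mmapZ mul_mpolyC. Qed.

Lemma extendC c : extend c%:MP = c%:MP. Proof. exact: mmapC. Qed.

Lemma extendX i : extend 'X_i = coord_v (spinor_var K) i.
Proof. by rewrite /extend mmapX mmap1U. Qed.

Lemma section_coord : [/\ coord_e section_point = 0,
  forall i j, coord_w section_point i j = section_w i j &
  forall i, coord_v section_point i = 'X_i].
Proof. exact: coord_even_spinor section_w_skew section_w_diag. Qed.

Lemma restrict_quad k : restrict (spinor_quad K k) = section_quad k.
Proof.
rewrite /restrict spinor_quad_subst; have [e w v] := section_coord.
exact: eq_quad.
Qed.

Lemma extendK : cancel extend restrict.
Proof.
move=> p; pose F q := restrict (extend q) = q.
have [_ _ vE] := @coord_morph _ _ restrict (spinor_var K) section_point restrict_var.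
have [_ _ sE] := section_coord.
have FX m : F 'X_[m].
  rewrite /F mpolyXE_id !rmorph_prod; apply: eq_bigr => i _.
  by rewrite !rmorphXn /= extendX vE sE.
rewrite -/(F p) (mpolyE p); elim/big_ind: _ => [|q1 q2 F1 F2|m _].
- by rewrite /F !rmorph0.
- by rewrite /F !rmorphD /= F1 F2.
by rewrite /F extendZ restrictZ FX.
Qed.

Lemma msize_spinor_var (B : {set 'I_5}) : (msize (spinor_var K B) <= 2)%N.
Proof. by rewrite /spinor_var; case: ifP; rewrite ?msize0 // msizeX mdeg1. Qed.

Lemma msize_section_w i j : (msize (section_w i j) <= 2)%N.
Proof.
by apply: msize_sum_bound => k _; apply: msizeZ_bound; rewrite msizeX mdeg1.
Qed.

Lemma msize_section_point B : (msize (section_point B) <= 2)%N.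
Proof.
rewrite /section_point /even_spinor.
by do 5!case: (_ \in _); rewrite ?msize0 ?msizeN ?msize_section_w ?msizeX ?mdeg1.
Qed.

Lemma msize_extend p : (msize (extend p) <= msize p)%N.
Proof.
apply: msize_mmap => i; rewrite /coord_v -signr_odd.
by case: (odd _); rewrite ?expr0 ?expr1 ?mul1r ?mulN1r ?msizeN msize_spinor_var.
Qed.

Lemma msize_restrict p : (msize (restrict p) <= msize p)%N.
Proof. by apply: msize_mmap => k; apply: msize_section_point. Qed.

Lemma msize_spinor_quad k : (msize (spinor_quad K k) <= 3)%N.
Proof.
have sv B c : (msize ((-1) ^+ c * spinor_var K B) <= 2)%N.
  by rewrite -signr_odd; case: (odd c);
    rewrite ?expr0 ?expr1 ?mul1r ?mulN1r ?msizeN msize_spinor_var.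
have sw i j : (msize (coord_w (spinor_var K) i j) <= 2)%N.
  by rewrite /coord_w; do 2?case: ifP; rewrite ?msizeN ?msize0 ?msize_spinor_var.
have mM (p q : P) : (msize p <= 2 -> msize q <= 2 -> msize (p * q) <= 3)%N.
  exact: (@msizeM_bound _ _ p q 2 1).
case: k => i; rewrite /spinor_quad /=; last first.
  by apply: msize_sum_bound => j _; apply: mM; [apply: sw | apply: sv].
rewrite /pfaffian; do ?apply: msizeD_bound; rewrite ?msizeN; apply: mM => //.
  exact: msize_spinor_var.
exact: sv.
Qed.

(* The 11 linear forms cutting out the section: [y - extend (restrict y)], where [y]
   runs over the coordinates on the sets with at most two elements. *)
Definition section_form (j : nat) : P :=
  spinor_var K (coord_set j) - extend (section_point (coord_set j)).

Lemma restrict_form j : (j < 16)%N -> restrict (section_form j) = 0.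
Proof.
by move=> lt_j; rewrite raddfB /= extendK restrict_var ?coord_set_even // subrr.
Qed.

(** The section is parametrized by its coordinates [v i], so on these five [extend] undoes
    [restrict]; only 11 forms remain. *)
Lemma section_form_top j : (10 < j < 16)%N -> section_form j = 0.
Proof.
case/andP=> lt_j lt_j16; apply/eqP; rewrite subr_eq0; apply/eqP.
have [i [eqi ptE]] : exists i : 'I_5, ~: [set i] = coord_set j /\
    section_point (coord_set j) = (-1) ^+ i *: 'X_i.
  have i_lt : (j - 11 < 5)%N by lia.
  exists (Ordinal i_lt); split.
    move: lt_j lt_j16 i_lt; do 16?[case: j => [|j] //] => _ _ i_lt //;
      by apply/setP=> -[[|[|[|[|[|?]]]]] ?]; rewrite !inE -?val_eqE.
  move: lt_j lt_j16 i_lt; do 16?[case: j => [|j] //] => _ _ i_lt //;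
    rewrite /section_point /even_spinor !inE /= -signr_odd /= ?scale1r ?scaleN1r;
    by congr ('X_ _) || congr (- 'X_ _); apply: val_inj.
by rewrite ptE extendZ extendX /coord_v eqi -mul_mpolyC rmorph_sign mulrA -expr2 sqrr_sign mul1r.
Qed.

(** With [rho] for restriction followed by extension, [x y - rho x * rho y = (x - rho x) * y + rho x
    * (y - rho y)] reduces a monomial to its variables. The multipliers lose one degree, which
    drives the induction of [section_spans]. *)
Lemma restrict_kernel d p : (msize p <= d.+1)%N ->
  exists2 q : 'I_11 -> P, forall j, (msize (q j) <= d)%N &
    p - extend (restrict p) = \sum_(j < 11) section_form j * q j.
Proof.
pose rho p := extend (restrict p).
pose good d p := exists2 q : 'I_11 -> P, forall j, (msize (q j) <= d)%N &
    p - rho p = \sum_(j < 11) section_form j * q j.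
have goodD d1 p1 p2 : good d1 p1 -> good d1 p2 -> good d1 (p1 + p2).
  move=> [q1 s1 e1] [q2 s2 e2]; exists (fun j => q1 j + q2 j) => [j|].
    exact: msizeD_bound.
  under eq_bigr do rewrite mulrDr; rewrite big_split /= -e1 -e2 /rho !rmorphD /=.
  by rewrite opprD addrACA.
have goodZ d1 c p1 : good d1 p1 -> good d1 (c *: p1).
  move=> [q1 s1 e1]; exists (fun j => c *: q1 j) => [j|]; first exact: msizeZ_bound.
  under eq_bigr do rewrite -scalerAr.
  by rewrite -scaler_sumr -e1 /rho restrictZ extendZ scalerBr.
have good0 d1 : good d1 0.
  by exists (fun=> 0) => [j|]; rewrite ?msize0 // /rho !rmorph0 subr0 big1 // => j _; rewrite mulr0.
have goodX d1 m : (mdeg m <= d1)%N -> good d1 'X_[m].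
  elim: d1 m => [|d1 IHd] m.
    rewrite leqn0 mdeg_eq0 => /eqP ->; rewrite mpolyX0; exists (fun=> 0) => [j|].
      by rewrite msize0.
    by rewrite /rho !rmorph1 subrr big1 // => j _; rewrite mulr0.
  have [->|/mnm_neq0[i mi]] := eqVneq m 0%MM.
    move=> _; rewrite mpolyX0; exists (fun=> 0) => [j|]; first by rewrite msize0.
    by rewrite /rho !rmorph1 subrr big1 // => j _; rewrite mulr0.
  have -> : m = (U_(i) + (m - U_(i)))%MM.
    rewrite addmC submK //; apply/mnm_lepP=> j; rewrite mnm1E.
    by case: eqP => // <-; rewrite lt0n.
  move: (m - U_(i))%MM => {mi}m; rewrite mdegD mdeg1 add1n ltnS => sm.
  have [q sq eq] := IHd m sm; rewrite mpolyXD.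
  have [c lt_c ec] := coord_setP (even_setP i).
  have Xi : 'X_i = spinor_var K (coord_set c) by rewrite -ec spinor_var_even_set.
  exists (fun j => rho 'X_i * q j + (if val j == c then 'X_[m] else 0)) => [j|].
    apply: msizeD_bound.
      rewrite mulrC -(addn1 d1); apply: msizeM_bound => //.
      by rewrite (leq_trans (msize_extend _)) // (leq_trans (msize_restrict _)) // msizeX mdeg1.
    by case: ifP; rewrite ?msize0 // msizeX.
  have step : 'X_i - rho 'X_i = section_form c.
    by rewrite /rho Xi restrict_var ?coord_set_even.
  have -> : 'X_i * 'X_[m] - rho ('X_i * 'X_[m]) =
      ('X_i - rho 'X_i) * 'X_[m] + rho 'X_i * ('X_[m] - rho 'X_[m]).
    have -> : rho ('X_i * 'X_[m]) = rho 'X_i * rho 'X_[m] by rewrite /rho !rmorphM.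
    by rewrite mulrBl mulrBr addrA subrK.
  rewrite eq step mulr_sumr; under [RHS]eq_bigr do rewrite mulrDr mulrCA.
  rewrite big_split /= addrC; congr (_ + _).
  have [lt_c11 | le_c] := ltnP c 11.
    rewrite (bigD1 (Ordinal lt_c11)) //= eqxx big1 ?addr0 // => j.
    by rewrite -val_eqE /= => /negbTE ->; rewrite mulr0.
  rewrite section_form_top ?le_c // mul0r big1 // => j _.
  by case: eqP => [jc|_]; [have := ltn_ord j; rewrite jc ltnNge le_c | rewrite mulr0].
have goods (s : seq 'X_{1..16}) : all (fun m => (mdeg m <= d)%N) s ->
    good d (\sum_(m <- s) p@_m *: 'X_[m]).
  elim: s => [|m s IHs] /=; first by rewrite big_nil.
  by move=> /andP[/goodX gm /IHs gs]; rewrite big_cons; apply/goodD/gs/goodZ.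
move=> sp; have : good d p.
  rewrite [p in good d p](mpolyE p); apply: goods; apply/allP => m mp.
  by rewrite -ltnS (leq_trans (msize_mdeg_lt mp)).
by case=> q sq eq; exists q.
Qed.

End LinearSection.

(** * Freeness over the polynomial ring in the linear forms *)

Section Freeness.

Variables (K : numFieldType) (z : 'I_5 -> 'I_5 -> 'I_5 -> K).

Local Notation T := {mpoly K[5]}.
Local Notation P := {mpoly K[16]}.
Local Notation QI := ('I_5 + 'I_5)%type.

Definition gen_degree (k : 'I_12) : nat := size (restriction k).

Definition section_ideal (t : T) : Prop :=
  exists r : QI -> T, t = \sum_k r k * section_quad z k.

Definition quad_ideal (p : P) : Prop :=
  exists r : QI -> P, p = \sum_k r k * spinor_quad K k.

(** Spanning modulo the quadrics within a degree budget: an element of degree below [d] uses only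
    generators of degree below [d] and multiples of quadrics of degree below [d]. The budget
    survives lifting to [P], which makes the counting there finite. *)
Definition generates (b : 'I_12 -> T) : Prop :=
  (forall k, msize (b k) <= (gen_degree k).+1)%N /\
  forall d t, (msize t <= d)%N -> exists (c : 'I_12 -> K) (r : QI -> T),
    [/\ forall k, (d <= gen_degree k)%N -> c k = 0,
        forall k, (msize (r k) <= d - 2)%N &
        t = \sum_k c k *: b k + \sum_k r k * section_quad z k].

Definition form_subst : {mpoly K[11]} -> P :=
  mmap (@mpolyC 16 K) (fun j : 'I_11 => section_form z j).

HB.instance Definition _ := GRing.RMorphism.on form_subst.

Lemma form_substC c : form_subst c%:MP = c%:MP. Proof. exact: mmapC. Qed.

Lemma form_substX i : form_subst 'X_i = section_form z i.
Proof. by rewrite /form_subst mmapX mmap1U. Qed.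

Definition section_basis (b : 'I_12 -> T) (g : 'I_12 -> {mpoly K[11]}) : P :=
  \sum_k form_subst (g k) * extend (b k).

Lemma section_basisD b g1 g2 :
  section_basis b (fun k => g1 k + g2 k) = section_basis b g1 + section_basis b g2.
Proof. by rewrite -big_split; apply: eq_bigr => k _; rewrite rmorphD mulrDl. Qed.

Lemma section_basisM b g1 g2 :
  section_basis b (fun k => g1 * g2 k) = form_subst g1 * section_basis b g2.
Proof. by rewrite mulr_sumr; apply: eq_bigr => k _; rewrite rmorphM mulrA. Qed.

Lemma quad_idealD p1 p2 : quad_ideal p1 -> quad_ideal p2 -> quad_ideal (p1 + p2).
Proof.
move=> [r1 ->] [r2 ->]; exists (fun k => r1 k + r2 k).
by rewrite -big_split; apply: eq_bigr => k _; rewrite mulrDl.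
Qed.

Lemma quad_idealM a p : quad_ideal p -> quad_ideal (a * p).
Proof.
move=> [r ->]; exists (fun k => a * r k).
by rewrite mulr_sumr; apply: eq_bigr => k _; rewrite mulrA.
Qed.

Lemma quad_ideal0 : quad_ideal 0.
Proof. by exists (fun=> 0); rewrite big1 // => k _; rewrite mul0r. Qed.

Lemma quad_ideal_vanishes p : quad_ideal p -> spinor_ideal K p.
Proof.
case=> r ->; elim/big_ind: _ => [|p1 p2|k _]; first exact: ideal_mem0.
  exact: ideal_memD.
by apply: (@ideal_memM _ (spinor_ideal K)); apply: spinor_ideal_quad.
Qed.

Lemma restrict_quad_ideal p : quad_ideal p -> section_ideal (restrict z p).
Proof.
case=> r ->; exists (fun k => restrict z (r k)).
by rewrite rmorph_sum; apply: eq_bigr => k _; rewrite rmorphM /= restrict_quad.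
Qed.

Variable b : 'I_12 -> T.
Hypothesis gen_b : generates b.

Lemma section_spans d p : (msize p <= d)%N ->
  exists2 g : 'I_12 -> {mpoly K[11]}, forall k, (msize (g k) <= d - gen_degree k)%N &
    quad_ideal (p - section_basis b g).
Proof.
have [sb span_b] := gen_b.
elim: d p => [|d IHd] p sp.
  exists (fun=> 0) => [k|]; first by rewrite msize0.
  have -> : p = 0 by apply/eqP; rewrite -msize_poly_eq0 -leqn0.
  by rewrite /section_basis big1 ?subr0 => [|k _]; [exact: quad_ideal0 | rewrite rmorph0 mul0r].
have [c [r [c0 sr e]]] := span_b d.+1 (restrict z p) (leq_trans (msize_restrict z p) sp).
pose p1 := \sum_k c k *: extend (b k); pose p2 := \sum_k extend (r k) * spinor_quad K k.
have rp' : restrict z (p - p1 - p2) = 0.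
  rewrite !rmorphB /= e /p1 /p2 !rmorph_sum /=.
  have -> : \sum_k restrict z (c k *: extend (b k)) = \sum_k c k *: b k.
    by apply: eq_bigr => k _; rewrite restrictZ extendK.
  have -> : \sum_k restrict z (extend (r k) * spinor_quad K k) = \sum_k r k * section_quad z k.
    by apply: eq_bigr => k _; rewrite rmorphM /= extendK restrict_quad.
  by rewrite -addrA -opprD subrr.
have sp' : (msize (p - p1 - p2) <= d.+1)%N.
  do 2?apply: msizeD_bound => //; rewrite msizeN; apply: msize_sum_bound => k _.
    have [lt_d | le_d] := leqP d.+1 (gen_degree k); first by rewrite c0 // scale0r msize0.
    by apply: msizeZ_bound; rewrite (leq_trans (msize_extend _)) // (leq_trans (sb k)).
  have := sr k; rewrite subSS => srk.
  (* For [d = 0] the truncated bound is 0 and forces [r k = 0]; otherwise it leaves exactly the two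
     degrees of the quadric. *)
  case: (d) srk => [|d'] srk.
    have -> : r k = 0 by apply/eqP; rewrite -msize_poly_eq0 -leqn0.
    by rewrite rmorph0 mul0r msize0.
  rewrite subSS subn0 in srk; rewrite -(addn2 d'); apply: msizeM_bound; last exact: msize_spinor_quad.
  exact: leq_trans (msize_extend _) srk.
have [q sq] := restrict_kernel z sp'; rewrite rp' rmorph0 subr0 => e'.
have /choice[g gP] (j : 'I_11) : exists g : 'I_12 -> {mpoly K[11]},
    (forall k, (msize (g k) <= d - gen_degree k)%N) /\ quad_ideal (q j - section_basis b g).
  by have [g sg Qg] := IHd (q j) (sq j); exists g.
exists (fun k => (c k)%:MP + \sum_j 'X_j * g j k) => [k|].
  apply: msizeD_bound.
    have [le_d | lt_d] := leqP d.+1 (gen_degree k); first by rewrite c0 // mpolyC0 msize0.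
    by rewrite msizeC (leq_trans (leq_b1 _)) // subn_gt0.
  apply: msize_sum_bound => j _; have [sg _] := gP j; have := sg k.
  have [le_d | lt_d] := leqP d (gen_degree k) => sgk.
    have -> : g j k = 0.
      by apply/eqP; rewrite -msize_poly_eq0 -leqn0 (leq_trans sgk) // leqn0 subn_eq0.
    by rewrite mulr0 msize0.
  rewrite subSn ?(ltnW lt_d) // -(addn1 (d - _)%N) mulrC; apply: msizeM_bound => //.
  by rewrite msizeX mdeg1.
rewrite section_basisD.
have -> : section_basis b (fun k => (c k)%:MP) = p1.
  by apply: eq_bigr => k _; rewrite form_substC mul_mpolyC.
have -> : section_basis b (fun k => \sum_j 'X_j * g j k) =
    \sum_(j < 11) section_form z j * section_basis b (g j).
  under [RHS]eq_bigr do rewrite -form_substX -section_basisM.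
  rewrite /section_basis exchange_big; apply: eq_bigr => k _ /=.
  by rewrite rmorph_sum mulr_suml.
set s := \sum_(j < 11) _.
have -> : p - (p1 + s) = (p - p1 - p2 - s) + p2 by ring.
apply: quad_idealD; last by exists (fun k => extend (r k)).
rewrite e' /s -sumrB; elim/big_ind: _ => [|u v|j _]; first exact: quad_ideal0.
  exact: quad_idealD.
by rewrite -mulrBr; apply: quad_idealM; case: (gP j).
Qed.

(** Standard monomials and the products [phi] are indexed by the same finite set of pairs below
    degree [d]. The former are independent and lie in the span of the latter modulo the ideal, so
    the latter are independent too. *)
Lemma section_basis_free g : spinor_ideal K (section_basis b g) -> forall k, g k = 0.
Proof.
pose d := \max_k (msize (g k) + gen_degree k)%N.
have sg k : (msize (g k) <= d - gen_degree k)%N.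
  have : (msize (g k) + gen_degree k <= d)%N by exact: (leq_bigmax k).
  by move: d (msize _) => D s; lia.
pose A := [pred x : 'I_12 * 'X_{1..11 < d.+1} | (gen_degree x.1 + mdeg x.2 < d)%N].
pose X := {x in A}.
pose phi (x : 'I_12 * 'X_{1..11 < d.+1}) := form_subst 'X_[x.2] * extend (b x.1).
have expand g' : (forall k, (msize (g' k) <= d - gen_degree k)%N) ->
    section_basis b g' = \sum_(x : X) (g' (val x).1)@_(val x).2 *: phi (val x).
  move=> sg'; transitivity (\sum_(x : 'I_12 * 'X_{1..11 < d.+1}) (g' x.1)@_(x.2) *: phi x); last first.
    rewrite (bigID (mem A)) /= [X in _ + X]big1 ?addr0 => [|x]; last first.
      rewrite inE -leqNgt => le_d; rewrite (_ : (g' x.1)@_(x.2) = 0) ?scale0r //.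
      apply: memN_msupp_eq0; apply: msize_mdeg_ge; rewrite (leq_trans (sg' _)) //.
      by rewrite leq_subLR.
    exact: (big_sub A (fun x => (g' x.1)@_(x.2) *: phi x)).
  rewrite -(pair_big xpredT xpredT (fun k (m : 'X_{1..11 < d.+1}) => (g' k)@_m *: phi (k, m))) /=.
  apply: eq_bigr => k _.
  have s' : (msize (g' k) <= d.+1)%N by rewrite (leq_trans (sg' k)) // (leq_trans (leq_subr _ _)).
  rewrite /form_subst (mmapE _ s') mulr_suml; apply: eq_bigr => m _.
  by rewrite /phi /form_subst mmapX mul_mpolyC -scalerAl.
move=> Ig k; apply/mpolyP => m; rewrite mcoeff0.
have [mk | mk] := boolP (m \in msupp (g k)); last exact: memN_msupp_eq0.
have lt_m : (gen_degree k + mdeg m < d)%N.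
  have := leq_trans (msize_mdeg_lt mk) (sg k); lia.
have lt_md : (mdeg m < d.+1)%N by lia.
pose x : X := Sub (k, BMultinom lt_md) lt_m.
have N0 := ideal_mem0 (spinor_ideal K).
have ND := @ideal_memD _ (spinor_ideal K).
have NZ a v : spinor_ideal K v -> spinor_ideal K (a *: v).
  by rewrite -mul_mpolyC; apply: (@ideal_memM _ (spinor_ideal K)).
apply: (@independent_of_span K P (spinor_ideal K) X
  (fun x => standard_monomial K (val x).1 (val x).2) (fun x => phi (val x)) N0 ND NZ _ _
  (fun x0 : X => (g (val x0).1)@_((val x0).2)) _ x).
- move=> c; apply: (@standard_monomial_independent K X (fun x => (val x).1)
    (fun x => bmnm (val x).2)).
  by move=> x1 x2 /= [e1 /val_inj e2]; apply: val_inj; rewrite [LHS]surjective_pairing e1 e2 -surjective_pairing.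
- move=> y; have [g' sg' Qg'] := @section_spans d (standard_monomial K (val y).1 (val y).2)
    (leq_trans (msize_standard_monomial _ _ (ltn_ord _)) (valP y)).
  exists (fun y0 : X => (g' (val y0).1)@_((val y0).2)); rewrite -expand //.
  exact: quad_ideal_vanishes.
by rewrite -expand.
Qed.

(** Modulo the quadrics an element of the ideal is some [section_basis b g]; this lies in the ideal
    again, and freeness makes it zero. *)
Lemma spinor_idealE p : spinor_ideal K p <-> quad_ideal p.
Proof.
split=> [Ip|]; last exact: quad_ideal_vanishes.
have [g _ Qg] := section_spans (leqnn (msize p)).
have /section_basis_free g0 : spinor_ideal K (section_basis b g).
  have -> : section_basis b g = p + - (p - section_basis b g) by rewrite opprB addrC subrK.
  by apply: (@ideal_memD _ (spinor_ideal K)) => //; apply/ideal_memN/quad_ideal_vanishes.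
move: Qg; rewrite /section_basis big1 ?subr0 // => k _.
by rewrite g0 rmorph0 mul0r.
Qed.

End Freeness.

Lemma dhomog_mmap n k (R : idomainType) (x : 'I_n -> {mpoly R[k]}) d (p : {mpoly R[n]}) :
  (forall i, x i \is 1.-homog) -> p \is d.-homog -> mmap (@mpolyC k R) x p \is d.-homog.
Proof.
move=> hx hp; rewrite /mmap big_seq; apply: rpred_sum => m mp.
rewrite mul_mpolyC; apply: rpredZ.
have -> : d = \sum_j m j by rewrite -(dhomog_mf hp mp) -mdegE.
rewrite /mmap1.
elim/big_rec2: _ => [|j y q _ IH]; first exact: dhomog1.
by apply: dhomogM => //; have := dhomogMn (m j) (hx j); rewrite mul1n.
Qed.

(** The variables form a regular sequence, monomial by monomial: a monomial divisible by no earlier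
    variable stays so after multiplication by ['X_i], hence its coefficient in [g] is zero. *)
Lemma mulX_regular n (R : idomainType) (i : 'I_n) (g : {mpoly R[n]}) (v : 'I_n -> {mpoly R[n]}) :
  'X_i * g = \sum_(j < n | (j < i)%N) 'X_j * v j ->
  exists u : 'I_n -> {mpoly R[n]}, g = \sum_(j < n | (j < i)%N) 'X_j * u j.
Proof.
move=> e; pose good p := exists u : 'I_n -> {mpoly R[n]}, p = \sum_(j < n | (j < i)%N) 'X_j * u j.
suff goods (s : seq 'X_{1..n}) : good (\sum_(m <- s) g@_m *: 'X_[m]).
  by have [u] := goods (msupp g); rewrite -mpolyE; exists u.
elim: s => [|m s [u eu]]; first by exists (fun=> 0); rewrite big_nil big1 // => j _; rewrite mulr0.
rewrite big_cons eu; have [/existsP[j /andP[ji mj]]|] :=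
    boolP [exists j : 'I_n, (j < i)%N && (m j != 0%N)].
  exists (fun k => u k + (if k == j then g@_m *: 'X_[m - U_(j)] else 0)).
  under [RHS]eq_bigr do rewrite mulrDr.
  rewrite big_split /= addrC; congr (_ + _); rewrite (bigD1 j) //= eqxx big1 ?addr0.
    rewrite -scalerAr -mpolyXD addmC submK //; apply/mnm_lepP=> k; rewrite mnm1E.
    by case: eqP => // <-; rewrite lt0n.
  by move=> k /andP[_ /negbTE ->]; rewrite mulr0.
rewrite negb_exists => /forallP mj0; suff -> : g@_m = 0 by exists u; rewrite scale0r add0r.
have := congr1 (mcoeff (U_(i) + m)%MM) e; rewrite mulrC mcoeffMX => ->.
rewrite raddf_sum big1 // => j ji /=; rewrite mulrC.
have [jm | jm] := boolP ((U_(i) + m)%MM \in msupp (v j * 'X_j)); last exact: memN_msupp_eq0.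
have := msuppM_le jm; move/allpairsP => [[m1 m2] /= [_]].
rewrite msuppX inE => /eqP -> /(congr1 (fun f : 'X_{1..n} => f j)).
rewrite !mnmDE !mnm1E eqxx -val_eqE /= (gtn_eqF ji) add0n.
by have := mj0 j; rewrite ji /= negbK => /eqP -> /esym/eqP; rewrite addn1.
Qed.

(** * Regularity of the forms and the coordinate ring of a section *)

Section SectionQuotient.

Variables (K : numFieldType) (z : 'I_5 -> 'I_5 -> 'I_5 -> K).

Local Notation T := {mpoly K[5]}.
Local Notation P := {mpoly K[16]}.

Lemma spinor_var_homog (B : {set 'I_5}) : spinor_var K B \is 1.-homog.
Proof. by rewrite /spinor_var; case: ifP; rewrite ?dhomog0 // dhomogX /= mdeg1. Qed.

Lemma section_point_homog B : section_point z B \is 1.-homog.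
Proof.
have w i j : section_w z i j \is 1.-homog.
  by apply: rpred_sum => k _; apply: rpredZ; rewrite dhomogX /= mdeg1.
have x (i : 'I_5) : ('X_i : T) \is 1.-homog by rewrite dhomogX /= mdeg1.
rewrite /section_point /even_spinor.
by case: ('o_0 \in B); case: ('o_1 \in B); case: ('o_2 \in B); case: ('o_3 \in B);
  case: ('o_4 \in B); rewrite ?dhomog0 ?rpredN.
Qed.

Lemma extend_homog d (t : T) : t \is d.-homog -> extend t \is d.-homog.
Proof.
apply: dhomog_mmap => i; rewrite /coord_v -signr_odd.
by case: (odd _); rewrite ?expr0 ?expr1 ?mul1r ?mulN1r ?rpredN spinor_var_homog.
Qed.

Lemma restrict_homog d (p : P) : p \is d.-homog -> restrict z p \is d.-homog.
Proof. by apply: dhomog_mmap => k; apply: section_point_homog. Qed.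

Variables (b : 'I_12 -> T) (I : ideal T).
Hypotheses (gen_b : generates z b) (IE : forall t, I t <-> section_ideal z t).
Hypothesis proper_I : ~ I 1.

Let piS : P -> spinor_ring K := quot_pi (spinor_ideal K).

Definition section_forms (i : 'I_11) : spinor_ring K := piS (section_form z i).

Let piSE p q : piS p = piS q <-> quad_ideal (p - q).
Proof. by rewrite -(spinor_idealE gen_b); apply: quot_piP. Qed.

Let spanP m x : prefix_span section_forms m x <-> exists q : 'I_11 -> P,
  x = piS (\sum_(j < 11 | (j < m)%N) q j * section_form z j).
Proof.
split=> [[c ->]|[q ->]].
  have /choice[q qc] j : exists q, c j = piS q by apply: quot_pi_surj.
  exists q; rewrite /piS raddf_sum; apply: eq_bigr => j _.
  by rewrite qc -rmorphM.
exists (fun j => piS (q j)); rewrite /piS raddf_sum; apply: eq_bigr => j _.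
by rewrite -rmorphM.
Qed.

(** Over the polynomial ring in the 11 forms the spinor ring is free, so regularity is inherited,
    coordinate by coordinate, from the variables. The quotient is nonzero because restricting a
    relation for 1 would put 1 into [I]. *)
Lemma section_forms_regular : regular_sequence section_forms.
Proof.
split=> [i y|/eqP].
  have [x ->] := quot_pi_surj y; have [p ->] := quot_pi_surj x.
  rewrite -rmorphM -(rmorph0 (quot_pi (prefix_ideal section_forms i))) => /quot_piP.
  rewrite subr0 => /spanP[q]; rewrite /section_forms /piS -rmorphM => /piSE Qp.
  apply/quot_piP; rewrite subr0; apply/spanP.
  have [g _ Qg] := section_spans gen_b (leqnn (msize p)).
  have /choice[gq gqP] j : exists g, quad_ideal (q j - section_basis z b g).
    by have [g' _ Qg'] := section_spans gen_b (leqnn (msize (q j))); exists g'.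
  pose G k := 'X_i * g k - \sum_(j < 11 | (j < i)%N) 'X_j * gq j k.
  have BG : section_basis z b G = section_form z i * section_basis z b g
      - \sum_(j < 11 | (j < i)%N) section_form z j * section_basis z b (gq j).
    rewrite -form_substX -section_basisM.
    under [X in _ - X]eq_bigr do rewrite -form_substX -section_basisM.
    rewrite /section_basis exchange_big -sumrB; apply: eq_bigr => k _ /=.
    by rewrite /G rmorphB mulrBl; congr (_ - _); rewrite rmorph_sum mulr_suml.
  have QG : quad_ideal (section_basis z b G).
    have -> : section_basis z b G = (section_form z i * p
         - \sum_(j < 11 | (j < i)%N) q j * section_form z j)
       + (- section_form z i) * (p - section_basis z b g)
       + \sum_(j < 11 | (j < i)%N) section_form z j * (q j - section_basis z b (gq j)).
      under [X in _ + X]eq_bigr do rewrite mulrBr [section_form _ _ * q _]mulrC.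
      by rewrite sumrB BG; ring.
    apply: quad_idealD; first by apply: quad_idealD => //; apply: quad_idealM.
    elim/big_ind: _ => [|u v|j _]; [exact: quad_ideal0 | exact: quad_idealD|].
    by apply: quad_idealM; case: (gqP j) => r ->; exists r.
  have G0 := section_basis_free gen_b (quad_ideal_vanishes QG).
  have /choice[u uP] k : exists u : 'I_11 -> {mpoly K[11]},
      g k = \sum_(j < 11 | (j < i)%N) 'X_j * u j.
    by apply: (@mulX_regular _ _ i _ (fun j => gq j k)); apply/eqP; rewrite -subr_eq0; apply/eqP/(G0 k).
  exists (fun j => section_basis z b (fun k => u k j)); apply/piSE.
  suff -> : \sum_(j < 11 | (j < i)%N) section_basis z b (fun k => u k j) * section_form z j
    = section_basis z b g by [].
  under eq_bigr do rewrite mulrC -form_substX -section_basisM.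
  rewrite /section_basis exchange_big; apply: eq_bigr => k _ /=.
  by rewrite uP rmorph_sum mulr_suml.
rewrite -(rmorph1 (quot_pi _)) -(rmorph0 (quot_pi _)) => /eqP/quot_piP.
rewrite subr0 => /spanP[q]; rewrite -(rmorph1 (quot_pi (spinor_ideal K))) => /piSE.
move/(restrict_quad_ideal z)/IE; rewrite rmorphB rmorph1 rmorph_sum /= big1 ?subr0 //.
by move=> j _; rewrite rmorphM /= restrict_form ?mulr0 // (leq_trans (ltn_ord j)).
Qed.

Let J := seq_ideal section_forms.
Let piJ : spinor_ring K -> gr_quot J := quot_pi J.

Let piJ_restrict (p : P) : piJ (piS (extend (restrict z p))) = piJ (piS p).
Proof.
have [q _ e] := restrict_kernel z (leqnSn (msize p)).
apply/quot_piP; rewrite /piS -rmorphB; apply/spanP; exists (fun j => - q j).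
congr (quot_pi _ _); rewrite -opprB e -sumrN; apply: eq_big => j; first by rewrite ltn_ord.
by rewrite mulNr mulrC.
Qed.

(** The map is induced by [extend]. It is inverted by [restrict], which kills the forms and maps the
    quadrics into [I]. *)
Lemma section_quotient_isomorphic :
  gr_isomorphic (gr_quot (A := gr_mpoly K 5) I) (gr_quot J).
Proof.
pose f : {rmorphism T -> gr_quot J} := (quot_pi J \o (quot_pi (spinor_ideal K) \o @extend K)).
have fE t : f t = piJ (piS (extend t)) by [].
have fI (t : gr_mpoly K 5) : I t -> f t = 0.
  move=> /IE[r ->]; pose p := \sum_k extend (r k) * spinor_quad K k.
  have -> : \sum_k r k * section_quad z k = restrict z p.
    by rewrite rmorph_sum; apply: eq_bigr => k _; rewrite rmorphM /= extendK restrict_quad.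
  rewrite fE piJ_restrict; suff -> : piS p = 0 by rewrite /piJ rmorph0.
  rewrite -[RHS](rmorph0 (quot_pi (spinor_ideal K))); apply/piSE; rewrite subr0.
  by exists (fun k => extend (r k)).
have [phi phiE] := quot_lift_rmorphism fI.
have phi_surj (p : P) : phi (quot_pi I (restrict z p)) = piJ (piS p).
  by rewrite phiE fE piJ_restrict.
have phi_inj : injective phi.
  move=> x y; have [t ->] := quot_pi_surj x; have [t' ->] := quot_pi_surj y.
  rewrite !phiE !fE /piJ => /quot_piP; rewrite /piS -rmorphB => /spanP[q /piSE].
  move/(restrict_quad_ideal z)/IE => It; apply/quot_piP; move: It.
  rewrite !rmorphB /= !extendK rmorph_sum /= big1 ?subr0 // => j _.
  by rewrite rmorphM /= restrict_form ?mulr0 // (leq_trans (ltn_ord j)).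
exists phi; split.
- have /choice[g gK] y : exists x, phi x = y.
    have [u ->] := quot_pi_surj y; have [p ->] := quot_pi_surj u.
    by exists (quot_pi I (restrict z p)); rewrite phi_surj.
  by exists g => [x|//]; apply: phi_inj; rewrite gK.
- by move=> c; rewrite /= phiE fE extendC.
move=> d x; have [t ->] := quot_pi_surj x; split.
  case=> t' ht' e; rewrite e phiE fE.
  exists (piS (extend t')) => //; exists (extend t') => //.
  exact: extend_homog.
case=> y [p hp ->] e; exists (restrict z p); first exact: restrict_homog.
by apply: phi_inj; rewrite e phi_surj.
Qed.

Lemma section_quotient : exists h : 'I_11 -> spinor_ring K,
  [/\ forall i, gr_part 1 (h i), regular_sequence h &
      gr_isomorphic (gr_quot (A := gr_mpoly K 5) I) (gr_quot (seq_ideal h))].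
Proof.
exists section_forms; split; last exact: section_quotient_isomorphic.
  move=> i; exists (section_form z i) => //; rewrite /= /section_form.
  by rewrite rpredB ?spinor_var_homog // extend_homog // section_point_homog.
exact: section_forms_regular.
Qed.

End SectionQuotient.

(** * Apolar ideals of cubics *)

Section DiffAction.

Variables (K : numFieldType) (n : nat).
Implicit Types D f : {mpoly K[n]}.

Lemma diff_actionwE k D f : (msize D <= k)%N ->
  diff_action D f = \sum_(m : 'X_{1..n < k}) D@_m *: f^`M[m].
Proof.
move=> sD; rewrite /diff_action (ssrcomplements.big_mksub 'X_{1..n < k}) ?msupp_uniq //=; first last.
  by move=> m /msize_mdeg_lt /leq_trans; apply.
by rewrite big_rmcond //= => m /memN_msupp_eq0 ->; rewrite scale0r.
Qed.

Lemma diff_actionD D1 D2 f : diff_action (D1 + D2) f = diff_action D1 f + diff_action D2 f.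
Proof.
pose k := maxn (msize D1) (msize D2).
rewrite !(@diff_actionwE k) ?leq_maxl ?leq_maxr //; last exact: msizeD_le.
by rewrite -big_split; apply: eq_bigr => m _; rewrite mcoeffD scalerDl.
Qed.

Lemma diff_actionZ c D f : diff_action (c *: D) f = c *: diff_action D f.
Proof.
rewrite !(@diff_actionwE (msize D)) ?msizeZ_le // scaler_sumr.
by apply: eq_bigr => m _; rewrite mcoeffZ scalerA.
Qed.

Lemma diff_action0 f : diff_action 0 f = 0.
Proof. by rewrite /diff_action msupp0 big_nil. Qed.

Lemma diff_action0r D : diff_action D 0 = 0.
Proof.
rewrite /diff_action big1 // => m _.
by rewrite raddf0 scaler0.
Qed.

Lemma diff_action_sum I (r : seq I) (P : pred I) F f :
  diff_action (\sum_(i <- r | P i) F i) f = \sum_(i <- r | P i) diff_action (F i) f.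
Proof.
by apply: (big_ind2 (fun D g => diff_action D f = g)) => [|D1 _ D2 _ <- <-|//];
  rewrite ?diff_action0 ?diff_actionD.
Qed.

Lemma diff_actionXm m f : diff_action 'X_[m] f = f^`M[m].
Proof. by rewrite /diff_action msuppX big_seq1 mcoeffX eqxx scale1r. Qed.

Lemma diff_actionX i f : diff_action 'X_i f = f^`M(i).
Proof. by rewrite diff_actionXm mderivmU1m. Qed.

Lemma diff_actionM D1 D2 f : diff_action (D1 * D2) f = diff_action D1 (diff_action D2 f).
Proof.
rewrite [in LHS](mpolyE D1) mulr_suml diff_action_sum; apply: eq_bigr => m1 _.
rewrite -scalerAl diff_actionZ; congr (_ *: _).
rewrite [in LHS](mpolyE D2) mulr_sumr diff_action_sum /diff_action raddf_sum.
apply: eq_bigr => m2 _ /=.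
have -> : 'X_[m1] * (D2@_m2 *: 'X_[m2]) = D2@_m2 *: 'X_[m1 + m2] by rewrite -scalerAr -mpolyXD.
by rewrite -/(diff_action _ _) diff_actionZ diff_actionXm addmC mderivmDm mderivmZ.
Qed.

Lemma diff_action1 f : diff_action 1 f = f.
Proof. by rewrite -mpolyX0 diff_actionXm mderivm0m. Qed.

Lemma dhomog_mderiv d f i : f \is d.+1.-homog -> f^`M(i) \is d.-homog.
Proof.
move=> hf; apply/dhomogP => m ms.
have : (m + U_(i))%MM \in msupp f.
  rewrite mcoeff_msupp; apply: contraTneq ms => fm.
  by rewrite mcoeff_msupp mcoeff_mderiv fm mul0rn eqxx.
by move/(dhomog_mf hf) => /=; rewrite mdegD mdeg1 addn1 => -[].
Qed.

Lemma dhomog1_eq0 f : f \is 1.-homog -> (forall l, (f^`M(l))@_0 = 0) -> f = 0.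
Proof.
move=> hf f0; apply/mpolyP => m; rewrite mcoeff0.
have [ms|] := boolP (m \in msupp f); last exact: memN_msupp_eq0.
have /eqP/mdeg1P[i /eqP ->] : mdeg m = 1%N := dhomog_mf hf ms.
by have := f0 i; rewrite mcoeff_mderiv add0m mnm0E mulr1n.
Qed.

End DiffAction.

Section Cubics.

Variable K : numFieldType.
Local Notation T := {mpoly K[5]}.

Definition trilinear (f : T) (j m l : 'I_5) : K := (f^`M(j)^`M(m)^`M(l))@_0.

Lemma trilinearE f j m l : trilinear f j m l = (diff_action ('X_j * 'X_m * 'X_l) f)@_0.
Proof.
rewrite !diff_actionM !diff_actionX /trilinear.
by rewrite (mderiv_comm m l) (mderiv_comm j l) (mderiv_comm j m).
Qed.

Lemma trilinear_sym f j m l :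
  trilinear f j m l = trilinear f m j l /\ trilinear f j m l = trilinear f j l m.
Proof. by rewrite /trilinear; split; [rewrite (mderiv_comm j m) | rewrite (mderiv_comm m l)]. Qed.

Lemma cubic_eq0 (f : T) : f \is 3.-homog ->
  (forall j m l, trilinear f j m l = 0) -> f = 0.
Proof.
move=> hf f0; have f2 j m : f^`M(j)^`M(m) = 0.
  by apply: dhomog1_eq0 => [|l]; [do 2?apply: dhomog_mderiv | apply: f0].
have f1 j : f^`M(j) = 0.
  rewrite (mderiv_all0 (f2 j)) (dhomog_nemf_coeff (dhomog_mderiv j hf)) ?mpolyC0 //=.
  by rewrite mdeg0.
by rewrite (mderiv_all0 f1) (dhomog_nemf_coeff hf) ?mpolyC0 //= mdeg0.
Qed.

(** The coefficients on ordered products of variables are not symmetrized, and the ring is arbitrary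
    so that [z] may also be a tensor of indeterminates. *)
Definition quad_coef (A : comNzRingType) (z : 'I_5 -> 'I_5 -> 'I_5 -> A)
    (k : 'I_5 + 'I_5) (j m : 'I_5) : A :=
  let W i1 i2 i3 := z i1 i2 i3 - z i2 i1 i3 in
  match k with
  | inl i => W (i + 1) (i + 2) j * W (i + 3) (i + 4) m
             - W (i + 1) (i + 3) j * W (i + 2) (i + 4) m
             + W (i + 1) (i + 4) j * W (i + 2) (i + 3) m
  | inr i => W i m j
  end.

Lemma section_quadE z k :
  section_quad z k = \sum_j \sum_m quad_coef z k j m *: ('X_j * 'X_m) :> T.
Proof.
have prod a b c d : section_w z a b * section_w z c d =
    \sum_j \sum_m ((z a b j - z b a j) * (z c d m - z d c m)) *: ('X_j * 'X_m).
  rewrite /section_w mulr_suml; apply: eq_bigr => j _; rewrite mulr_sumr.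
  by apply: eq_bigr => m _; rewrite -scalerAl -scalerAr scalerA.
case: k => i; rewrite /section_quad /=.
  rewrite /pfaffian mul0r subr0 !prod -sumrB -big_split; apply: eq_bigr => j _ /=.
  rewrite -sumrB -big_split; apply: eq_bigr => m _ /=.
  by rewrite scalerDl scalerBl.
rewrite exchange_big; apply: eq_bigr => m _; rewrite /section_w mulr_suml.
by apply: eq_bigr => j _; rewrite scalerAl.
Qed.

Lemma diff_action_section_quad z k f j :
  (diff_action ('X_j * section_quad z k) f)@_0 =
  \sum_a \sum_b quad_coef z k a b * trilinear f a b j.
Proof.
rewrite section_quadE mulr_sumr diff_action_sum raddf_sum; apply: eq_bigr => a _ /=.
rewrite mulr_sumr diff_action_sum raddf_sum; apply: eq_bigr => b _ /=.
by rewrite -scalerAr diff_actionZ mcoeffZ trilinearE [X in diff_action X _]mulrC.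
Qed.

End Cubics.

Section ApolarSection.

Variables (K : numFieldType) (z : 'I_5 -> 'I_5 -> 'I_5 -> K).
Local Notation T := {mpoly K[5]}.
Local Notation q := (section_quad z).

(** At the base point the quadrics reduce every product of two variables to a square or to 0, whence
    the squares in degree 2. The cubic [c] is a parameter because [c = 0] is needed to refute an
    empty kernel. *)
Definition generators (c : T) (k : 'I_12) : T :=
  nth 0 [:: 1; 'X_'o_0; 'X_'o_1; 'X_'o_2; 'X_'o_3; 'X_'o_4; 'X_'o_0 ^+ 2; 'X_'o_1 ^+ 2;
            'X_'o_2 ^+ 2; 'X_'o_3 ^+ 2; 'X_'o_4 ^+ 2; c] k.

Definition quad_combination (d : nat) (t : T) : Prop :=
  exists2 r : 'I_5 + 'I_5 -> T, forall k, (msize (r k) <= d)%N & t = \sum_k r k * q k.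

Lemma quad_combinationD d t1 t2 : quad_combination d t1 -> quad_combination d t2 ->
  quad_combination d (t1 + t2).
Proof.
move=> [r1 s1 ->] [r2 s2 ->]; exists (fun k => r1 k + r2 k) => [k|].
  exact: msizeD_bound.
by rewrite -big_split; apply: eq_bigr => k _; rewrite mulrDl.
Qed.

Lemma quad_combinationZ d a t : quad_combination d t -> quad_combination d (a *: t).
Proof.
move=> [r s ->]; exists (fun k => a *: r k) => [k|]; first exact: msizeZ_bound.
by rewrite scaler_sumr; apply: eq_bigr => k _; rewrite scalerAl.
Qed.

Lemma quad_combinationX d i t : quad_combination d t -> quad_combination d.+1 ('X_i * t).
Proof.
move=> [r s ->]; exists (fun k => 'X_i * r k) => [k|].
  by rewrite mulrC -(addn1 d); apply: msizeM_bound => //; rewrite msizeX mdeg1.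
by rewrite mulr_sumr; apply: eq_bigr => k _; rewrite mulrA.
Qed.

Lemma quad_combination0 d : quad_combination d 0.
Proof. by exists (fun=> 0) => [k|]; rewrite ?msize0 // big1 // => k _; rewrite mul0r. Qed.

Lemma quad_combinationW d e t : (d <= e)%N -> quad_combination d t -> quad_combination e t.
Proof. by move=> de [r s ->]; exists r => // k; apply: leq_trans de. Qed.

Lemma mpolyX_split (m : 'X_{1..5}) d : mdeg m = d.+1 ->
  exists i m', mdeg m' = d /\ 'X_[m] = 'X_i * 'X_[m'] :> T.
Proof.
move=> dm; have /mnm_neq0[i mi] : m != 0%MM by rewrite -mdeg_eq0 dm.
exists i, (m - U_(i))%MM; have mE : (U_(i) + (m - U_(i)))%MM = m.
  rewrite addmC submK //; apply/mnm_lepP=> j; rewrite mnm1E.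
  by case: eqP => // <-; rewrite lt0n.
split; last by rewrite -mpolyXD mE.
by move: dm; rewrite -[in mdeg m]mE mdegD mdeg1 => -[].
Qed.

Lemma mpolyX_0 (m : 'X_{1..5}) : mdeg m = 0%N -> 'X_[m] = 1 :> T.
Proof. by move/eqP; rewrite mdeg_eq0 => /eqP ->; rewrite mpolyX0. Qed.

Hypothesis quadrics : forall j m, exists (a : 'I_5 -> K) (r : 'I_5 + 'I_5 -> K),
  'X_j * 'X_m = \sum_i a i *: 'X_i ^+ 2 + \sum_k r k *: q k.

(** The bounds 2 and 3 allow multipliers of degree 1 for cubics and 2 for quartics, so no reduction
    exceeds the degree budget. Degrees above 4 follow from the quartics. *)
Lemma generates_generators c : (msize c <= 4)%N ->
  (forall j m l, exists a : K, quad_combination 2 ('X_j * 'X_m * 'X_l - a *: c)) ->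
  (forall i j m l, quad_combination 3 ('X_i * ('X_j * 'X_m * 'X_l))) ->
  generates z (generators c).
Proof.
move=> sc cubics quartics; have X1 i : (msize ('X_i : T) <= 2)%N by rewrite msizeX mdeg1.
have X2 i : (msize ('X_i ^+ 2 : T) <= 3)%N.
  by rewrite expr2; apply: (@msizeM_bound _ _ _ _ 2 1).
split=> [[k lt_k]|].
  rewrite /generators /gen_degree /=.
  by move: lt_k; do 12?[case: k => [|k] //]; rewrite /= ?msize1.
pose red d t := exists2 c' : 'I_12 -> K, forall k, (d <= gen_degree k)%N -> c' k = 0 &
  quad_combination (d - 2) (t - \sum_k c' k *: generators c k).
have redD d t1 t2 : red d t1 -> red d t2 -> red d (t1 + t2).
  move=> [c1 d1 r1] [c2 d2 r2]; exists (fun k => c1 k + c2 k) => [k dk|].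
    by rewrite d1 // d2 // addr0.
  under eq_bigr do rewrite scalerDl.
  by rewrite big_split opprD addrACA; apply: quad_combinationD.
have redZ d a t : red d t -> red d (a *: t).
  move=> [c1 d1 r1]; exists (fun k => a * c1 k) => [k dk|]; first by rewrite d1 // mulr0.
  under eq_bigr do rewrite -scalerA.
  by rewrite -scaler_sumr -scalerBr; apply: quad_combinationZ.
have red0 d : red d 0.
  exists (fun=> 0) => //; rewrite big1 ?subr0 => [|k _]; last by rewrite scale0r.
  exact: quad_combination0.
have redW d e t : (d <= e)%N -> red d t -> red e t.
  move=> de [c1 d1 r1]; exists c1 => [k ek|]; first by rewrite d1 // (leq_trans de).
  by apply: quad_combinationW r1; rewrite leq_sub2r.
have redg (k : 'I_12) : red (gen_degree k).+1 (generators c k).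
  exists (fun k' => (k' == k)%:R) => [k'|].
    by case: eqP => // ->; rewrite ltnn.
  rewrite (bigD1 k) //= eqxx scale1r big1 ?addr0 ?subrr => [|k' /negbTE ->].
    exact: quad_combination0.
  by rewrite scale0r.
have redX1 i : red 2%N 'X_i.
  have lt_i : (i.+1 < 12)%N by have := ltn_ord i; lia.
  have := redg (Ordinal lt_i); rewrite /gen_degree /generators /=.
  by case: i lt_i => -[|[|[|[|[|//]]]]] pi _; rewrite (bool_irrelevance pi isT).
have redX2 i : red 3%N ('X_i ^+ 2).
  have lt_i : (i + 6 < 12)%N by have := ltn_ord i; lia.
  have := redg (Ordinal lt_i); rewrite /gen_degree /generators /=.
  by case: i lt_i => -[|[|[|[|[|//]]]]] pi _; rewrite (bool_irrelevance pi isT).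
have redc : red 4%N c by have := redg (@Ordinal 12 11 isT).
have redq d t : quad_combination (d - 2) t -> red d t.
  move=> rt; exists (fun=> 0) => //; rewrite [X in _ - X]big1 ?subr0 // => k _.
  by rewrite scale0r.
have high d m : (4 <= d)%N -> mdeg m = d -> quad_combination (d - 1) 'X_[m].
  elim: d m => // d IHd m; rewrite leq_eqVlt => /orP[/eqP[d3]|lt_d] dm.
    rewrite -d3 in dm *.
    have [i [m1 [d1 ->]]] := mpolyX_split dm; have [j [m2 [d2 ->]]] := mpolyX_split d1.
    have [l [m3 [e3 ->]]] := mpolyX_split d2; have [l' [m4 [e4 ->]]] := mpolyX_split e3.
    by rewrite (mpolyX_0 e4) mulr1 [_ * ('X_l * _)]mulrA.
  have [i [m1 [d1 ->]]] := mpolyX_split dm; have := IHd m1 lt_d d1.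
  by move/(quad_combinationX i); congr quad_combination; lia.
have redm m : red (mdeg m).+1 'X_[m].
  have [le_4 | ] := leqP 4 (mdeg m); first by apply: redq; rewrite subSS; apply: high.
  case dm : (mdeg m) => [|[|[|[|//]]]] _.
  - by rewrite (mpolyX_0 dm); apply: (redg ord0).
  - have [i [m1 [d1 ->]]] := mpolyX_split dm; rewrite (mpolyX_0 d1) mulr1; exact: redX1.
  - have [i [m1 [d1 ->]]] := mpolyX_split dm; have [j [m2 [d2 ->]]] := mpolyX_split d1.
    rewrite (mpolyX_0 d2) mulr1; have [a [r ->]] := quadrics i j; apply: (redD).
      by elim/big_ind: _ => // [t1 t2|k _]; [apply: redD | apply: redZ].
    apply: redq; exists (fun k => (r k)%:MP) => [k|]; first by rewrite msizeC leq_b1.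
    by apply: eq_bigr => k _; rewrite mul_mpolyC.
  have [i [m1 [d1 ->]]] := mpolyX_split dm; have [j [m2 [d2 ->]]] := mpolyX_split d1.
  have [l [m3 [e3 ->]]] := mpolyX_split d2; rewrite (mpolyX_0 e3) mulr1 mulrA.
  have [a] := cubics i j l; move/(redq 4%N)/redD/(_ (redZ _ a _ redc)).
  by rewrite subrK.
move=> d t st; have goods (s : seq 'X_{1..5}) : all (fun m => (mdeg m < d)%N) s ->
    red d (\sum_(m <- s) t@_m *: 'X_[m]).
  elim: s => [|m s IHs] /=; first by rewrite big_nil.
  move=> /andP[lt_m /IHs rs]; rewrite big_cons; apply/redD/rs/redZ.
  exact: redW (redm m).
have [|c' d' [r sr e]] := goods (msupp t).
  by apply/allP => m mt; apply: leq_trans st; apply: msize_mdeg_lt.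
by exists c', r; split=> //; rewrite -e -mpolyE addrC subrK.
Qed.

End ApolarSection.

Section ApolarIdeal.

Variables (K : numFieldType) (z : 'I_5 -> 'I_5 -> 'I_5 -> K) (f : {mpoly K[5]}).
Local Notation T := {mpoly K[5]}.
Local Notation q := (section_quad z).
Local Notation c0 := ('X_'o_0 * 'X_'o_0 * 'X_'o_1 : T).

Hypothesis homog_f : f \is 3.-homog.
Hypothesis apolar_q : forall k l, \sum_a \sum_b quad_coef z k a b * trilinear f a b l = 0.
Hypothesis quadrics : forall j m, exists (a : 'I_5 -> K) (r : 'I_5 + 'I_5 -> K),
  'X_j * 'X_m = \sum_i a i *: 'X_i ^+ 2 + \sum_k r k *: q k.
Hypothesis cubics : forall j m l, exists a : K,
  quad_combination z 2 ('X_j * 'X_m * 'X_l - a *: c0).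
Hypothesis gram_unit : (\matrix_(i, j) trilinear f i j j : 'M[K]_5) \in unitmx.

(** The socle functional: it vanishes on [f^perp] and, in the pairing [lam (t * u)], detects
    membership in it. *)
Let lam (t : T) : K := (diff_action t f)@_0.

Let lamD t1 t2 : lam (t1 + t2) = lam t1 + lam t2.
Proof. by rewrite /lam diff_actionD mcoeffD. Qed.

Let lamZ a t : lam (a *: t) = a * lam t.
Proof. by rewrite /lam diff_actionZ mcoeffZ. Qed.

Let lam_sum I (r : seq I) (P : pred I) F :
  lam (\sum_(i <- r | P i) F i) = \sum_(i <- r | P i) lam (F i).
Proof. by rewrite /lam diff_action_sum raddf_sum. Qed.

Lemma diff_action_quad k : diff_action (q k) f = 0.
Proof.
apply: dhomog1_eq0 => [|l].
  rewrite section_quadE diff_action_sum; apply: rpred_sum => a _.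
  rewrite diff_action_sum; apply: rpred_sum => b _.
  rewrite diff_actionZ diff_actionM !diff_actionX; apply: rpredZ.
  by do 2?apply: dhomog_mderiv.
by rewrite -diff_actionX -diff_actionM diff_action_section_quad.
Qed.

Let lam_quad (r : 'I_5 + 'I_5 -> T) : lam (\sum_k r k * q k) = 0.
Proof.
rewrite lam_sum big1 // => k _.
by rewrite /lam diff_actionM diff_action_quad diff_action0r mcoeff0.
Qed.

Let lam_homog d (t : T) : t \is d.-homog -> d != 3 -> lam t = 0.
Proof.
move=> ht d3; rewrite /lam /diff_action raddf_sum big1_seq // => m /andP[_ mt] /=.
rewrite mcoeffZ mcoeff_mderivm addm0 (dhomog_nemf_coeff homog_f) ?mul0rn ?mulr0 //=.
by rewrite (dhomog_mf ht mt : mdeg m = d).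
Qed.

Let dual_quadric (i : 'I_5) : T := \sum_j invmx (\matrix_(i, j) trilinear f i j j) j i *: 'X_j ^+ 2.

Let lam_X2 i j : lam ('X_i * 'X_j ^+ 2) = trilinear f i j j.
Proof. by rewrite trilinearE expr2 mulrA. Qed.

Let lam_dual i c : lam ('X_i * dual_quadric c) = (i == c)%:R.
Proof.
rewrite /dual_quadric mulr_sumr lam_sum.
have := congr1 (fun M : 'M[K]_5 => M i c) (mulmxV gram_unit); rewrite !mxE => <-.
apply: eq_bigr => j _; rewrite -scalerAr lamZ lam_X2 mulrC [in RHS]mxE.
by [].
Qed.

(** Cubics are multiples of [c0] modulo the quadrics, so otherwise [lam] would vanish on all of
    them, against [lam ('X_'o_0 * dual_quadric 'o_0) = 1]. *)
Let c0_neq0 : lam c0 != 0.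
Proof.
apply/negP => /eqP c00; have := lam_dual 'o_0 'o_0.
have X j : lam ('X_'o_0 * 'X_j ^+ 2) = 0.
  have [a' [r' _ e']] := cubics 'o_0 j j.
  have -> : 'X_'o_0 * 'X_j ^+ 2 = a' *: c0 + \sum_k r' k * q k :> T.
    by rewrite -e' addrC subrK expr2 mulrA.
  by rewrite lamD lamZ c00 mulr0 lam_quad addr0.
rewrite /dual_quadric mulr_sumr lam_sum big1 => [/esym/eqP|j _].
  by rewrite oner_eq0.
by rewrite -scalerAr lamZ X mulr0.
Qed.

Let cubic_rem t : (exists a : K, quad_combination z 2 (t - a *: c0)) -> lam t = 0 ->
  quad_combination z 2 t.
Proof.
case=> a [r sr e]; have te : t = a *: c0 + \sum_k r k * q k by rewrite -e addrC subrK.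
rewrite te lamD lam_quad lamZ addr0 => /eqP; rewrite mulf_eq0 (negbTE c0_neq0) orbF => /eqP ->.
by rewrite scale0r add0r; exists r.
Qed.

Let reducible t := exists a : K, quad_combination z 2 (t - a *: c0).

Let reducibleD t1 t2 : reducible t1 -> reducible t2 -> reducible (t1 + t2).
Proof.
move=> [a1 r1] [a2 r2]; exists (a1 + a2).
by rewrite scalerDl opprD addrACA; apply: quad_combinationD.
Qed.

Let reducibleZ a t : reducible t -> reducible (a *: t).
Proof.
move=> [a1 r1]; exists (a * a1).
by rewrite -scalerA -scalerBr; apply: quad_combinationZ.
Qed.

Let reducible_dual i c : reducible ('X_i * dual_quadric c).
Proof.
rewrite /dual_quadric mulr_sumr; elim/big_ind: _ => [|t1 t2|j _].
- by exists 0; rewrite scale0r subr0; apply: quad_combination0.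
- exact: reducibleD.
by rewrite -scalerAr; apply: reducibleZ; rewrite expr2 mulrA; apply: cubics.
Qed.

(* [dual_quadric] is the basis of quadrics dual to the variables, so a cubic [n] equals
   [lam n *: 'X_c * dual_quadric c] modulo the quadrics for every [c]; taking [c <> i]
   makes ['X_i * dual_quadric c] a combination of the quadrics. *)
Lemma quartic_combination i j m l : quad_combination z 3 ('X_i * ('X_j * 'X_m * 'X_l)).
Proof.
have succ_neq (k : 'I_5) : (k == k + 1) = false by case: k => -[|[|[|[|[|]]]]].
set n := 'X_j * 'X_m * 'X_l; pose c := i + 1; have ic : (i == c) = false := succ_neq i.
have n_red : quad_combination z 2 (n - lam n *: ('X_c * dual_quadric c)).
  apply: cubic_rem; last by rewrite -scaleNr lamD lamZ lam_dual eqxx mulr1 subrr.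
  by apply: reducibleD; [apply: cubics | rewrite -scaleNr; apply/reducibleZ/reducible_dual].
have u_red : quad_combination z 2 ('X_i * dual_quadric c).
  by apply: cubic_rem; [apply: reducible_dual | rewrite lam_dual ic].
have -> : 'X_i * n = 'X_i * (n - lam n *: ('X_c * dual_quadric c))
    + lam n *: ('X_c * ('X_i * dual_quadric c)).
  by rewrite mulrBr -scalerAr ['X_i * ('X_c * _)]mulrCA subrK.
by apply: quad_combinationD; [|apply: quad_combinationZ]; apply: quad_combinationX.
Qed.

Lemma generates_apolar : generates z (generators c0).
Proof.
apply: generates_generators => //; last exact: quartic_combination.
by rewrite -!mpolyXD msizeX !mdegD !mdeg1.
Qed.

(** Modulo the quadrics an element of [f^perp] is a combination [s] of the 12 generators with
    [lam (u * s) = 0] for all [u]. Choosing [u] as [c0], 1, the variables and the dual quadrics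
    isolates the coefficients of 1, of [c0], of the squares and of the variables; all vanish. *)
Lemma apolar_idealE (I : ideal T) : is_apolar_ideal I f ->
  forall t, I t <-> section_ideal z t.
Proof.
move=> If t; have sumI (r : 'I_5 + 'I_5 -> T) : I (\sum_k r k * q k).
  elim/big_ind: _ => [|t1 t2|k _]; [exact: ideal_mem0 | exact: ideal_memD |].
  by apply: ideal_memM; apply/If/diff_action_quad.
split=> [It|[r ->]]; last exact: sumI.
have [_ span] := generates_apolar.
have [c [r [_ _ e]]] := span _ t (leqnn _); exists r.
pose s := \sum_k c k *: generators c0 k.
have Is : I s.
  have -> : s = t + - (\sum_k r k * q k) by rewrite e addrK.
  by apply: ideal_memD => //; apply: ideal_memN.
have sl u : lam (u * s) = 0.
  by rewrite /lam; have /If -> := ideal_memM u Is; rewrite mcoeff0.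
have lsum u : lam (u * s) = \sum_k c k * lam (u * generators c0 k).
  rewrite /s mulr_sumr lam_sum; apply: eq_bigr => k _.
  by rewrite -scalerAr lamZ.
suff c00 k : c k = 0.
  by rewrite e big1 ?add0r // => k _; rewrite c00 scale0r.
have X1 i : ('X_i : T) \is 1.-homog by rewrite dhomogX /= mdeg1.
have X2 i : ('X_i ^+ 2 : T) \is 2.-homog by have := dhomogMn 2 (X1 i).
have hc0 : c0 \is 3.-homog.
  by rewrite -[3%N]/(1 + 1 + 1)%N; do 2?apply: dhomogM.
have gen_homog k' : generators c0 k' \is (gen_degree k').-homog.
  case: k' => -[|[|[|[|[|[|[|[|[|[|[|[|//]]]]]]]]]]]] pk; rewrite /generators /gen_degree //=.
  exact: dhomog1.
have lam0 d (u : T) (k' : 'I_12) : u \is d.-homog -> (d + gen_degree k')%N != 3 ->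
    lam (u * generators c0 k') = 0.
  by move=> hu; apply: lam_homog; apply: dhomogM.
pose o k (lt_k : (k < 12)%N) := Ordinal lt_k.
have big12 (F : 'I_12 -> K) : \sum_k F k = F (@o 0 isT) + F (@o 1 isT) + F (@o 2 isT)
    + F (@o 3 isT) + F (@o 4 isT) + F (@o 5 isT) + F (@o 6 isT) + F (@o 7 isT)
    + F (@o 8 isT) + F (@o 9 isT) + F (@o 10 isT) + F (@o 11 isT).
  rewrite !big_ord_recl big_ord0 addr0 !addrA.
  by do ![congr (_ + F _); last exact: val_inj]; congr (F _); exact: val_inj.
have sub d (u : T) (P := fun k' => (d + gen_degree k' == 3)%N) : u \is d.-homog ->
    \sum_k' (if P k' then c k' * lam (u * generators c0 k') else 0) = 0.
  move=> hu; rewrite -[RHS](sl u) lsum -big_mkcond [RHS](bigID P) /=.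
  by rewrite [X in _ = _ + X]big1 ?addr0 // => k' nP; rewrite (lam0 d) ?mulr0.
have k0 : c (@o 0 isT) = 0.
  have := sub 3%N c0 hc0; rewrite big12 /= !addr0 mulr1 => /eqP.
  by rewrite mulf_eq0 (negbTE c0_neq0) orbF => /eqP.
have k11 : c (@o 11 isT) = 0.
  have := sub 0%N 1 (dhomog1 _ _); rewrite big12 /= !add0r mul1r => /eqP.
  by rewrite mulf_eq0 (negbTE c0_neq0) orbF => /eqP.
pose v : 'cV[K]_5 := \col_j nth 0 [:: c (@o 6 isT); c (@o 7 isT); c (@o 8 isT);
  c (@o 9 isT); c (@o 10 isT)] j.
have v0 : v = 0.
  rewrite -(mulKmx gram_unit v); suff -> : (\matrix_(i, j) trilinear f i j j) *m v = 0.
    by rewrite mulmx0.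
  apply/colP=> i; rewrite [RHS]mxE -[RHS](sub 1%N 'X_i (X1 i)) big12 /= !(addr0, add0r).
  by rewrite !mxE big_ord5 /= !mxE /= !lam_X2; congr (_ + _ + _ + _ + _); rewrite mulrC.
have vE j : nth 0 [:: c (@o 6 isT); c (@o 7 isT); c (@o 8 isT); c (@o 9 isT); c (@o 10 isT)] j = 0.
  case: (ltnP j 5) => [lt_j|le_j]; last by rewrite nth_default.
  by have := congr1 (fun u : 'cV_5 => u (Ordinal lt_j) 0) v0; rewrite !mxE.
have dual_homog i : dual_quadric i \is 2.-homog.
  by apply: rpred_sum => j _; apply: rpredZ.
have w0 i : nth 0 [:: c (@o 1 isT); c (@o 2 isT); c (@o 3 isT); c (@o 4 isT); c (@o 5 isT)] (i : 'I_5) = 0.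
  rewrite -[RHS](sub 2%N (dual_quadric i) (dual_homog i)) big12 /= !(addr0, add0r).
  rewrite ![dual_quadric i * _]mulrC !lam_dual.
  case: i => -[|[|[|[|[|//]]]]] pi /=; by rewrite !(mulr1, mulr0, addr0, add0r).
case: k => -[|[|[|[|[|[|[|[|[|[|[|[|//]]]]]]]]]]]] pk; rewrite (bool_irrelevance pk isT).
- exact: k0.
- exact: (w0 'o_0).
- exact: (w0 'o_1).
- exact: (w0 'o_2).
- exact: (w0 'o_3).
- exact: (w0 'o_4).
- exact: (vE 0%N).
- exact: (vE 1%N).
- exact: (vE 2%N).
- exact: (vE 3%N).
- exact: (vE 4%N).
exact: k11.
Qed.

Lemma apolar_section (I : ideal T) : is_apolar_ideal I f ->
  exists h : 'I_11 -> spinor_ring K,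
  [/\ forall i, gr_part 1 (h i), regular_sequence h &
      gr_isomorphic (gr_quot (A := gr_mpoly K 5) I) (gr_quot (seq_ideal h))].
Proof.
move=> If; apply: (section_quotient generates_apolar (apolar_idealE If)).
move=> /If; rewrite diff_action1 => f0; case/negP: c0_neq0.
by rewrite /lam f0 diff_action0r mcoeff0.
Qed.

End ApolarIdeal.

(** * Generic cubics *)

Section GenericLinearAlgebra.

Variables (K : numFieldType) (N : nat) (z0 : 'I_N -> K).

Let full_rank (X : finType) n (A : 'M[K]_(#|X|, n)) :
  (forall t : 'cV[K]_n, A *m t = 0 -> t = 0) -> exists C, C *m A = 1%:M.
Proof.
move=> A0; suff /row_freeP[C AC] : row_free A^T.
  by exists C^T; rewrite -[A]trmxK -trmx_mul AC trmx1.
rewrite -kermx_eq0; apply/eqP/row_matrixP => i; rewrite row0.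
apply: trmx_inj; rewrite trmx0; apply: A0.
by apply: trmx_inj; rewrite trmx_mul !trmxK trmx0 -row_mul mulmx_ker row0.
Qed.

(** With [C] a left inverse of the matrix at [z0], the determinant of [C] times the matrix is a
    polynomial with value 1 at [z0], and where it is nonzero the rows span. *)
Lemma rank_open (X Y : finType) (A : X -> Y -> {mpoly K[N]}) :
  (forall t : Y -> K, (forall x, \sum_y (A x y).@[z0] * t y = 0) -> forall y, t y = 0) ->
  exists D : {mpoly K[N]}, D.@[z0] != 0 /\ forall z, D.@[z] != 0 ->
    forall v : Y -> K, exists c : X -> K, forall y, \sum_x c x * (A x y).@[z] = v y.
Proof.
move=> A0; pose AX : 'M[{mpoly K[N]}]_(#|X|, #|Y|) := \matrix_(i, j) A (enum_val i) (enum_val j).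
have [C CA] : exists C, C *m map_mx (meval z0) AX = 1%:M.
  apply: full_rank => t At; apply/colP => j; rewrite mxE -(enum_valK j).
  apply: (A0 (fun y => t (enum_rank y) 0)) => x.
  have := congr1 (fun u : 'cV_ _ => u (enum_rank x) 0) At; rewrite !mxE => e.
  rewrite -[RHS]e (reindex _ (onW_bij _ (enum_val_bij Y))) /=.
  by apply: eq_bigr => i _; rewrite !mxE !enum_rankK enum_valK.
pose G := map_mx (@mpolyC N K) C *m AX.
have GE z : map_mx (meval z) G = C *m map_mx (meval z) AX.
  rewrite map_mxM; congr (_ *m _); apply/matrixP => i j.
  by rewrite !mxE /= mevalC.
exists (\det G); have detE z : (\det G).@[z] = \det (C *m map_mx (meval z) AX).
  by rewrite -GE det_map_mx.
split=> [|z]; rewrite detE; first by rewrite CA det1 oner_neq0.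
move=> Gz v; have Gu : C *m map_mx (meval z) AX \in unitmx by rewrite unitmxE unitfE.
pose r := (\row_j v (enum_val j)) *m invmx (C *m map_mx (meval z) AX) *m C.
have rA : r *m map_mx (meval z) AX = \row_j v (enum_val j).
  by rewrite /r -mulmxA mulmxKV.
exists (fun x => r 0 (enum_rank x)) => y.
have := congr1 (fun u : 'rV_ _ => u 0 (enum_rank y)) rA; rewrite !mxE enum_rankK => <-.
rewrite (reindex _ (onW_bij _ (enum_val_bij X))) /=.
by apply: eq_bigr => i _; rewrite !mxE enum_valK enum_rankK.
Qed.

(* Off a hypersurface the kernel of [M] is spanned by the solution of [M t = 0, e t = 1],
   which is given by Cramer's rule. *)
Lemma kernel_vector (X : finType) n (M : X -> 'I_n -> {mpoly K[N]}) (e f0 : 'I_n -> K)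
    (D : {mpoly K[N]}) :
  (forall t : 'I_n -> K, (forall x, \sum_i (M x i).@[z0] * t i = 0) ->
     \sum_i e i * t i = 0 -> forall i, t i = 0) ->
  (forall x, \sum_i (M x i).@[z0] * f0 i = 0) -> (exists i, f0 i != 0) ->
  D.@[z0] != 0 ->
  (forall z, D.@[z] != 0 -> exists t : 'I_n -> K,
     (exists i, t i != 0) /\ forall x, \sum_i (M x i).@[z] * t i = 0) ->
  exists F : 'I_n -> {mpoly K[N]}, (forall x, \sum_i M x i * F i = 0) /\
    exists2 k, k != 0 & forall i, (F i).@[z0] = k * f0 i.
Proof.
move=> A0 Mf0 [i0 f00] D0 gen.
pose A (x : option X) i := if x is Some x' then M x' i else (e i)%:MP.
pose AX : 'M[{mpoly K[N]}]_(#|{: option X}|, n) := \matrix_(i, j) A (enum_val i) j.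
have AXt z (t : 'I_n -> K) : (forall x, \sum_i (M x i).@[z] * t i = 0) ->
    map_mx (meval z) AX *m (\col_i t i)
      = (\sum_i e i * t i) *: delta_mx (enum_rank None) 0.
  move=> Mt; apply/colP => j; rewrite !mxE -(inj_eq enum_val_inj) enum_rankK.
  case jE: (enum_val j) => [x|].
    rewrite /= mulr0 -[RHS](Mt x); apply: eq_bigr => i _.
    by rewrite !mxE jE.
  rewrite eqxx mulr1; apply: eq_bigr => i _.
  by rewrite !mxE jE /= mevalC.
have [C CA] : exists C, C *m map_mx (meval z0) AX = 1%:M.
  apply: full_rank => t At; apply/colP => j; rewrite [RHS]mxE.
  have At' x : \sum_i (A x i).@[z0] * t i 0 = 0.
    have := congr1 (fun u : 'cV_ _ => u (enum_rank x) 0) At; rewrite !mxE => e'.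
    by rewrite -[RHS]e'; apply: eq_bigr => i _; rewrite !mxE enum_rankK.
  apply: (A0 (fun i => t i 0)) => [x|]; first exact: (At' (Some x)).
  by have := At' None; under eq_bigr do rewrite mevalC.
pose G := map_mx (@mpolyC N K) C *m AX.
have GE z : map_mx (meval z) G = C *m map_mx (meval z) AX.
  rewrite map_mxM; congr (_ *m _); apply/matrixP => i j.
  by rewrite !mxE /= mevalC.
pose c2 : 'cV[K]_n := C *m delta_mx (enum_rank None) 0.
pose F : 'cV[{mpoly K[N]}]_n := \adj G *m map_mx (@mpolyC N K) c2.
have FE z : map_mx (meval z) F = \adj (map_mx (meval z) G) *m c2.
  rewrite map_mxM map_mx_adj; congr (_ *m _); apply/matrixP => i j.
  by rewrite !mxE /= mevalC.
have cramer z (t : 'I_n -> K) : (forall x, \sum_i (M x i).@[z] * t i = 0) ->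
    (\det G).@[z] *: (\col_i t i) = (\sum_i e i * t i) *: map_mx (meval z) F.
  move=> Mt; rewrite FE scalemxAr /c2 scalemxAr -(AXt z t Mt) [C *m _]mulmxA -GE mulmxA.
  by rewrite mul_adj_mx mul_scalar_mx -det_map_mx.
have G0 : (\det G).@[z0] = 1 by rewrite -det_map_mx GE CA det1.
(* Cramer's rule identifies [F] with a kernel vector only where [D] and [\det G] are nonzero;
   density of this set gives the polynomial identity. *)
exists (fun i => F i 0); split=> [x|].
  apply: (@mpoly_id _ _ (D * \det G) _ z0) => [|z].
    by rewrite mevalM G0 mulr1.
  rewrite mevalM mulf_eq0 negb_or => /andP[/gen[t [[i ti] Mt]] dz].
  have et : \sum_i e i * t i != 0.
    apply: contraNneq ti => et; have := cramer z t Mt; rewrite et scale0r.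
    move/colP/(_ i)/eqP; rewrite !mxE mulf_eq0.
    by have /negbTE -> : (\det G).@[z] != 0 by [].
  rewrite raddf_sum /=; apply/eqP; rewrite -(mulrI_eq0 _ (mulfI et)) mulr_sumr; apply/eqP.
  transitivity (\sum_i (\det G).@[z] * ((M x i).@[z] * t i)); last by rewrite -mulr_sumr Mt mulr0.
  apply: eq_bigr => j _; have := cramer z t Mt; move/colP/(_ j); rewrite !mxE => e'.
  by rewrite mevalM mulrCA -e'; ring.
have ef : \sum_i e i * f0 i != 0.
  by apply: contraNneq f00 => ef; rewrite (A0 f0).
exists (\sum_i e i * f0 i)^-1; first by rewrite invr_eq0.
move=> i; have := cramer z0 f0 Mf0; rewrite G0 scale1r => /colP/(_ i); rewrite !mxE => ->.
by rewrite mulKf.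
Qed.

End GenericLinearAlgebra.

Section ConeDensity.

Variables (K : numFieldType) (n N : nat) (F : 'I_n -> {mpoly K[N]}).

(** The Jacobian criterion applied to [(w, z) |-> w * F z] at [w = 1], with [w] as variable [ord0]:
    the derivative in [w] contributes the condition that [u] kills [F z0]. *)
Lemma cone_dense (z0 : 'I_N -> K) (D : {mpoly K[N]}) (g : {mpoly K[n]}) :
  (forall u : 'I_n -> K, \sum_i u i * (F i).@[z0] = 0 ->
    (forall j, \sum_i u i * (F i)^`M(j).@[z0] = 0) -> forall i, u i = 0) ->
  D.@[z0] != 0 -> g != 0 ->
  exists z w, [/\ D.@[z] != 0, w != 0 & g.@[fun i => w * (F i).@[z]] != 0].
Proof.
move=> J0 D0 g0; pose h (j : 'I_N) : {mpoly K[N.+1]} := 'X_(lift ord0 j).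
pose wd (p : {mpoly K[N]}) := mmap (@mpolyC N.+1 K) h p.
have wdE p z : (wd p).@[z] = p.@[fun j => z (lift ord0 j)].
  by rewrite /wd meval_mmap; apply: meval_eq => j; rewrite mevalXU.
have dwd p j : (wd p)^`M(j) = \sum_i wd p^`M(i) * (lift ord0 i == j)%:R.
  have := derivation_mmap (D := @mderiv N.+1 K j) (f := @mpolyC N.+1 K) h
    (@mderivM _ K j) (@mderivC _ K j) p.
  move=> /= ->; apply: eq_bigr => i _; congr (_ * _).
  rewrite /h mderivX mnm1E; case: eqP => [->|_]; last by rewrite scale0r.
  have -> : (U_(j) - U_(j))%MM = 0%MM :> 'X_{1..N.+1} by apply/mnmP=> k; rewrite !mnmE subnn.
  by rewrite scale1r mpolyX0.
pose F' i := 'X_ord0 * wd (F i).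
pose z1 (j : 'I_N.+1) := if unlift ord0 j is Some j' then z0 j' else 1.
have z1l j : z1 (lift ord0 j) = z0 j by rewrite /z1 liftK.
have z10 : z1 ord0 = 1 by rewrite /z1 unlift_none.
have wd1 p : (wd p).@[z1] = p.@[z0] by rewrite wdE; apply: meval_eq => j; rewrite z1l.
have dX j : ('X_ord0 : {mpoly K[N.+1]})^`M(j) = (j == ord0)%:R.
  rewrite mderivX mnm1E eq_sym; case: eqP => [->|_]; last by rewrite scale0r.
  have -> : (U_(ord0) - U_(ord0))%MM = 0%MM :> 'X_{1..N.+1} by apply/mnmP=> k; rewrite !mnmE subnn.
  by rewrite scale1r mpolyX0.
have dF' i j : (F' i)^`M(j).@[z1] = if unlift ord0 j is Some j' then (F i)^`M(j').@[z0]
    else (F i).@[z0].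
  rewrite mderivM mevalD !mevalM dX mevalXU z10 mul1r wd1 dwd.
  case: unliftP => [j' ->|->].
    rewrite (_ : (lift ord0 j' == ord0) = false) //= rmorph0 mul0r add0r raddf_sum /=.
    rewrite (bigD1 j') //= eqxx mulr1 big1 ?addr0 ?wd1 // => k kj.
    by rewrite (inj_eq (@lift_inj _ ord0)) (negbTE kj) mulr0 meval0.
  by rewrite eqxx rmorph1 mul1r big1 ?meval0 ?addr0 // => k _; rewrite mulr0.
have [u uJ|||z [Dz gz]] := @dominant_dense K n N.+1 F' z1 ('X_ord0 * wd D) g.
- apply/rowP => i; rewrite [RHS]mxE; apply: (J0 (fun i => u 0 i)).
    by rewrite -[RHS](uJ ord0); apply: eq_bigr => k _; rewrite dF' unlift_none.
  move=> j; rewrite -[RHS](uJ (lift ord0 j)); apply: eq_bigr => k _.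
  by rewrite dF' liftK.
- by rewrite mevalM mevalXU z10 mul1r wd1.
- by [].
exists (fun j => z (lift ord0 j)), (z ord0); move: Dz.
rewrite mevalM mevalXU mulf_eq0 negb_or wdE => /andP[w0 Dz]; split=> //.
move: gz; congr (_ != 0); apply: meval_eq => i.
by rewrite /F' mevalM mevalXU wdE.
Qed.

End ConeDensity.

(** * The cyclic base point and the Klein cubic *)

Section CyclicIndices.

Implicit Type i : 'I_5.

Lemma shiftD i : (i + 1 + 1 = i + 2) * (i + 1 + 2 = i + 3) * (i + 1 + 3 = i + 4) * (i + 1 + 4 = i)
  * ((i + 2 + 1 = i + 3) * (i + 2 + 2 = i + 4) * (i + 2 + 3 = i) * (i + 2 + 4 = i + 1))
  * ((i + 3 + 1 = i + 4) * (i + 3 + 2 = i) * (i + 3 + 3 = i + 1) * (i + 3 + 4 = i + 2))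
  * ((i + 4 + 1 = i) * (i + 4 + 2 = i + 1) * (i + 4 + 3 = i + 2) * (i + 4 + 4 = i + 3)).
Proof.
have e (a b c : 'I_5) : a + b = c -> i + a + b = i + c by move=> <-; rewrite addrA.
have e0 (a b : 'I_5) : a + b = 0 -> i + a + b = i by move=> ab; rewrite -addrA ab addr0.
by do ?split; (apply: e || apply: e0); apply: val_inj.
Qed.

Lemma big_shift (V : nmodType) (F : 'I_5 -> V) i :
  \sum_j F j = F i + F (i + 1) + F (i + 2) + F (i + 3) + F (i + 4).
Proof.
rewrite (reindex_inj (addrI i)) big_ord5.
have -> : i + 'o_0 = i by rewrite -[RHS]addr0; congr (_ + _); apply: val_inj.
by congr (_ + F _ + F _ + F _ + F _); congr (_ + _); apply: val_inj.
Qed.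

Lemma cyclic_ind i (P : 'I_5 -> Prop) :
  P i -> P (i + 1) -> P (i + 2) -> P (i + 3) -> P (i + 4) -> forall j, P j.
Proof.
move=> P0 P1 P2 P3 P4 j; have : i + (j - i) = j by rewrite addrC subrK.
case: (j - i) => -[|[|[|[|[|//]]]]] lt_k <-.
- by rewrite (_ : i + _ = i) // -[RHS]addr0; congr (_ + _); apply: val_inj.
- by rewrite (_ : i + _ = i + 1) //; congr (_ + _); apply: val_inj.
- by rewrite (_ : i + _ = i + 2) //; congr (_ + _); apply: val_inj.
- by rewrite (_ : i + _ = i + 3) //; congr (_ + _); apply: val_inj.
by rewrite (_ : i + _ = i + 4) //; congr (_ + _); apply: val_inj.
Qed.

End CyclicIndices.

Section BasePoint.

Variable K : numFieldType.
Implicit Types (t : 'I_5 -> 'I_5 -> 'I_5 -> K) (i : 'I_5).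

(* The section with [w_(i, i+1) = x_i] and all other [w_ij] zero. *)
Definition base_point (i j k : 'I_5) : K := ((j == i + 1) && (k == i))%:R.

Local Notation W i j k := (base_point i j k - base_point j i k).

Lemma base_skew1 i k : W i (i + 1) k = (k == i)%:R.
Proof.
have e : (i == i + 1 + 1) = false by case: (i) => -[|[|[|[|[|]]]]].
by rewrite /base_point eqxx e subr0.
Qed.

Lemma base_skew2 i k : W i (i + 2) k = 0.
Proof.
have e1 : (i + 2 == i + 1) = false by case: (i) => -[|[|[|[|[|]]]]].
have e2 : (i == i + 2 + 1) = false by case: (i) => -[|[|[|[|[|]]]]].
by rewrite /base_point e1 e2 subr0.
Qed.

Lemma base_skew3 i k : W i (i + 3) k = 0.
Proof.
have e1 : (i + 3 == i + 1) = false by case: (i) => -[|[|[|[|[|]]]]].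
have e2 : (i == i + 3 + 1) = false by case: (i) => -[|[|[|[|[|]]]]].
by rewrite /base_point e1 e2 subr0.
Qed.

Lemma delta_sum (F : 'I_5 -> K) i : \sum_j (j == i)%:R * F j = F i.
Proof.
rewrite (bigD1 i) //= eqxx mul1r big1 ?addr0 // => j /negbTE ->.
by rewrite mul0r.
Qed.

Lemma base_quad_coef_inl i a b : quad_coef base_point (inl i) a b = (a == i + 1)%:R * (b == i + 3)%:R.
Proof.
have := base_skew1 (i + 1) a; have := base_skew1 (i + 3) b; have := base_skew2 (i + 1) a; have := base_skew3 (i + 1) a.
rewrite /quad_coef.
rewrite !shiftD.
move=> -> -> -> ->.
by rewrite !mul0r subr0 addr0.
Qed.

Lemma base_quad_coef_inr i a b : quad_coef base_point (inr i) a b =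
  (a == i)%:R * (b == i + 1)%:R - (a == i + 4)%:R * (b == i + 4)%:R.
Proof.
have e : (i == b + 1) = (b == i + 4).
  by case: i b => -[|[|[|[|[|]]]]] pi // -[[|[|[|[|[|]]]]]].
rewrite /quad_coef /base_point -!natrM !mulnb e [(b == i + 1) && _]andbC.
by congr (_ - (nat_of_bool _)%:R); case: eqP => [->|_] //=; rewrite ?andbT ?andbF.
Qed.

Lemma base_quad_inl (F : 'I_5 -> 'I_5 -> K) i :
  \sum_a \sum_b quad_coef base_point (inl i) a b * F a b = F (i + 1) (i + 3).
Proof.
rewrite -[RHS](delta_sum (fun a => F a _)); apply: eq_bigr => a _.
rewrite -[X in _ * X](delta_sum (F a)) mulr_sumr; apply: eq_bigr => b _.
by rewrite base_quad_coef_inl mulrA.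
Qed.

Lemma base_quad_inr (F : 'I_5 -> 'I_5 -> K) i :
  \sum_a \sum_b quad_coef base_point (inr i) a b * F a b = F i (i + 1) - F (i + 4) (i + 4).
Proof.
rewrite -[X in X - _](delta_sum (fun a => F a (i + 1))).
rewrite -[X in _ - X](delta_sum (fun a => F a (i + 4))) -sumrB.
apply: eq_bigr => a _.
rewrite -[X in _ * X - _](delta_sum (F a)) -[X in _ - _ * X](delta_sum (F a)) !mulr_sumr -sumrB.
by apply: eq_bigr => b _; rewrite base_quad_coef_inr mulrBl !mulrA.
Qed.

Definition symmetric3 t := forall a b c, t a b c = t b a c /\ t a b c = t a c b.

(** The quadrics say [t i (i + 2) l = 0] and [t i (i + 1) l = t (i + 4) (i + 4) l]. Hence
    [t i i (i + 1)] is independent of [i] and all other entries vanish, so one entry determines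
    [t]. *)
Lemma base_kernel t : symmetric3 t ->
  (forall k l, \sum_a \sum_b quad_coef base_point k a b * t a b l = 0) ->
  t 'o_0 'o_0 'o_1 = 0 -> forall a b c, t a b c = 0.
Proof.
move=> st t0 t001.
have sw a b c : t a b c = t b a c := (st a b c).1.
have sr a b c : t a b c = t a c b := (st a b c).2.
have t2 i l : t i (i + 2) l = 0.
  by have := t0 (inl (i + 4)) l; rewrite base_quad_inl !shiftD.
have t3 i l : t i (i + 3) l = 0 by have := t2 (i + 3) l; rewrite sw shiftD.
have t1 i l : t i (i + 1) l = t (i + 4) (i + 4) l.
  by apply/eqP; rewrite -subr_eq0 -(base_quad_inr (fun a b => t a b l)) t0.
have v1 i : t (i + 1) (i + 1) (i + 1 + 1) = t i i (i + 1).
  by rewrite sr t1 !shiftD.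
have v i : t i i (i + 1) = 0.
  have v0 : t 'o_0 'o_0 ('o_0 + 1) = 0 by rewrite -[RHS]t001; congr (t _ _ _); apply: val_inj.
  have := v1 ('o_0 + 3); have := v1 ('o_0 + 2); have := v1 ('o_0 + 1); have := v1 'o_0.
  rewrite !shiftD v0 => vv1; rewrite vv1 => vv2; rewrite vv2 => vv3; rewrite vv3 => vv4.
  by apply: (@cyclic_ind 'o_0 (fun i => t i i (i + 1) = 0)); rewrite ?shiftD.
have tii i l : t i i l = 0.
  elim/(@cyclic_ind i): l.
  - by have := t1 (i + 1) i; rewrite !shiftD => <-; rewrite sr sw sr t2.
  - exact: v.
  - by rewrite sr t2.
  - by rewrite sr t3.
  rewrite sr sw; have := t1 (i + 4) i; rewrite !shiftD => ->.
  by have := t2 (i + 3) (i + 3); rewrite shiftD sr.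
move=> a b c; elim/(@cyclic_ind a): b.
- exact: tii.
- by rewrite t1 tii.
- exact: t2.
- exact: t3.
by rewrite sw; have := t1 (a + 4) c; rewrite shiftD => ->; rewrite tii.
Qed.

End BasePoint.

Section KleinCubic.

Variable K : numFieldType.
Implicit Types (t : 'I_5 -> 'I_5 -> 'I_5 -> K) (i : 'I_5).

(* The Klein cubic spans the kernel of the contraction at [base_point]. *)
Definition klein : {mpoly K[5]} := \sum_i 2^-1 *: ('X_i * 'X_i * 'X_(i + 1)).

(** The factor 1/2 in [klein] makes these third derivatives 0 or 1. *)
Definition klein_tensor (p q r : 'I_5) : K :=
  (q == p)%:R * (r == p + 1)%:R + (r == p)%:R * (q == p + 1)%:R + (r == q)%:R * (p == q + 1)%:R.

Lemma mderivX1 n (A : comNzRingType) (i j : 'I_n) :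
  ('X_i : {mpoly A[n]})^`M(j) = ((i == j)%:R)%:MP.
Proof.
rewrite mderivX mnm1E; case: eqP => [->|_]; last by rewrite scale0r rmorph0.
have -> : (U_(j) - U_(j))%MM = 0%MM :> 'X_{1..n} by apply/mnmP=> k; rewrite !mnmE subnn.
by rewrite scale1r mpolyX0 rmorph1.
Qed.

Lemma klein_homog : klein \is 3.-homog.
Proof.
apply: rpred_sum => i _; apply: rpredZ.
by rewrite -!mpolyXD dhomogX /= !mdegD !mdeg1.
Qed.

Lemma trilinear_klein p q r : trilinear klein p q r = klein_tensor p q r.
Proof.
have triZ c f : trilinear (c *: f) p q r = c * trilinear f p q r.
  by rewrite /trilinear !mderivZ mcoeffZ.
have triX (s u : 'I_5) : trilinear ('X_s * 'X_s * 'X_u : {mpoly K[5]}) p q r =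
    2 * ((s == p)%:R * ((s == q)%:R * (u == r)%:R) + (s == p)%:R * ((s == r)%:R * (u == q)%:R)
         + (s == q)%:R * ((s == r)%:R * (u == p)%:R)).
  rewrite /trilinear; set R := (X in _ = X).
  suff -> : ('X_s * 'X_s * 'X_u : {mpoly K[5]})^`M(p)^`M(q)^`M(r) = R%:MP by rewrite mcoeffC eqxx mulr1.
  rewrite /R; do 3!rewrite ?(mderivM, mderivD, mderivX1, mderivC).
  by rewrite !(mpolyCM, mpolyCD, mpolyC1); ring.
have -> : trilinear klein p q r = \sum_i trilinear (2^-1 *: ('X_i * 'X_i * 'X_(i + 1))) p q r.
  apply: (big_ind2 (fun f c => trilinear f p q r = c)) => [|f1 c1 f2 c2 <- <-|//].
    by rewrite /trilinear !mderiv0 mcoeff0.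
  by rewrite /trilinear !mderivD mcoeffD.
transitivity (\sum_s ((s == p)%:R * ((s == q)%:R * (s + 1 == r)%:R)
    + (s == p)%:R * ((s == r)%:R * (s + 1 == q)%:R)
    + (s == q)%:R * ((s == r)%:R * (s + 1 == p)%:R)) : K).
  apply: eq_bigr => s _; by rewrite triZ triX mulKf ?pnatr_eq0.
rewrite !big_split /= !delta_sum /klein_tensor.
by rewrite [r == p + 1]eq_sym [r == p]eq_sym [q == p]eq_sym [r == q]eq_sym [q == p + 1]eq_sym [p == q + 1]eq_sym.
Qed.

End KleinCubic.

(** * Rank and tangent conditions at the base point *)

Definition dquad_coef (A : comNzRingType) (z d : 'I_5 -> 'I_5 -> 'I_5 -> A)
    (k : 'I_5 + 'I_5) (j m : 'I_5) : A :=
  let W i1 i2 i3 := z i1 i2 i3 - z i2 i1 i3 in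
  let D i1 i2 i3 := d i1 i2 i3 - d i2 i1 i3 in
  match k with
  | inl i => D (i + 1) (i + 2) j * W (i + 3) (i + 4) m + W (i + 1) (i + 2) j * D (i + 3) (i + 4) m
             - (D (i + 1) (i + 3) j * W (i + 2) (i + 4) m + W (i + 1) (i + 3) j * D (i + 2) (i + 4) m)
             + (D (i + 1) (i + 4) j * W (i + 2) (i + 3) m + W (i + 1) (i + 4) j * D (i + 2) (i + 3) m)
  | inr i => D i m j
  end.

Lemma mderiv_quad_coef n (A : comNzRingType) (z : 'I_5 -> 'I_5 -> 'I_5 -> {mpoly A[n]}) k j m x :
  (quad_coef z k j m)^`M(x) = dquad_coef z (fun i1 i2 i3 => (z i1 i2 i3)^`M(x)) k j m.
Proof. by case: k => i; rewrite /quad_coef /dquad_coef !(mderivB, mderivD, mderivM). Qed.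

Lemma meval_quad_coef n (A : comNzRingType) (z : 'I_5 -> 'I_5 -> 'I_5 -> {mpoly A[n]}) k j m v :
  (quad_coef z k j m).@[v] = quad_coef (fun i1 i2 i3 => (z i1 i2 i3).@[v]) k j m.
Proof. by case: k => i; rewrite /quad_coef !(mevalB, mevalD, mevalM). Qed.

Lemma meval_dquad_coef n (A : comNzRingType) (z d : 'I_5 -> 'I_5 -> 'I_5 -> {mpoly A[n]}) k j m v :
  (dquad_coef z d k j m).@[v]
    = dquad_coef (fun i1 i2 i3 => (z i1 i2 i3).@[v]) (fun i1 i2 i3 => (d i1 i2 i3).@[v]) k j m.
Proof. by case: k => i; rewrite /dquad_coef !(mevalB, mevalD, mevalM). Qed.

Section BaseConditions.

Variable K : numFieldType.
Implicit Types (t : 'I_5 -> 'I_5 -> 'I_5 -> K) (i : 'I_5).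
Local Notation z0 := (base_point K).
Local Notation tau := (klein_tensor K).

Lemma klein_apolar k l : \sum_a \sum_b quad_coef z0 k a b * tau a b l = 0.
Proof.
case: k => i.
  rewrite base_quad_inl /klein_tensor -!natrM -!natrD -[RHS](mulr0n 1); congr _%:R.
  by case: i l => -[|[|[|[|[|]]]]] pi // -[[|[|[|[|[|]]]]]].
rewrite (base_quad_inr (fun a b => tau a b l)) -[RHS](subrr (tau i (i + 1) l)); congr (_ - _).
rewrite /klein_tensor -!natrM -!natrD; congr _%:R.
by case: i l => -[|[|[|[|[|]]]]] pi // -[[|[|[|[|[|]]]]]].
Qed.

(** It is the permutation matrix of a cyclic shift, inverted by its transpose. *)
Lemma klein_gram : (\matrix_(i, j) tau i j j : 'M[K]_5) \in unitmx.
Proof.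
suff /mulmx1_unit[] : (\matrix_(i, j) tau i j j : 'M[K]_5) *m \matrix_(i, j) (j == i + 1)%:R = 1%:M by [].
apply/matrixP => i j; rewrite !mxE.
transitivity (\sum_k ((k == i + 4) * (j == k + 1))%:R : K).
  apply: eq_bigr => k _; rewrite !mxE /klein_tensor -!natrM -!natrD -natrM; congr (_ * _)%:R.
  by case: i k => -[|[|[|[|[|]]]]] pi // -[[|[|[|[|[|]]]]]].
under eq_bigr do rewrite natrM.
by rewrite delta_sum shiftD eq_sym.
Qed.

(** The dual form of the fact that the squares and the ten quadrics span all quadratic forms at the
    base point. *)
Lemma base_quadrics (t : 'I_5 -> 'I_5 -> K) : (forall a b, t a b = t b a) ->
  (forall i, t i i = 0) -> (forall k, \sum_a \sum_b quad_coef z0 k a b * t a b = 0) ->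
  forall a b, t a b = 0.
Proof.
move=> st tii t0 a.
have t1 i : t i (i + 1) = 0.
  by have := t0 (inr i); rewrite base_quad_inr tii subr0.
have t2 i : t i (i + 2) = 0.
  by have := t0 (inl (i + 4)); rewrite base_quad_inl !shiftD.
apply: (@cyclic_ind a) => //.
  by rewrite st; have := t2 (a + 3); rewrite shiftD.
by rewrite st; have := t1 (a + 4); rewrite shiftD.
Qed.

Let psi (u : 'I_5 -> K) c b := \sum_l u l * tau c b l.

Let psiE u c b : psi u c b = (b == c)%:R * u (c + 1) + (b == c + 1)%:R * u c + (c == b + 1)%:R * u b.
Proof.
rewrite -(delta_sum u (c + 1)) -(delta_sum u c) -(delta_sum u b) !mulr_sumr -!big_split.
apply: eq_bigr => l _; rewrite /klein_tensor /=; ring.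
Qed.

Let psi_shift u c : (psi u c c = u (c + 1)) * (psi u c (c + 1) = u c) * (psi u c (c + 2) = 0)
  * (psi u c (c + 3) = 0) * (psi u c (c + 4) = u (c + 4)).
Proof.
rewrite !psiE !shiftD !eqxx.
have [e1 [e2 [e3 e4]]] : (c == c + 1) = false /\ (c == c + 2) = false /\
  (c == c + 3) = false /\ (c == c + 4) = false by case: (c) => -[|[|[|[|[|]]]]].
have [f1 [f2 [f3 f4]]] : (c + 2 == c + 1) = false /\ (c + 3 == c + 1) = false /\
  (c + 4 == c + 1) = false /\ (c + 1 == c) = false by case: (c) => -[|[|[|[|[|]]]]].
have [f5 [f6 f7]] : (c + 2 == c) = false /\ (c + 3 == c) = false /\
  (c + 4 == c) = false by case: (c) => -[|[|[|[|[|]]]]].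
rewrite e1 e2 e3 e4 f1 f2 f3 f4 f5 f6 f7.
by rewrite !(mul0r, mul1r, add0r, addr0).
Qed.

Definition unit_direction (p q r i j k : 'I_5) : K := ((i == p) && (j == q))%:R * (k == r)%:R.

Let skew p q (i j : 'I_5) : K := ((i == p) && (j == q))%:R - ((j == p) && (i == q))%:R.

Let dquad_inl p q r i l : \sum_a \sum_b dquad_coef z0 (unit_direction p q r) (inl i) a b * tau a b l =
  skew p q (i + 1) (i + 2) * tau r (i + 3) l + skew p q (i + 3) (i + 4) * tau r (i + 1) l
  + skew p q (i + 1) (i + 4) * tau r (i + 2) l.
Proof.
have w12 a := base_skew1 K (i + 1) a; have w34 a := base_skew1 K (i + 3) a.
have w13 a := base_skew2 K (i + 1) a; have w24 a := base_skew2 K (i + 2) a.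
have w14 a := base_skew3 K (i + 1) a; have w23 a := base_skew1 K (i + 2) a.
have ts a b c : tau a b c = tau b a c by rewrite -!trilinear_klein; case: (trilinear_sym (klein K) a b c).
rewrite [tau r (i + 1) l]ts.
have e (x y : 'I_5) (F : 'I_5 -> 'I_5 -> K) : F x y = \sum_a \sum_b (a == x)%:R * (b == y)%:R * F a b.
  rewrite -[LHS](delta_sum (fun a => F a y)); apply: eq_bigr => a _.
  rewrite -[X in _ * X](delta_sum (F a)) mulr_sumr; apply: eq_bigr => b _.
  by rewrite mulrA.
rewrite (e r (i + 3) (fun a b => tau a b l)) (e (i + 1) r (fun a b => tau a b l)) (e r (i + 2) (fun a b => tau a b l)).
rewrite !mulr_sumr -!big_split; apply: eq_bigr => a _.
rewrite !mulr_sumr -!big_split; apply: eq_bigr => b _.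
move: (w12 a) (w34 b) (w13 a) (w24 b) (w14 a) (w23 b); rewrite !shiftD.
rewrite /dquad_coef => -> -> -> -> -> ->; rewrite /unit_direction /skew /=.
ring.
Qed.

Let dquad_inr p q r i l : \sum_a \sum_b dquad_coef z0 (unit_direction p q r) (inr i) a b * tau a b l =
  (i == p)%:R * tau r q l - (i == q)%:R * tau r p l.
Proof.
rewrite -(delta_sum (fun b => tau r b l) q) -(delta_sum (fun b => tau r b l) p) !mulr_sumr -sumrB.
rewrite exchange_big; apply: eq_bigr => b _.
rewrite -(delta_sum (fun a => tau a b l) r) !mulr_sumr -sumrB; apply: eq_bigr => a _.
rewrite /dquad_coef /unit_direction -![(_ && _)%:R]/((_ && _ : nat)%:R) -!mulnb !natrM; ring.
Qed.

Section Tangent.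

Variable y : 'I_5 + 'I_5 -> 'I_5 -> K.
Hypothesis tangent_y : forall p q r, \sum_k \sum_l y k l *
  (\sum_a \sum_b dquad_coef z0 (unit_direction p q r) k a b * tau a b l) = 0.

Local Notation m i := (y (inl i)).
Local Notation el i := (y (inr i)).

Let tangent_psi p q r : psi (el p) r q - psi (el q) r p +
  \sum_i (skew p q (i + 1) (i + 2) * psi (m i) r (i + 3)
           + skew p q (i + 3) (i + 4) * psi (m i) r (i + 1)
           + skew p q (i + 1) (i + 4) * psi (m i) r (i + 2)) = 0.
Proof.
rewrite -[RHS](tangent_y p q r) big_sumType [LHS]addrC; congr (_ + _).
  apply: eq_bigr => i _; rewrite /psi !mulr_sumr -!big_split; apply: eq_bigr => l _.
  by rewrite dquad_inl /=; ring.
rewrite -(delta_sum (fun i => psi (el i) r q) p) -(delta_sum (fun i => psi (el i) r p) q) -sumrB.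
apply: eq_bigr => i _; rewrite /psi !mulr_sumr -sumrB; apply: eq_bigr => l _.
by rewrite dquad_inr /=; ring.
Qed.

Let skew1 s i : [/\ skew s (s + 1) (i + 1) (i + 2) = (i == s + 4)%:R,
  skew s (s + 1) (i + 3) (i + 4) = (i == s + 2)%:R & skew s (s + 1) (i + 1) (i + 4) = 0].
Proof.
rewrite /skew; split; [apply/eqP; rewrite subr_eq -natrD..|rewrite -[RHS](subrr 0)];
  by case: i s => -[|[|[|[|[|]]]]] pi // -[[|[|[|[|[|]]]]]].
Qed.

Let skew2 s i : [/\ skew s (s + 2) (i + 1) (i + 2) = 0,
  skew s (s + 2) (i + 3) (i + 4) = 0 & skew s (s + 2) (i + 1) (i + 4) = - (i == s + 1)%:R].
Proof.
rewrite /skew; split; [rewrite -[RHS](subrr 0)..|rewrite -[RHS]add0r];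
  by case: i s => -[|[|[|[|[|]]]]] pi // -[[|[|[|[|[|]]]]]].
Qed.

(** Two distinct indices are, up to order, [s, s + 1] or [s, s + 2], and the tangency equations are
    skew in [p, q]. So [adjacent] and [distant] contain all of them; suitable [r] give the relations
    between the entries of [y]. *)
Let adjacent s r : psi (el s) r (s + 1) - psi (el (s + 1)) r s
  + psi (m (s + 4)) r (s + 2) + psi (m (s + 2)) r (s + 3) = 0.
Proof.
rewrite -[RHS](tangent_psi s (s + 1) r) -!addrA; congr (_ + (_ + _)).
have := delta_sum (fun i => psi (m i) r (i + 3)) (s + 4).
have := delta_sum (fun i => psi (m i) r (i + 1)) (s + 2).
rewrite /= !shiftD => <- <-; rewrite -big_split; apply: eq_bigr => i _.
by have [-> -> ->] := skew1 s i; rewrite mul0r addr0.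
Qed.

Let distant s r : psi (el s) r (s + 2) - psi (el (s + 2)) r s - psi (m (s + 1)) r (s + 3) = 0.
Proof.
rewrite -[RHS](tangent_psi s (s + 2) r); congr (_ + _).
have := delta_sum (fun i => psi (m i) r (i + 2)) (s + 1).
rewrite /= !shiftD => <-; rewrite -sumrN; apply: eq_bigr => i _.
by have [-> -> ->] := skew2 s i; rewrite !mul0r !add0r mulNr.
Qed.

Let el0 i : el i i = el (i + 4) (i + 4).
Proof.
by have := adjacent (i + 4) (i + 4); rewrite !psi_shift !shiftD !addr0 => /subr0_eq.
Qed.

Let el4 i : el i (i + 4) = 0.
Proof.
have := distant (i + 3) (i + 3); rewrite !psi_shift !shiftD.
by rewrite subr0 add0r => /eqP; rewrite oppr_eq0 => /eqP.
Qed.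

Let m0 i : m i i = - el (i + 3) (i + 4) - m (i + 2) (i + 1).
Proof.
have := adjacent (i + 3) i; rewrite !shiftD !psi_shift subr0 => e.
by apply/eqP; rewrite -subr_eq0 opprD !opprK addrC e.
Qed.

Let el3 i : el i (i + 3) = el (i + 3) (i + 4).
Proof.
have e j : el (j + 4) j = el (j + 1) (j + 4).
  by have := distant (j + 4) j; rewrite !shiftD !psi_shift subr0 => /subr0_eq.
by have := e (i + 4); rewrite !shiftD.
Qed.

Let el2 i : el i (i + 2) = m (i + 1) (i + 4).
Proof.
have e j : el (j + 2) (j + 4) = m (j + 3) (j + 1).
  by have := distant (j + 2) j; rewrite !shiftD !psi_shift subr0 => /subr0_eq.
by have := e (i + 3); rewrite !shiftD.
Qed.

Let m1 i : m i (i + 1) = el (i + 2) (i + 3).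
Proof.
have e j : el (j + 3) (j + 1) = m (j + 4) j.
  by have := distant (j + 3) j; rewrite !shiftD !psi_shift subr0 => /subr0_eq.
by have := e (i + 1); have := el3 (i + 4); rewrite !shiftD => -> ->.
Qed.

Let m2 i : m i (i + 2) = - m (i + 2) i.
Proof.
have e j : el (j + 3) j + m (j + 2) (j + 4) = 0.
  have := distant (j + 1) j; rewrite !shiftD !psi_shift add0r -opprD => /eqP.
  by rewrite oppr_eq0 => /eqP.
have := e (i + 3); have := el2 (i + 1); rewrite !shiftD => -> /eqP.
by rewrite addrC addr_eq0 => /eqP.
Qed.

(** The functional given by [y] thus vanishes on every cubic: a covector normal to the cone at the
    base point is zero. *)
Lemma tangent_annihilator t : symmetric3 t ->
  \sum_k \sum_l y k l * (\sum_a \sum_b quad_coef z0 k a b * t a b l) = 0.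
Proof.
move=> st; have sw a b c : t a b c = t b a c := (st a b c).1.
have sr a b c : t a b c = t a c b := (st a b c).2.
have shift0 (F : 'I_5 -> K) c : \sum_i F (i + c) = \sum_i F i.
  by rewrite [RHS](reindex_inj (addIr c)).
transitivity (\sum_i (\sum_l m i l * t (i + 1) (i + 3) l
    + \sum_l el i l * (t i (i + 1) l - t (i + 4) (i + 4) l))).
  rewrite big_split big_sumType; congr (_ + _); apply: eq_bigr => i _; apply: eq_bigr => l _.
    by rewrite base_quad_inl.
  by rewrite (base_quad_inr (fun a b => t a b l)).
(* Each [F] is an entry of [y] left free by the relations times an entry of [t]. After substitution
   the sum consists of differences of an [F] and its cyclic shifts, so it telescopes. *)
pose F1 i := m i (i + 4) * t (i + 1) (i + 3) (i + 4).
pose F2 i := el i i * t i (i + 1) i.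
pose F3 i := m i (i + 3) * t (i + 4) i (i + 1).
pose F4 i := m i (i + 3) * t (i + 1) (i + 3) (i + 3).
pose F5 i := el i (i + 1) * t (i + 4) (i + 4) (i + 1).
pose F6 i := el i (i + 1) * t i (i + 1) (i + 1).
transitivity (\sum_i ((F1 i - F1 (i + 2)) + (F2 i - F2 (i + 4)) - (F3 i - F3 (i + 1)) + (F3 i - F3 (i + 2))
  + (F4 i - F4 (i + 1)) - (F5 i - F5 (i + 2)) + (F6 i - F6 (i + 3)))); last first.
  rewrite !(sumrN, big_split) /= !(shift0 F1, shift0 F2, shift0 F3, shift0 F4, shift0 F5, shift0 F6).
  ring.
apply: eq_bigr => i _ /=; rewrite /F1 /F2 /F3 /F4 /F5 /F6 !shiftD.
rewrite !(big_shift _ i) m0 m1 m2 el4 el3 el2 (el0 i).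
have cyc a b c : t a b c = t b c a by rewrite sw sr.
rewrite [t (i + 3) i _]cyc -(cyc i (i + 1)) [t (i + 1) _ (i + 1)]sr [t (i + 1) (i + 3) (i + 2)]sr.
rewrite [t (i + 4) (i + 4) i]sr [t (i + 2) _ _]cyc [t (i + 3) _ _]cyc.
ring.
Qed.

End Tangent.

End BaseConditions.

Lemma mderiv_sum n (A : comNzRingType) I (r : seq I) (P : pred I) (F : I -> {mpoly A[n]}) j :
  (\sum_(i <- r | P i) F i)^`M(j) = \sum_(i <- r | P i) (F i)^`M(j).
Proof. exact: (big_morph _ (@mderivD n A j) (mderiv0 A j)). Qed.

(** * Sections through a generic cubic *)

Section GenericCubic.

Variables (K : numClosedFieldType) (n : nat) (vb : 'I_n -> {mpoly K[5]}).
Hypothesis vb_homog : forall i, vb i \is 3.-homog.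
Hypothesis vb_free : forall v : 'I_n -> K, \sum_i v i *: vb i = 0 -> forall i, v i = 0.
Hypothesis vb_span : forall f : {mpoly K[5]}, f \is 3.-homog -> exists v : 'I_n -> K, f = \sum_i v i *: vb i.

Local Notation T := {mpoly K[5]}.
Local Notation QI := ('I_5 + 'I_5)%type.
Local Notation idx := ('I_5 * 'I_5 * 'I_5)%type.
Local Notation N := #|{: idx}|.

Let cubic (v : 'I_n -> K) : T := \sum_i v i *: vb i.

Let cubic_homog v : cubic v \is 3.-homog.
Proof. by apply: rpred_sum => i _; apply: rpredZ; apply: vb_homog. Qed.

Let trilinear_cubic v a b l : trilinear (cubic v) a b l = \sum_i v i * trilinear (vb i) a b l.
Proof.
apply: (big_ind2 (fun f c => trilinear f a b l = c)) => [|f1 c1 f2 c2 <- <-|i _].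
- by rewrite /trilinear !mderiv0 mcoeff0.
- by rewrite /trilinear !mderivD mcoeffD.
by rewrite /trilinear !mderivZ mcoeffZ.
Qed.

Let sym_trilinear (f : T) : symmetric3 (trilinear f).
Proof. by move=> a b c; apply: trilinear_sym. Qed.

Let zX (i j k : 'I_5) : {mpoly K[N]} := 'X_(enum_rank ((i, j, k) : idx)).
Let zv (w : 'I_N -> K) (i j k : 'I_5) : K := w (enum_rank ((i, j, k) : idx)).
Let w0 (x : 'I_N) : K := let: (i, j, k) := enum_val x in base_point K i j k.

Let zXE w : (fun i j k => (zX i j k).@[w]) = zv w.
Proof. by do 3!apply: funext => ?; rewrite /zX mevalXU. Qed.

Let zv0 : zv w0 = base_point K.
Proof. by do 3!apply: funext => ?; rewrite /zv /w0 enum_rankK. Qed.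

(* The condition that [section_quad z] annihilates [cubic v] is [\sum_i contraction x i * v i = 0]
   for all [x], a bilinear system in [v] and the quadratic functions of [z]. *)
Let contraction (x : QI * 'I_5) i : {mpoly K[N]} :=
  \sum_a \sum_b quad_coef zX x.1 a b * (trilinear (vb i) a b x.2)%:MP.

Let contractionE w x i : (contraction x i).@[w] =
  \sum_a \sum_b quad_coef (zv w) x.1 a b * trilinear (vb i) a b x.2.
Proof.
rewrite raddf_sum; apply: eq_bigr => a _ /=; rewrite raddf_sum; apply: eq_bigr => b _ /=.
by rewrite mevalM mevalC meval_quad_coef zXE.
Qed.

Let contract_cubic (q : 'I_5 -> 'I_5 -> K) l v :
  \sum_i (\sum_a \sum_b q a b * trilinear (vb i) a b l) * v i =
  \sum_a \sum_b q a b * trilinear (cubic v) a b l.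
Proof.
under eq_bigr do rewrite mulr_suml.
rewrite exchange_big; apply: eq_bigr => a _.
under eq_bigr do rewrite mulr_suml.
rewrite exchange_big; apply: eq_bigr => b _.
rewrite trilinear_cubic mulr_sumr; apply: eq_bigr => i _.
by rewrite -mulrA [X in _ * X]mulrC.
Qed.

Let contraction_sum (w : 'I_N -> K) x v : \sum_i (contraction x i).@[w] * v i =
  \sum_a \sum_b quad_coef (zv w) x.1 a b * trilinear (cubic v) a b x.2.
Proof. by under eq_bigr do rewrite contractionE; apply: contract_cubic. Qed.

Let contraction_deriv p q r x i :
  (contraction x i)^`M(enum_rank ((p, q, r) : idx)).@[w0] = \sum_a \sum_b
    dquad_coef (base_point K) (unit_direction K p q r) x.1 a b * trilinear (vb i) a b x.2.
Proof.
have unitE : (fun a b c => (zX a b c)^`M(enum_rank ((p, q, r) : idx)).@[w0]) = unit_direction K p q r.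
  do 3!apply: funext => ?; rewrite /zX mderivX1 mevalC (inj_eq enum_rank_inj) /unit_direction.
  by rewrite -natrM mulnb -!xpair_eqE.
rewrite /contraction mderiv_sum raddf_sum; apply: eq_bigr => a _; rewrite /=.
rewrite mderiv_sum raddf_sum; apply: eq_bigr => b _; rewrite /=.
rewrite mderivM mderivC mulr0 addr0 mevalM mevalC mderiv_quad_coef meval_dquad_coef unitE.
by rewrite zXE zv0.
Qed.

(** The functional used to normalize kernel vectors; it takes the value 1 on the Klein cubic. *)
Let top i : K := trilinear (vb i) 'o_0 'o_0 'o_1.

Let top_sum v : \sum_i top i * v i = trilinear (cubic v) 'o_0 'o_0 'o_1.
Proof. by rewrite trilinear_cubic; apply: eq_bigr => i _; rewrite mulrC. Qed.

Let base_injective (v : 'I_n -> K) :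
  (forall x, \sum_i (contraction x i).@[w0] * v i = 0) -> \sum_i top i * v i = 0 ->
  forall i, v i = 0.
Proof.
move=> M0 t0; apply/vb_free/(cubic_eq0 (cubic_homog v)).
apply: base_kernel => //; last by rewrite -top_sum.
by move=> k l; have := M0 (k, l); rewrite contraction_sum zv0.
Qed.

Let pairing_eq0 (D : T) : D \is 3.-homog -> (forall i, (diff_action D (vb i))@_0 = 0) -> D = 0.
Proof.
move=> hD D0; apply/mpolyP => m; rewrite mcoeff0.
have [ms|] := boolP (m \in msupp D); last exact: memN_msupp_eq0.
have [v vE] : exists v : 'I_n -> K, 'X_[m] = cubic v.
  by apply: vb_span; rewrite dhomogX /= (dhomog_mf hD ms : mdeg m = 3%N).
have DX : (diff_action D 'X_[m])@_0 = 0.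
  rewrite vE; apply: (big_ind (fun f => (diff_action D f)@_0 = 0)) => [|f1 f2 f10 f20|i _].
  - by rewrite diff_action0r mcoeff0.
  - rewrite /diff_action; under eq_bigr do rewrite mderivmD scalerDr.
    by rewrite big_split mcoeffD f10 f20 addr0.
  rewrite /diff_action; under eq_bigr do rewrite mderivmZ scalerA mulrC -scalerA.
  by rewrite -scaler_sumr mcoeffZ D0 mulr0.
apply/eqP; move: DX; rewrite /diff_action raddf_sum /= (bigD1_seq m) //= big1_seq => [|m' /andP[m'm _]].
  rewrite addr0 mcoeffZ mcoeff_mderivm addm0 mcoeffX eqxx => /eqP.
  rewrite mulf_eq0 -[_ *+ _]/(_%:R) pnatr_eq0 => /orP[//|]; rewrite -leqn0 leqNgt.
  by rewrite prodn_gt0 // => i; rewrite ffactnn fact_gt0.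
by rewrite mcoeffZ mcoeff_mderivm addm0 mcoeffX eq_sym (negbTE m'm) mul0rn mulr0.
Qed.

Local Notation c0 := ('X_'o_0 * 'X_'o_0 * 'X_'o_1 : T).

Let X3_homog (j m l : 'I_5) : ('X_j * 'X_m * 'X_l : T) \is 3.-homog.
Proof. by rewrite -!mpolyXD dhomogX /= !mdegD !mdeg1. Qed.

Let lam (t f : T) : K := (diff_action t f)@_0.

Let lamD t1 t2 f : lam (t1 + t2) f = lam t1 f + lam t2 f.
Proof. by rewrite /lam diff_actionD mcoeffD. Qed.

Let lamZ a t f : lam (a *: t) f = a * lam t f.
Proof. by rewrite /lam diff_actionZ mcoeffZ. Qed.

Let lam_sum I (r : seq I) (P : pred I) (F : I -> T) f :
  lam (\sum_(i <- r | P i) F i) f = \sum_(i <- r | P i) lam (F i) f.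
Proof. by rewrite /lam diff_action_sum raddf_sum. Qed.

Let combination w (r : QI * 'I_5 -> K) (a : K) (t : T) : t \is 3.-homog ->
  (forall i, \sum_x r x * (contraction x i).@[w] + a * top i = lam t (vb i)) ->
  quad_combination (zv w) 2 (t - a *: c0).
Proof.
move=> ht rE; exists (fun k => \sum_l r (k, l) *: 'X_l) => [k|].
  elim/big_ind: _ => [|t1 t2|l _]; [by rewrite msize0 | exact: msizeD_bound |].
  by apply: msizeZ_bound; rewrite msizeX mdeg1.
apply/eqP; rewrite -subr_eq0; apply/eqP/pairing_eq0 => [|i].
  rewrite rpredB ?rpredB ?rpredZ ?X3_homog //; apply: rpred_sum => k _.
  rewrite section_quadE -[3%N]/(1 + 2)%N; apply: dhomogM.
    by apply: rpred_sum => l _; apply: rpredZ; rewrite dhomogX /= mdeg1.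
  apply: rpred_sum => b _; apply: rpred_sum => c _; apply: rpredZ.
  by rewrite -!mpolyXD dhomogX /= !mdegD !mdeg1.
have topE : lam c0 (vb i) = top i by rewrite /lam -trilinearE.
rewrite -/(lam _ _) -scaleNr -[- \sum_(_ | _) _]scaleN1r !lamD !lamZ topE -rE.
suff -> : lam (\sum_k (\sum_l r (k, l) *: 'X_l) * section_quad (zv w) k) (vb i) =
  \sum_x r x * (contraction x i).@[w] by ring.
rewrite lam_sum; transitivity (\sum_k \sum_l r (k, l) * (contraction (k, l) i).@[w]); last first.
  by rewrite pair_bigA; apply: eq_bigr => -[].
apply: eq_bigr => k _; rewrite mulr_suml lam_sum; apply: eq_bigr => l _.
rewrite -scalerAl lamZ contractionE; congr (_ * _); exact: diff_action_section_quad.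
Qed.

Let big_option' (V : nmodType) (I : finType) (G : option I -> V) :
  \sum_x G x = G None + \sum_x G (Some x).
Proof.
rewrite (bigD1 None) //=; congr (_ + _).
rewrite (reindex_omap Some id) => [|[]//].
by apply: eq_bigl => x; rewrite /= ?eqxx.
Qed.

Let generic_rank : exists D : {mpoly K[N]}, D.@[w0] != 0 /\ forall w, D.@[w] != 0 ->
  forall u : 'I_n -> K, exists c : option (QI * 'I_5) -> K, forall i,
    c None * top i + \sum_x c (Some x) * (contraction x i).@[w] = u i.
Proof.
have [|D [D0 DP]] := @rank_open K N w0 (option (QI * 'I_5)) 'I_n
  (fun x i => if x is Some x' then contraction x' i else (top i)%:MP).
  move=> t t0; apply: base_injective => [x|]; first exact: (t0 (Some x)).
  by have := t0 None; under eq_bigr do rewrite mevalC.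
exists D; split=> // w /DP{DP} DP u; have [c cE] := DP u.
by exists c => i; rewrite -cE big_option' mevalC.
Qed.

Let generic_quadrics : exists D : {mpoly K[N]}, D.@[w0] != 0 /\ forall w, D.@[w] != 0 ->
  forall j m, exists (a : 'I_5 -> K) (r : QI -> K),
  'X_j * 'X_m = \sum_i a i *: 'X_i ^+ 2 + \sum_k r k *: section_quad (zv w) k :> T.
Proof.
(* The rows [inr (a, b)] stand for the commutators of two variables: they are zero as polynomials
   and make up for indexing by ordered pairs. *)
pose A (x : QI + 'I_5 + 'I_5 * 'I_5) (y : 'I_5 * 'I_5) : {mpoly K[N]} :=
  match x with
  | inl (inl k) => quad_coef zX k y.1 y.2
  | inl (inr i) => (((y.1 == i) && (y.2 == i))%:R)%:MP
  | inr (a, b) => ((y == (a, b))%:R - (y == (b, a))%:R)%:MP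
  end.
have pair_sum (V : nmodType) (F : 'I_5 * 'I_5 -> V) : \sum_y F y = \sum_a \sum_b F (a, b).
  by rewrite pair_bigA; apply: eq_bigr => -[].
have [|D [D0 DP]] := rank_open (A := A) (z0 := w0).
  move=> t t0; suff: forall a b, t (a, b) = 0 by move=> t00 [a b].
  have pick_sum a b : \sum_y (y == (a, b))%:R * t y = t (a, b).
    by rewrite (bigD1 (a, b)) //= eqxx mul1r big1 ?addr0 // => y /negbTE ->; rewrite mul0r.
  apply: base_quadrics => [a b|i|k].
  - apply/eqP; rewrite -subr_eq0 -!pick_sum -sumrB; apply/eqP.
    rewrite -[RHS](t0 (inr (a, b))); apply: eq_bigr => y _.
    by rewrite mevalC mulrBl.
  - rewrite -pick_sum -[RHS](t0 (inl (inr i))); apply: eq_bigr => -[a b] _.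
    by rewrite mevalC.
  rewrite -[RHS](t0 (inl (inl k))) pair_sum; apply: eq_bigr => a _; apply: eq_bigr => b _.
  by rewrite meval_quad_coef zXE zv0.
exists D; split=> // w /DP{DP} DP j m; have [c cE] := DP (fun y => (y == (j, m))%:R).
exists (fun i => c (inl (inr i))), (fun k => c (inl (inl k))).
have -> : 'X_j * 'X_m = \sum_y (y == (j, m))%:R *: ('X_y.1 * 'X_y.2) :> T.
  by rewrite (bigD1 (j, m)) //= eqxx scale1r big1 ?addr0 // => y /negbTE ->; rewrite scale0r.
under eq_bigr do rewrite -cE scaler_suml.
pose X2 (y : 'I_5 * 'I_5) : T := 'X_y.1 * 'X_y.2.
have pick2 a b : \sum_y (y == (a, b))%:R *: X2 y = X2 (a, b).
  by rewrite (bigD1 (a, b)) //= eqxx scale1r big1 ?addr0 // => y /negbTE ->; rewrite scale0r.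
rewrite exchange_big; transitivity (\sum_x c x *: \sum_y (A x y).@[w] *: X2 y).
  by apply: eq_bigr => x _; rewrite scaler_sumr; apply: eq_bigr => y _; rewrite scalerA.
have skew0 : \sum_(p : 'I_5 * 'I_5) c (inr p) *: \sum_y (A (inr p) y).@[w] *: X2 y = 0.
  rewrite big1 // => -[a b] _; transitivity (c (inr (a, b)) *: (X2 (a, b) - X2 (b, a))).
    congr (_ *: _); rewrite -!pick2 -sumrB; apply: eq_bigr => y _.
    by rewrite mevalC scalerBl.
  by rewrite /X2 mulrC subrr scaler0.
rewrite big_sumType skew0 Monoid.mulm1 big_sumType [LHS]addrC; congr (_ + _); apply: eq_bigr => k _; congr (_ *: _).
  rewrite expr2 -/(X2 (k, k)) -pick2; apply: eq_bigr => -[a b] _.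
  by rewrite mevalC.
rewrite section_quadE pair_sum; apply: eq_bigr => a _; apply: eq_bigr => b _.
by rewrite meval_quad_coef zXE.
Qed.

(** With a trivial kernel every cubic would be a combination of the quadrics, and [generators 0]
    would generate. Its last element is 0, which cannot belong to a basis of a free module. *)
Let kernel_exists w :
  (forall j m, exists (a : 'I_5 -> K) (r : QI -> K),
     'X_j * 'X_m = \sum_i a i *: 'X_i ^+ 2 + \sum_k r k *: section_quad (zv w) k :> T) ->
  exists v : 'I_n -> K, (exists i, v i != 0) /\ forall x, \sum_i (contraction x i).@[w] * v i = 0.
Proof.
move=> quadrics; apply: contrapT => nov.
have [|D [Dw /(_ w Dw) span]] := rank_open (A := contraction) (z0 := w).
  move=> v v0 i; apply/eqP; apply: contrapT => /negP vi; apply: nov.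
  by exists v; split; first exists i.
have cubics (t : T) : t \is 3.-homog -> quad_combination (zv w) 2 t.
  move=> ht; have [r rE] := span (fun i => lam t (vb i)).
  rewrite -[t]subr0 -(scale0r c0); apply: (combination (r := r)) => // i.
  by rewrite mul0r addr0 rE.
have gen : generates (zv w) (generators 0).
  apply: generates_generators => // [|j m l|i j m l]; first by rewrite msize0.
    by exists 0; rewrite scaler0 subr0; apply: cubics.
  by apply/quad_combinationX/cubics.
pose g (k : 'I_12) : {mpoly K[11]} := (k == ord_max)%:R.
have := section_basis_free gen (g := g) _ ord_max; rewrite /g eqxx => e.
suff /e/eqP : spinor_ideal K (section_basis (zv w) (generators 0) g) by rewrite oner_eq0.
rewrite /section_basis big1 => [|k _]; first exact: ideal_mem0.
rewrite /g; case: eqP => [->|_]; last by rewrite rmorph0 mul0r.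
by rewrite (_ : generators 0 ord_max = 0) // rmorph0 mulr0.
Qed.

Let gram : 'M[{mpoly K[n]}]_5 := \matrix_(i, j) \sum_a (trilinear (vb a) i j j)%:MP * 'X_a.

Let gramE v : (\det gram).@[v] = \det (\matrix_(i, j) trilinear (cubic v) i j j).
Proof.
rewrite -det_map_mx; congr (\det _); apply/matrixP => i j; rewrite !mxE /= trilinear_cubic.
by rewrite raddf_sum; apply: eq_bigr => a _ /=; rewrite mevalM mevalC mevalXU mulrC.
Qed.

Let gram_scale k v : (\det gram).@[fun i => k * v i] = k ^+ 5 * (\det gram).@[v].
Proof.
rewrite !gramE -detZ; congr (\det _); apply/matrixP => i j; rewrite !mxE !trilinear_cubic mulr_sumr.
by apply: eq_bigr => a _; rewrite mulrA.
Qed.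

Lemma generic_apolar : exists g : {mpoly K[n]}, g != 0 /\ forall v, g.@[v] != 0 ->
  forall I : ideal T, is_apolar_ideal I (\sum_i v i *: vb i) ->
  exists h : 'I_11 -> spinor_ring K,
  [/\ forall i, gr_part 1 (h i), regular_sequence h &
      gr_isomorphic (gr_quot (A := gr_mpoly K 5) I) (gr_quot (seq_ideal h))].
Proof.
have [D2 [D20 D2P]] := generic_quadrics; have [D3 [D30 D3R]] := generic_rank.
have D3P w : D3.@[w] != 0 -> forall t : T, t \is 3.-homog ->
    exists a : K, quad_combination (zv w) 2 (t - a *: c0).
  move=> /D3R{}D3R t ht; have [c cE] := D3R (fun i => lam t (vb i)).
  exists (c None); apply: (combination (r := fun x => c (Some x))) => // i.
  by rewrite -cE addrC.
pose emb_v (p : {mpoly K[n]}) : {mpoly K[n + N]} := mmap (@mpolyC _ K) (fun i => 'X_(lshift N i)) p.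
pose emb_w (p : {mpoly K[N]}) : {mpoly K[n + N]} := mmap (@mpolyC _ K) (fun i => 'X_(rshift n i)) p.
have emb_vE p v w : (emb_v p).@[glue v w] = p.@[v].
  by rewrite meval_mmap; apply: meval_eq => i; rewrite mevalXU /glue (unsplitK (inl i)).
have emb_wE p v w : (emb_w p).@[glue v w] = p.@[w].
  by rewrite meval_mmap; apply: meval_eq => i; rewrite mevalXU /glue (unsplitK (inr i)).
pose P x : {mpoly K[n + N]} := \sum_i emb_w (contraction x i) * 'X_(lshift N i).
have PE x v w : (P x).@[glue v w] = \sum_i (contraction x i).@[w] * v i.
  rewrite raddf_sum; apply: eq_bigr => i _ /=.
  by rewrite mevalM emb_wE mevalXU /glue (unsplitK (inl i)).
have [g [g0 gP]] := generic_projection P (emb_w (D2 * D3) * emb_v (\det gram)).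
exists g; split=> // v gv I vI.
case: gP => [/(_ v gv)[w [Pw Dw]]|noX].
  move: Dw; rewrite mevalM emb_wE emb_vE mevalM !mulf_eq0 !negb_or => /andP[/andP[D2w D3w] gw].
  apply: (apolar_section (z := zv w) (cubic_homog v)) vI.
  - by move=> k l; rewrite -[RHS](Pw (k, l)) PE contraction_sum.
  - exact: D2P.
  - by move=> j m l; apply: D3P => //; apply: X3_homog.
  by rewrite unitmxE unitfE -gramE.
(* In the other alternative no cubic with [g != 0] has a suitable section; the dense cone over the
   image of [F] supplies one. *)
exfalso.
have [f0 f0E] := vb_span (klein_homog K).
have tri0 a b l : trilinear (cubic f0) a b l = klein_tensor K a b l.
  by rewrite /cubic -f0E trilinear_klein.
have Mf0 x : \sum_i (contraction x i).@[w0] * f0 i = 0.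
  rewrite contraction_sum zv0 -[RHS](klein_apolar K x.1 x.2).
  by apply: eq_bigr => a _; apply: eq_bigr => b _; rewrite tri0.
have top0 : \sum_i top i * f0 i = 1.
  rewrite top_sum tri0 /klein_tensor.
by rewrite -!natrM -!natrD.
have [i0 f0i] : exists i, f0 i != 0.
  apply: contrapT => f00; have /eqP := top0; rewrite big1 ?(eq_sym 0) ?oner_eq0 // => i _.
  by have [->|fi] := eqVneq (f0 i) 0; [rewrite mulr0|case: f00; exists i].
have [F [MF [k k0 F0]]] : exists F : 'I_n -> {mpoly K[N]},
    (forall x, \sum_i contraction x i * F i = 0) /\
    exists2 k, k != 0 & forall i, (F i).@[w0] = k * f0 i.
  apply: (kernel_vector (z0 := w0) (M := contraction) (e := top) (f0 := f0) (D := D2)) => //.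
    by exists i0.
  by move=> w D2w; apply: kernel_exists; apply: D2P.
(* The Gram determinant has to be nonzero at the cubic [F(z)] itself, so it is pulled back to a
   condition on [z]. *)
pose Dg : {mpoly K[N]} := mmap (@mpolyC _ K) F (\det gram).
have [||w [c [Dw c0' gw]]] := cone_dense (F := F) (z0 := w0) (D := D2 * D3 * Dg) (g := g) _ _ g0.
- move=> u uF udF i.
  (* The rows at the base point and [top] span all functionals. Both [u] and the rows kill [f0], on
     which [top] is 1, so [top] has coefficient 0. *)
  have [y yE] : exists y : QI * 'I_5 -> K, forall i, u i = \sum_x y x * (contraction x i).@[w0].
    have [c cE] := D3R w0 D30 u; exists (fun x => c (Some x)).
    suff cN : c None = 0 by move=> j; rewrite -cE cN mul0r add0r.
    have : \sum_i u i * f0 i = 0.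
      apply: (mulfI k0); rewrite mulr0 mulr_sumr -[RHS]uF; apply: eq_bigr => j _.
      by rewrite F0 mulrCA.
    under eq_bigr do rewrite -cE mulrDl mulr_suml -mulrA.
    rewrite big_split exchange_big -mulr_sumr top0 mulr1 /= => <-.
    rewrite [X in _ + X]big1 ?addr0 // => x _.
    by under eq_bigr do rewrite -mulrA; rewrite -mulr_sumr Mf0 mulr0.
  have tangent p q r : \sum_k \sum_l y (k, l) * (\sum_a \sum_b
      dquad_coef (base_point K) (unit_direction K p q r) k a b * klein_tensor K a b l) = 0.
    set j := enum_rank ((p, q, r) : idx).
    have dMF x : \sum_i (contraction x i).@[w0] * (F i)^`M(j).@[w0] =
        - (k * \sum_i (contraction x i)^`M(j).@[w0] * f0 i).
      have /(congr1 (fun P' => P'^`M(j).@[w0])) := MF x.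
      rewrite mderiv0 meval0 mderiv_sum raddf_sum /= => e.
      apply/eqP; rewrite -addr_eq0 mulr_sumr -big_split; apply/eqP; rewrite -[RHS]e.
      by apply: eq_bigr => a _; rewrite mderivM mevalD !mevalM F0 /= addrC mulrCA.
    apply: (mulfI k0); apply: oppr_inj; rewrite mulr0 oppr0 -[RHS](udF j).
    under [RHS]eq_bigr do rewrite yE mulr_suml.
    rewrite [RHS]exchange_big [X in k * X]pair_bigA mulr_sumr -sumrN; apply: eq_bigr => -[a l] _ /=.
    under [RHS]eq_bigr do rewrite -mulrA.
    rewrite -mulr_sumr dMF mulrN mulrCA; congr (- (_ * (_ * _))).
    under [RHS]eq_bigr do rewrite contraction_deriv.
    rewrite contract_cubic; apply: eq_bigr => b _; apply: eq_bigr => c _.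
    by rewrite tri0.
  rewrite yE; have := tangent_annihilator (y := fun k l => y (k, l)) tangent (sym_trilinear (vb i)).
  rewrite pair_bigA => e; rewrite -[RHS]e; apply: eq_bigr => -[a l] _.
  by rewrite contractionE zv0.
- rewrite !mevalM !mulf_neq0 // meval_mmap (meval_eq _ F0) gram_scale mulf_neq0 ?expf_neq0 // gramE.
  have := klein_gram K; rewrite unitmxE unitfE; congr (\det _ != 0).
  by apply/matrixP => i j; rewrite !mxE tri0.
(* The linear system is homogeneous and the Gram determinant of degree 5, so the scalar [c] changes
   neither condition. *)
apply: (noX _ gw); exists w; split=> [x|].
  rewrite PE -[RHS](mulr0 c) -[X in c * X](meval0 w) -(MF x) raddf_sum mulr_sumr.
  by apply: eq_bigr => i _; rewrite /= mevalM mulrCA.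
rewrite mevalM emb_wE emb_vE gram_scale; move: Dw; rewrite [in X in X -> _]mevalM meval_mmap.
by move=> Dw'; rewrite mulrCA mulf_neq0 ?expf_neq0.
Qed.

End GenericCubic.

Theorem theorem0p10 (R : realType) :
  exists U : dhomog 5 R[i] 3 -> Prop,
    [/\ zariski_open U,
        (exists f, U f) &
        forall I : ideal {mpoly R[i][5]},
          homogeneous_ideal I ->
          artinian_gorenstein (gr_quot (A := gr_mpoly R[i] 5) I) ->
          has_hilbert_function (gr_quot (A := gr_mpoly R[i] 5) I)
            [:: 1; 5; 5; 1]%N ->
          forall f : dhomog 5 R[i] 3,
            is_apolar_ideal I f -> U f ->
            exists h : 'I_11 -> spinor_ring R[i],
              [/\ forall i, gr_part 1 (h i),
                  regular_sequence h &
                  gr_isomorphic (gr_quot (A := gr_mpoly R[i] 5) I)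
                                (gr_quot (seq_ideal h))]].
Proof.
pose vb (i : 'I_(\dim {:dhomog 5 R[i] 3})) : {mpoly R[i][5]} := val ((vbasis {:dhomog 5 R[i] 3})`_i).
have vbE v : \sum_i v i *: vb i = val (\sum_i v i *: (vbasis {:dhomog 5 R[i] 3})`_i).
  by rewrite raddf_sum; apply: eq_bigr => i _.
have vb_coord (f : dhomog 5 R[i] 3) : \sum_i coord (vbasis {:dhomog 5 R[i] 3}) i f *: vb i = val f.
  by rewrite vbE -coord_vbasis ?memvf.
have [|||g [g0 gP]] := @generic_apolar R[i] _ vb.
- by move=> i; apply: (valP ((vbasis {:dhomog 5 R[i] 3})`_i)).
- move=> v; rewrite vbE => v0; have /freeP := basis_free (vbasisP {:dhomog 5 R[i] 3}).
  by apply; apply: val_inj.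
- by move=> f hf; exists (fun i => coord (vbasis {:dhomog 5 R[i] 3}) i (DHomog hf)); rewrite vb_coord.
exists (fun f => g.@[fun i => coord (vbasis {:dhomog 5 R[i] 3}) i f] != 0); split.
- by exists (eq^~ g) => f; split=> [gf|[_ ->]] //; exists g.
- have [v gv] := meval_neq0 g0; exists (\sum_i v i *: (vbasis {:dhomog 5 R[i] 3})`_i).
  rewrite (meval_eq _ (v2 := v)) // => i.
  by rewrite coord_sum_free // (basis_free (vbasisP _)).
move=> I _ _ _ f If gf; apply: (gP _ gf).
by rewrite vb_coord.
Qed.
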